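(* Fix an integer $k\ge 2$ and consider the polynomial structural errors-in-variables model $$y = c^{T} z + \beta_0+\beta^T(\xi,\xi^2,\dots,\xi^k)^T + e+\epsilon,\qquad x=\xi+\delta,$$ where $y,\xi,e,\epsilon,\delta,x$ are real random variables, $z$ is a random vector in $\mathbb{R}^q$, and $c\in\mathbb{R}^q$, $\beta_0\in\mathbb{R}$, $\beta\in\mathbb{R}^k$ are nonrandom. Assume: (a) $\xi$, $e$, $z$ and $(\epsilon,\delta)^T$ are independent with finite second moments ($\epsilon$ and $\delta$ may be correlated with each other); (b) $\Sigma_z=\mathbf{Cov}(z)$ is nonsingular and $\sigma_x^2=\mathbf{Var}(x)>0$; (c) $e,\epsilon,\delta$ have zero mean; (d) $\epsilon,\delta,\xi$ are jointly Gaussian. Let $(y_i,z_i,\xi_i,e_i,\epsilon_i,x_i,\delta_i)$, $i=0,1,2,\dots$, be independent copies of the model, let $\hat y_0=\mathbf{E}[y_0\mid z_0,x_0]$ be the best mean squared error individual predictor, and let $\tilde y_0=\tilde y_0^{(n)}$ be the OLS predictor built from $(y_i,z_i,x_i)$, $i=1,\dots,n$, and $(z_0,x_0)$ (defined in the context). Then $\tilde y_0$ is a strongly consistent estimator of $\hat y_0$, i.e. $\tilde y_0\to\hat y_0$ almost surely as $n\to\infty$. Moreover, $$\forall\,\tau>0,\qquad \mathbf{P}\big(|\tilde y_0-\hat y_0|>\tau\,\big|\,z_0,x_0\big)\to0\quad\text{a.s. as }n\to\infty.$$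
   Context: All vectors are columns. For variables $u,v$, $\bar u=\frac1n\sum_{i=1}^n u_i$ (in particular $\overline{x^j}=\frac1n\sum_{i=1}^n x_i^j$) and $S_{uv}=\frac1n\sum_{i=1}^n (u_i-\bar u)(v_i-\bar v)^T$. $A^{+}$ denotes the (Moore–Penrose) pseudo-inverse. With $r=(z^T,x,x^2,\dots,x^k)^T$, the OLS estimators $\hat c\in\mathbb{R}^q$, $\hat\beta_{0x}\in\mathbb{R}$, $\hat\beta_x\in\mathbb{R}^k$ (which minimize $\sum_{i=1}^n(y_i-c^Tz_i-\beta_0-\beta^T(x_i,\dots,x_i^k)^T)^2$) are given by $$\begin{pmatrix}\hat c\\ \hat\beta_x\end{pmatrix}=S_{rr}^{+}S_{ry},\qquad \hat\beta_{0x}=\bar y-\hat c^T\bar z-\hat\beta_x^T(\overline{x},\overline{x^2},\dots,\overline{x^k})^T .$$ The OLS predictor is $\tilde y_0=\hat c^Tz_0+\hat\beta_{0x}+\hat\beta_x^T(x_0,x_0^2,\dots,x_0^k)^T$. *)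

(* Defs.v *)
From HB Require Import structures.
From mathcomp Require Import all_boot all_order all_algebra.
From mathcomp Require Import finmap.
From mathcomp Require Import all_classical all_reals all_analysis.

Set Implicit Arguments.
Unset Strict Implicit.
Unset Printing Implicit Defensive.

Import Order.TTheory GRing.Theory Num.Theory.
Import numFieldNormedType.Exports.

Local Open Scope classical_set_scope.
Local Open Scope ring_scope.

(* The four Penrose conditions. Mathcomp's [pinvmx] is only a partial inverse
   on the row space and does not satisfy the last two. *)
Definition is_mpinv (R : realFieldType) (m n : nat)
    (A : 'M[R]_(m, n)) (B : 'M[R]_(n, m)) : Prop :=
  [/\ A *m B *m A = A, B *m A *m B = B,
      (A *m B)^T = A *m B & (B *m A)^T = B *m A].

Definition mpinv (R : realFieldType) (m n : nat) (A : 'M[R]_(m, n)) :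
  'M[R]_(n, m) := xget 0 [set B | is_mpinv A B].

Lemma row_free_gram_unit (R : realFieldType) (m n : nat) (G : 'M[R]_(m, n)) :
  row_free G -> G *m G^T \in unitmx.
Proof.
move=> Gfree; rewrite -row_free_unit -kermx_eq0; apply/rowV0P => u.
move/sub_kermxP; rewrite mulmxA => uGG.
have uG0 : u *m G = 0.
  have : ((u *m G) *m (u *m G)^T) 0 0 = 0.
    by rewrite trmx_mul mulmxA uGG mul0mx mxE.
  rewrite mxE => /eqP; rewrite psumr_eq0; last first.
    by move=> j _; rewrite [_^T _ _]mxE -expr2 sqr_ge0.
  move=> /allP h; apply/rowP => j; rewrite [RHS]mxE.
  have /implyP/(_ isT) := h j (mem_index_enum j).
  by rewrite [_^T _ _]mxE -expr2 sqrf_eq0 => /eqP.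
by apply: (row_free_inj Gfree); rewrite /= mul0mx.
Qed.

Lemma mpinvP (R : realFieldType) (m n : nat) (A : 'M[R]_(m, n)) :
  is_mpinv A (mpinv A).
Proof.
rewrite /mpinv; case: xgetP => [B _ //|/= noB]; exfalso.
have [r [F [G [AFG uF uG]]]] : exists r (F : 'M[R]_(m, r)) (G : 'M[R]_(r, n)),
    [/\ A = F *m G, F^T *m F \in unitmx & G *m G^T \in unitmx].
  exists (\rank A), (col_base A), (row_base A); split.
  - by rewrite mulmx_base.
  - rewrite -[X in _ *m X]trmxK; apply: row_free_gram_unit.
    by rewrite /row_free mxrank_tr; exact: col_base_full.
  - by apply: row_free_gram_unit; exact: row_base_free.
set iG := invmx (G *m G^T); set iF := invmx (F^T *m F).
have iGT : iG^T = iG by rewrite /iG trmx_inv trmx_mul trmxK.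
have iFT : iF^T = iF by rewrite /iF trmx_inv trmx_mul trmxK.
have AB : A *m (G^T *m iG *m iF *m F^T) = F *m iF *m F^T.
  rewrite AFG -!mulmxA (mulmxA G G^T) (mulmxA (G *m G^T) iG) mulmxV//.
  by rewrite mul1mx.
have BA : G^T *m iG *m iF *m F^T *m A = G^T *m iG *m G.
  rewrite AFG -!mulmxA (mulmxA F^T F) (mulmxA iF (F^T *m F)) mulVmx//.
  by rewrite mul1mx.
apply: (noB (G^T *m iG *m iF *m F^T)); split.
- rewrite AB AFG -!mulmxA (mulmxA F^T F) (mulmxA iF (F^T *m F)) mulVmx//.
  by rewrite mul1mx.
- rewrite BA -!mulmxA (mulmxA G G^T) (mulmxA iG (G *m G^T)) mulVmx//.
  by rewrite mul1mx.
- by rewrite AB !trmx_mul iFT trmxK mulmxA.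
- by rewrite BA !trmx_mul iGT trmxK mulmxA.
Qed.

Lemma mpinv_unique (R : realFieldType) (m n : nat) (A : 'M[R]_(m, n))
    (B C : 'M[R]_(n, m)) : is_mpinv A B -> is_mpinv A C -> B = C.
Proof.
move=> [AB1 AB2 AB3 AB4] [AC1 AC2 AC3 AC4].
have eqAB : A *m B = A *m C.
  by rewrite -{1}AC1 -(mulmxA (A *m C)) -AB3 -AC3 -trmx_mul mulmxA AB1 AC3.
have eqBA : B *m A = C *m A.
  rewrite -{1}AC1 -mulmxA mulmxA -AB4 -AC4 -trmx_mul.
  by rewrite -mulmxA (mulmxA A) AB1.
by rewrite -AB2 eqBA -mulmxA eqAB mulmxA AC2.
Qed.

(* Observations used for estimation are those with indices 1, ..., n. *)
Definition smean (R : realType) (m n : nat) (u : nat -> 'cV[R]_m) : 'cV[R]_m :=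
  n%:R^-1 *: \sum_(1 <= i < n.+1) u i.

Definition scov (R : realType) (m p n : nat)
    (u : nat -> 'cV[R]_m) (v : nat -> 'cV[R]_p) : 'M[R]_(m, p) :=
  n%:R^-1 *: \sum_(1 <= i < n.+1) ((u i - smean n u) *m (v i - smean n v)^T).

Definition dot (R : realType) (m : nat) (u v : 'cV[R]_m) : R := (u^T *m v) 0 0.

(* (t, t^2, ..., t^k)^T *)
Definition powers (R : realType) (k : nat) (t : R) : 'cV[R]_k :=
  \col_(j < k) t ^+ j.+1.

Definition tuple_col (R : realType) (q : nat) (t : q.-tuple R) : 'cV[R]_q :=
  \col_(j < q) tnth t j.

Section ols.
Context (R : realType) (q k : nat).
Variables (y : nat -> R) (z : nat -> 'cV[R]_q) (x : nat -> R).

Let r (i : nat) : 'cV[R]_(q + k) := col_mx (z i) (powers k (x i)).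
Let ycol (i : nat) : 'cV[R]_1 := (y i)%:M.

Definition ols_coef (n : nat) : 'cV[R]_(q + k) :=
  mpinv (scov n r r) *m scov n r ycol.
Definition ols_c (n : nat) : 'cV[R]_q := usubmx (ols_coef n).
Definition ols_beta (n : nat) : 'cV[R]_k := dsubmx (ols_coef n).
Definition ols_beta0 (n : nat) : R :=
  smean n ycol 0 0 - dot (ols_c n) (smean n z)
  - dot (ols_beta n) (smean n (fun i => powers k (x i))).

Definition ols_predictor (n : nat) (z0 : 'cV[R]_q) (x0 : R) : R :=
  dot (ols_c n) z0 + ols_beta0 n + dot (ols_beta n) (powers k x0).
End ols.

Definition independent_systems d (T : measurableType d) (R : realType)
    (P : probability T R) (I : choiceType) (F : I -> set (set T)) : Prop :=
  forall (J : {fset I}) (A : I -> set T),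
    (forall i, i \in J -> F i (A i)) ->
    P (\bigcap_(i in [set` J]) A i) = (\prod_(i <- J) fine (P (A i)))%:E.

Notation sigma_of X := (g_sigma_algebra_preimage X).

(* [normal_prob m 0] is not a Dirac mass in the library. *)
Definition normal_law (R : realType) (m s : R) : set R -> \bar R :=
  if s == 0 then \d_m else normal_prob m s.

Definition gaussian d (T : measurableType d) (R : realType)
    (P : probability T R) (X : T -> R) : Prop :=
  exists m s : R, 0 <= s /\
    forall A : set R, measurable A -> P (X @^-1` A) = normal_law m s A.

(* Degenerate laws are allowed. *)
Definition jointly_gaussian d (T : measurableType d) (R : realType)
    (P : probability T R) (n : nat) (X : 'I_n -> T -> R) : Prop :=
  forall a : 'I_n -> R, gaussian P (fun w => \sum_(i < n) a i * X i w).

(* Z is a version of E[Y | G], for a sub-sigma-algebra G and integrable Y. *)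
Definition is_cond_expectation d (T : measurableType d) (R : realType)
    (P : probability T R) (G : set (set T)) (Y Z : T -> R) : Prop :=
  [/\ sigma_of Z `<=` G,
      P.-integrable setT (EFin \o Z) &
      forall A, G A -> (\int[P]_(w in A) (Z w)%:E = \int[P]_(w in A) (Y w)%:E)%E].

Definition is_cond_probability d (T : measurableType d) (R : realType)
    (P : probability T R) (G : set (set T)) (E : set T) (Z : T -> R) : Prop :=
  is_cond_expectation P G (\1_E : T -> R) Z.

Definition cov_mx d (T : measurableType d) (R : realType)
    (P : probability T R) (q : nat) (z : T -> q.-tuple R) : 'M[R]_q :=
  \matrix_(i < q, j < q)
    fine (covariance P (fun w => tnth (z w) i) (fun w => tnth (z w) j)).

Definition model_vector (T : Type) (R : realType) (q : nat)
    (y : T -> R) (z : T -> q.-tuple R) (xi e eps x delta : T -> R) (w : T) :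
  R * q.-tuple R * R * R * R * R * R :=
  (y w, z w, xi w, e w, eps w, x w, delta w).

Definition same_law d0 (T0 : measurableType d0) d (T : measurableType d)
    d' (U : measurableType d') (R : realType)
    (P0 : probability T0 R) (P : probability T R) (X0 : T0 -> U) (X : T -> U) :
  Prop := forall A : set U, measurable A -> P0 (X0 @^-1` A) = P (X @^-1` A).

(* Main.v *)
From HB Require Import structures.
Require Import Defs.
From mathcomp Require Import all_boot all_order all_algebra.
From mathcomp Require Import finmap.
From mathcomp Require Import all_classical all_reals all_analysis.
From mathcomp Require Import measurable_realfun ring lra.
Set Implicit Arguments.
Unset Strict Implicit.
Unset Printing Implicit Defensive.
Import Order.TTheory GRing.Theory Num.Theory.
Import numFieldNormedType.Exports.
Local Open Scope classical_set_scope.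
Local Open Scope ring_scope.

(** Write [xi = a x + u], where the residual [u] is Gaussian and uncorrelated
with [x], hence independent of it in moments; expanding [(a x + u)^j] shows that
[E(xi^j | x)] is a polynomial of degree at most [j] in [x], and [E(eps | x)] is
affine in [x].  So [y = c^T z + b0 + b^T (x, ..., x^k) + eta] with [eta] orthogonal
to all functions of [(z, x)]: orthogonality to the powers of [x] is a computation,
and it extends to indicators because the law of [x] is determined by its moments.
Hence [E(y | z, x)] is linear in the regressors.  By the strong law of large
numbers (for pairwise independent copies, via truncation and dyadic blocks) the
empirical moments converge, the covariance matrix of the regressors is invertible,
and continuity of matrix inversion gives the convergence of the OLS predictor.
The conditional statement only uses that the exceptional events have a negligible
limsup: if [P(E_n | G) > t] infinitely often on a set of positive measure, then
first-passage decomposition yields subsets of the [E_n] of uniformly positive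
measure infinitely often. *)

(** Joint normality is given only through the laws of linear combinations. Each of these laws yields
    one value of the joint moment generating function, and differentiation turns these values into
    mixed moments, but no factorisation on events comes out directly. Hence [u] and [x] are
    separated in moments only, and indicators of [x] are reached through determinacy. That step
    rests on the integrability of [exp (lam x^2)] for some [lam > 0]. It is run on the nonnegative
    variables [(x - a)^2], because the functions [exp (- mu Q)] are bounded only for [Q >= 0].

    In the conditional statement the versions of the conditional probabilities are arbitrary, and no
    measurability of the exceptional events is established: the predictor contains a pseudo-inverse
    picked by [xget]. The integral of a nonnegative function is still a supremum over simple
    functions below it, so each event is replaced by a measurable subset before any measure is
    estimated; the limsup enters only as a negligible set. *)

Local Notation intg P f := ((P : set _ -> \bar _).-integrable setT (EFin \o f)).
Local Notation Ex P f := (Rintegral P setT f).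

(** * Expectations *)

Section expectation.
Context d (T : measurableType d) (R : realType) (P : probability T R).
Implicit Types (f g : T -> R) (A : set T).

Lemma intg_measurable f : intg P f -> measurable_fun setT f.
Proof. by move=> /measurable_int/measurable_EFinP. Qed.

Lemma intgD f g : intg P f -> intg P g -> intg P (fun w => f w + g w).
Proof. by move=> fi gi; exact: (integrableD measurableT fi gi). Qed.

Lemma intgB f g : intg P f -> intg P g -> intg P (fun w => f w - g w).
Proof. by move=> fi gi; exact: (integrableB measurableT fi gi). Qed.

Lemma intgZ (a : R) f : intg P f -> intg P (fun w => a * f w).
Proof. by move=> fi; exact: (integrableZl measurableT a fi). Qed.

Lemma intg_cst (a : R) : intg P (fun=> a).
Proof. exact: finite_measure_integrable_cst. Qed.

Lemma intg_sum (I : Type) (s : seq I) (p : pred I) (F : I -> T -> R) :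
  (forall i, p i -> intg P (F i)) -> intg P (fun w => \sum_(i <- s | p i) F i w).
Proof.
move=> Fi; have := integrable_sum measurableT s Fi.
by apply: eq_integrable => // w _; rewrite /= sumEFin.
Qed.

Lemma intg_le f g : measurable_fun setT f -> intg P g ->
  (forall w, `|f w| <= g w) -> intg P f.
Proof.
move=> mf gi fg; apply: le_integrable gi => //; first exact/measurable_EFinP.
by move=> w _ /=; rewrite lee_fin (le_trans (fg w))// ler_norm.
Qed.

Lemma intg_norm f : intg P f -> intg P (fun w => `|f w|).
Proof. exact: integrable_norm. Qed.

Lemma intg_indic A : measurable A -> intg P (\1_A : T -> R).
Proof. exact: integrable_indic. Qed.

Lemma intg_mul f g : measurable_fun setT f -> measurable_fun setT g ->
  intg P (fun w => f w ^+ 2) -> intg P (fun w => g w ^+ 2) ->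
  intg P (fun w => f w * g w).
Proof.
move=> mf mg fi gi; apply: (intg_le _ (intgD fi gi)); first exact: measurable_funM.
move=> w; rewrite normrM -(real_normK (num_real (f w))).
rewrite -(real_normK (num_real (g w))).
by have := normr_ge0 (f w); have := normr_ge0 (g w);
  move: `|f w| `|g w| => a b; nra.
Qed.

Lemma intg_sqr f : measurable_fun setT f -> intg P (fun w => f w ^+ 2) -> intg P f.
Proof.
move=> mf fi; rewrite (_ : f = fun w => f w * 1); last by apply/funext => w; rewrite mulr1.
by apply: intg_mul => //; under eq_fun do rewrite expr1n; exact: intg_cst.
Qed.

Lemma intgMindic f A : measurable A -> intg P f -> intg P (fun w => f w * \1_A w).
Proof.
move=> mA fi; apply: (intg_le _ (intg_norm fi)).
  by apply: measurable_funM; [exact: intg_measurable|exact: measurable_indic].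
by move=> w; rewrite normrM indicE; case: (_ \in _); rewrite ?normr1 ?mulr1// normr0 mulr0.
Qed.

Lemma ExD f g : intg P f -> intg P g -> Ex P (fun w => f w + g w) = Ex P f + Ex P g.
Proof. exact: RintegralD. Qed.

Lemma ExB f g : intg P f -> intg P g -> Ex P (fun w => f w - g w) = Ex P f - Ex P g.
Proof. exact: RintegralB. Qed.

Lemma ExZ (a : R) f : intg P f -> Ex P (fun w => a * f w) = a * Ex P f.
Proof. exact: RintegralZl. Qed.

Lemma Ex_cst (a : R) : Ex P (fun=> a) = a.
Proof. by rewrite Rintegral_cst// [X in fine X]probability_setT mulr1. Qed.

Lemma Ex_sum (I : Type) (s : seq I) (p : pred I) (F : I -> T -> R) :
  (forall i, p i -> intg P (F i)) ->
  Ex P (fun w => \sum_(i <- s | p i) F i w) = \sum_(i <- s | p i) Ex P (F i).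
Proof.
move=> Fi; elim: s => [|i s ih].
  by under eq_Rintegral do rewrite big_nil; rewrite Ex_cst big_nil.
rewrite big_cons; under eq_Rintegral do rewrite big_cons.
case: ifPn => // pi; rewrite ExD ?ih//; first exact: Fi.
exact: intg_sum.
Qed.

Lemma Ex_le f g : intg P f -> intg P g -> (forall w, f w <= g w) -> Ex P f <= Ex P g.
Proof. by move=> fi gi fg; apply: le_Rintegral. Qed.

Lemma Ex_ge0 f : (forall w, 0 <= f w) -> 0 <= Ex P f.
Proof. by move=> f0; apply: Rintegral_ge0. Qed.

Lemma Ex_indic A : measurable A -> Ex P (\1_A : T -> R) = fine (P A).
Proof. by move=> mA; rewrite /Rintegral integral_indic// setIT. Qed.

Lemma ExEFin f : intg P f -> (\int[P]_w (f w)%:E)%E = (Ex P f)%:E.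
Proof. by move=> fi; rewrite fineK//; exact: (integrable_fin_num measurableT fi). Qed.

Lemma Ex_setE f A : measurable A ->
  \int[P]_(w in A) f w = Ex P (fun w => f w * \1_A w).
Proof.
move=> mA; rewrite Rintegral_mkcond; apply: eq_Rintegral => w _.
by rewrite patchE indicE; case: (_ \in _); rewrite ?mulr1 ?mulr0.
Qed.

Lemma Ex_dominated (F : nat -> T -> R) f g :
  (forall n, measurable_fun setT (F n)) -> measurable_fun setT f -> intg P g ->
  (forall w, F n w @[n --> \oo] --> f w) ->
  (forall n w, `|F n w| <= g w) ->
  intg P f /\ Ex P (F n) @[n --> \oo] --> Ex P f.
Proof.
move=> mF mf gi Ff Fg.
have [|||||fi _ cv] := @dominated_convergence _ T R P setT measurableT
  (fun n w => (F n w)%:E) (fun w => (f w)%:E) (EFin \o g).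
- by move=> n; exact/measurable_EFinP.
- exact/measurable_EFinP.
- by apply: aeW => w _; apply/fine_cvgP; split; [exact: nearW|exact: Ff].
- exact: gi.
- by apply: aeW => w n _; rewrite /= lee_fin.
split; first exact: fi.
by apply: fine_cvg; rewrite -ExEFin.
Qed.

Lemma Ex_eq0_ae f : intg P f -> (forall w, 0 <= f w) -> Ex P f = 0 ->
  {ae P, forall w, f w = 0}.
Proof.
move=> fi f0 Ef; have : (\int[P]_w `|(f w)%:E| = 0)%E.
  under eq_integral do rewrite gee0_abs ?lee_fin//.
  by rewrite ExEFin// Ef.
move/ae_eq_integral_abs => /(_ measurableT (measurable_int _ fi)).
by apply: filterS => w /(_ I) [].
Qed.

Lemma ae_and (Q1 Q2 : T -> Prop) : {ae P, forall w, Q1 w} -> {ae P, forall w, Q2 w} ->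
  {ae P, forall w, Q1 w /\ Q2 w}.
Proof. by apply: filterS2 => w. Qed.

End expectation.

(** * Independence *)

Definition indep2 d (T : measurableType d) (R : realType) (P : probability T R)
    d1 (U : measurableType d1) d2 (V : measurableType d2) (X : T -> U) (Y : T -> V) :=
  forall A B, measurable A -> measurable B ->
  P (X @^-1` A `&` Y @^-1` B) = (P (X @^-1` A) * P (Y @^-1` B))%E.

Section independence.
Context d (T : measurableType d) (R : realType) (P : probability T R).
Implicit Types W : T -> R.

Lemma Ex_pi_lambda d1 (U : measurableType d1) (G : set (set U)) (f : T -> U) W :
  measurable_fun setT f -> intg P W -> @measurable _ U = <<s G >> ->
  setI_closed G -> Ex P W = 0 ->
  (forall A, G A -> Ex P (fun w => W w * \1_A (f w)) = 0) ->
  forall A, measurable A -> Ex P (fun w => W w * \1_A (f w)) = 0.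
Proof.
move=> mf iW mG GI W0 GW A mA.
have iWA B : measurable B -> intg P (fun w => W w * \1_B (f w)).
  move=> mB; have mfB : measurable (f @^-1` B) by rewrite -[X in measurable X]setTI; exact: mf.
  exact: intgMindic mfB iW.
pose H := [set B : set U | measurable B /\ Ex P (fun w => W w * \1_B (f w)) = 0].
suff /(_ A) : @measurable _ U `<=` H by case.
have mGB B : G B -> measurable B by move=> GB; rewrite mG; exact: sub_sigma_algebra.
rewrite mG; apply: (@lambda_system_subset _ G GI setT) => //; last first.
  by move=> B GB; split; [exact: mGB|exact: GW].
split => //.
- split => //; under eq_Rintegral do rewrite indicT mulr1.
  exact: W0.
- move=> B C CB [mB B0] [mC C0]; split; first exact: measurableD.
  have -> : (fun w => W w * \1_(B `\` C) (f w)) =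
            (fun w => W w * \1_B (f w) - W w * \1_C (f w)).
    apply/funext => w; rewrite -mulrBr !indicE in_setD; congr (_ * _).
    have : f w \in C -> f w \in B by rewrite !inE; exact: CB.
    by case: (f w \in C) => /= [->//|_]; rewrite ?andbF ?andbT ?subrr ?subr0.
  by rewrite ExB ?B0 ?C0 ?subr0//; exact: iWA.
- move=> F ndF HF; split; first by apply: bigcup_measurable => i _; case: (HF i).
  have mF i : measurable (F i) by case: (HF i).
  have [|||||_ +] := @Ex_dominated _ T R P (fun n w => W w * \1_(F n) (f w))
      (fun w => W w * \1_(\bigcup_n F n) (f w)) (fun w => `|W w|).
  + by move=> n; apply: intg_measurable; exact: iWA.
  + by apply: intg_measurable; apply: iWA; exact: bigcupT_measurable.
  + exact: intg_norm.
  + move=> w; apply: cvgMr; apply: (@cvg_near_cst _ _ _ _ _ _ _).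
    have [[n _ Fn]|nF] := pselect ((\bigcup_n F n) (f w)).
      exists n => // m /= nm; rewrite !indicE mem_set; last first.
        by move: (f w) Fn; exact/subsetPset/ndF.
      by rewrite mem_set//; exists n.
    near=> m; rewrite !indicE [in RHS]memNset// memNset// => Fm.
    by apply: nF; exists m.
  + move=> n w; rewrite normrM indicE; case: (_ \in _); rewrite ?normr1 ?mulr1//.
    by rewrite normr0 mulr0.
  rewrite (_ : (fun n => _) = fun=> 0); last by apply/funext => n; case: (HF n).
  by move/(cvg_unique (@Rhausdorff R)) => /(_ _ (cvg_cst 0)) ->.
Unshelve. all: by end_near. Qed.

Context d1 (U : measurableType d1) d2 (V : measurableType d2).

Lemma indep2_comp d3 (U' : measurableType d3) d4 (V' : measurableType d4)
  (X : T -> U) (Y : T -> V) (f : U -> U') (g : V -> V') :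
  measurable_fun setT f -> measurable_fun setT g ->
  indep2 P X Y -> indep2 P (fun w => f (X w)) (fun w => g (Y w)).
Proof.
move=> mf mg XY A B mA mB.
have := XY (f @^-1` A) (g @^-1` B); apply.
  by rewrite -[X in measurable X]setTI; exact: mf.
by rewrite -[X in measurable X]setTI; exact: mg.
Qed.

(** Independence on rectangles makes the law of [(X, Y)] the product of the two laws. Tonelli then
    gives integrability of the product, and Fubini factors its integral. *)
Lemma Ex_indepM (X Y : T -> R) : indep2 P X Y -> intg P X -> intg P Y ->
  intg P (fun w => X w * Y w) /\ Ex P (fun w => X w * Y w) = Ex P X * Ex P Y.
Proof.
move=> XY iX iY.
have mX := intg_measurable iX; have mY := intg_measurable iY.
pose X' : {mfun T >-> R} := HB.pack X (isMeasurableFun.Build _ _ _ _ _ mX).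
pose Y' : {mfun T >-> R} := HB.pack Y (isMeasurableFun.Build _ _ _ _ _ mY).
have mXY : measurable_fun setT (fun w => (X w, Y w)) by exact/measurable_fun_pair.
pose XY' : {mfun T >-> (R * R)%type} :=
  HB.pack (fun w => (X w, Y w)) (isMeasurableFun.Build _ _ _ _ _ mXY).
pose p := (distribution P X' \x distribution P Y')%E.
have pE A : measurable A -> p A = distribution P XY' A.
  by move=> mA; apply: product_measure_unique => // B C mB mC; exact: XY.
have mM : measurable_fun setT (fun u : R * R => (u.1 * u.2)%:E).
  by apply/measurable_EFinP; apply: measurable_funM; [exact: measurable_fst|exact: measurable_snd].
have iX' : (distribution P X').-integrable setT EFin.
  by apply: integrable_pushforward => //; exact/measurable_EFinP.
have iY' : (distribution P Y').-integrable setT EFin.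
  by apply: integrable_pushforward => //; exact/measurable_EFinP.
have EX : (\int[distribution P X']_x x%:E)%E = (Ex P X)%:E.
  rewrite -ExEFin//; apply: integral_distribution => //; exact/measurable_EFinP.
have EY : (\int[distribution P Y']_x x%:E)%E = (Ex P Y)%:E.
  rewrite -ExEFin//; apply: integral_distribution => //; exact/measurable_EFinP.
have ip : p.-integrable setT (fun u : R * R => (u.1 * u.2)%:E).
  apply/integrable12ltyP => //=.
  under eq_integral => x _.
    under eq_integral => y _ do rewrite normrM EFinM.
    rewrite ge0_integralZl//=; last first.
      by apply/measurable_EFinP; exact: normr_measurable.
    over.
  rewrite ge0_integralZr//=; last 2 first.
    by apply/measurable_EFinP; exact: normr_measurable.
    by apply: integral_ge0 => y _; rewrite lee_fin.
  by apply: lte_mul_pinfty; rewrite ?integral_ge0//;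
    [rewrite ge0_fin_numE ?integral_ge0//|]; have /integrableP[_ ] := iX'; have /integrableP[_ ] := iY'.
have idis : (distribution P XY').-integrable setT (fun u : R * R => (u.1 * u.2)%:E).
  apply/integrableP; split => //.
  by have /integrableP[_] := ip; rewrite (eq_measure_integral (distribution P XY'))// => A mA _; exact: pE.
have iXY : intg P (fun w => X w * Y w).
  apply/integrableP; split; first exact/measurable_EFinP/measurable_funM.
  have /integrableP[_] := idis; rewrite ge0_integral_distribution//.
  exact: measurableT_comp.
split=> //; rewrite -[RHS]/(fine (Ex P X * Ex P Y)%:E); congr fine.
transitivity (\int[distribution P XY']_u (u.1 * u.2)%:E)%E.
  by rewrite integral_distribution.
rewrite (eq_measure_integral p); last by move=> A mA _; exact/esym/pE.
rewrite -integral12_prod_meas1// /fubini_F /=.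
under eq_integral => x _.
  under eq_integral => y _ do rewrite EFinM.
  rewrite integralZl//= EY; over.
by rewrite /= integralZr//= EX.
Qed.

End independence.

(** Apply the Dynkin argument to the centred weight [\1_E - P E]: its mean over the preimage of [D]
    is exactly the defect of independence between that preimage and [E]. *)
Lemma pair_indep_event d (T : measurableType d) (R : realType) (P : probability T R)
  d1 (U : measurableType d1) d2 (V : measurableType d2)
  (X : T -> U) (Y : T -> V) (E : set T) :
  measurable_fun setT X -> measurable_fun setT Y -> measurable E ->
  (forall A B, measurable A -> measurable B ->
   P (X @^-1` A `&` Y @^-1` B `&` E) = (P (X @^-1` A `&` Y @^-1` B) * P E)%E) ->
  forall D, measurable D ->
  P ((fun w => (X w, Y w)) @^-1` D `&` E) = (P ((fun w => (X w, Y w)) @^-1` D) * P E)%E.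
Proof.
move=> mX mY mE XYE D mD.
have mXY : measurable_fun setT (fun w => (X w, Y w)) by exact/measurable_fun_pair.
have pre B : measurable B -> measurable ((fun w => (X w, Y w)) @^-1` B).
  by move=> mB; rewrite -[S in measurable S]setTI; exact: mXY.
have fP A : measurable A -> P A \is a fin_num by move=> mA; exact: fin_num_measure.
have expand B : measurable B -> Ex P (fun w => (\1_E w - fine (P E)) * \1_B (X w, Y w)) =
    fine (P ((fun w => (X w, Y w)) @^-1` B `&` E)) -
    fine (P E) * fine (P ((fun w => (X w, Y w)) @^-1` B)).
  move=> mB; have mB' := pre B mB; have mBE := measurableI _ _ mB' mE.
  under eq_Rintegral do rewrite mulrBl.
  have e1 : (fun w => \1_E w * \1_B (X w, Y w)) =
      \1_((fun w => (X w, Y w)) @^-1` B `&` E) :> (T -> R).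
    by apply/funext => w; rewrite [LHS]mulrC [RHS]indicE in_setI -mulnb natrM.
  have e2 : (fun w => fine (P E) * \1_B (X w, Y w)) =
      (fun w => fine (P E) * \1_((fun w => (X w, Y w)) @^-1` B) w) by [].
  rewrite ExB; [|by rewrite e1; exact: intg_indic|by rewrite e2; apply: intgZ; exact: intg_indic].
  by rewrite e1 e2 ExZ ?Ex_indic//; exact: intg_indic.
suff key : Ex P (fun w => (\1_E w - fine (P E)) * \1_D (X w, Y w)) = 0.
  move: key; rewrite expand// => /subr0_eq EE.
  have mDE := measurableI _ _ (pre _ mD) mE.
  by rewrite -[LHS](fineK (fP _ mDE)) EE EFinM (fineK (fP _ mE)) (fineK (fP _ (pre _ mD))) muleC.
move: D mD; apply: (@Ex_pi_lambda _ T R P _ (U * V)%type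
  [set A | exists A1, measurable A1 /\ exists A2, measurable A2 /\ A = A1 `*` A2]) => //.
- by apply: intgB; [exact: intg_indic|exact: intg_cst].
- rewrite measurable_prod_measurableType //; congr (<<s _ >>).
  rewrite predeqE; split => [[A mA [B mB <-]]|[A [mA [B [mB ->]]]]].
    by exists A; split => //; exists B.
  by exists A => //; exists B.
- move=> /= _ _ [X1 [mX1 [X2 [mX2 ->]]]] [Y1 [mY1 [Y2 [mY2 ->]]]].
  rewrite -setXI; exists (X1 `&` Y1); split; first exact: measurableI.
  by exists (X2 `&` Y2); split => //; exact: measurableI.
- by rewrite ExB ?Ex_cst ?Ex_indic ?subrr//; [exact: intg_indic|exact: intg_cst].
- move=> _ [A [mA [B [mB ->]]]]; have mAB := measurableX mA mB.
  rewrite expand//; have := XYE A B mA mB.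
  rewrite (_ : X @^-1` A `&` Y @^-1` B = (fun w => (X w, Y w)) @^-1` (A `*` B))// => ->.
  by rewrite (fineM (fP _ (pre _ mAB)) (fP _ mE)) mulrC subrr.
Qed.

Lemma indep2_pair d (T : measurableType d) (R : realType) (P : probability T R)
  d1 (U : measurableType d1) d2 (V : measurableType d2) d3 (S : measurableType d3)
  (X : T -> U) (Y : T -> V) (Z : T -> S) :
  measurable_fun setT X -> measurable_fun setT Y -> measurable_fun setT Z ->
  (forall A B C, measurable A -> measurable B -> measurable C ->
   P (X @^-1` A `&` Y @^-1` B `&` Z @^-1` C) =
   (P (X @^-1` A) * P (Y @^-1` B) * P (Z @^-1` C))%E) ->
  indep2 P (fun w => (X w, Y w)) Z.
Proof.
move=> mX mY mZ XYZ D C mD mC; apply: pair_indep_event => //.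
  by rewrite -[E in measurable E]setTI; exact: mZ.
move=> A B mA mB; rewrite XYZ//; congr (_ * _)%E.
have := XYZ A B setT mA mB measurableT.
by rewrite preimage_setT setIT probability_setT mule1.
Qed.

(** * Expectations under equal laws *)

Section law_transfer.
Context d0 (T0 : measurableType d0) d (T : measurableType d) (R : realType).
Variables (P0 : probability T0 R) (P : probability T R).
Context dU (U : measurableType dU) (X0 : T0 -> U) (X : T -> U).
Hypotheses (mX0 : measurable_fun setT X0) (mX : measurable_fun setT X).
Hypothesis XX : same_law P0 P X0 X.
Variable f : U -> R.
Hypothesis mf : measurable_fun setT f.

Let X0' : {mfun T0 >-> U} := HB.pack X0 (isMeasurableFun.Build _ _ _ _ _ mX0).
Let X' : {mfun T >-> U} := HB.pack X (isMeasurableFun.Build _ _ _ _ _ mX).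

Lemma same_law_intg : intg P0 (fun w => f (X0 w)) -> intg P (fun w => f (X w)).
Proof.
move=> /integrableP[_ foo]; apply/integrableP; split.
  exact/measurable_EFinP/measurableT_comp.
have mf' : measurable_fun setT (fun u => `|(f u)%:E|%E).
  by apply/measurableT_comp => //; exact/measurable_EFinP.
have <- := @ge0_integral_distribution _ _ _ _ _ P X' _ mf' (fun=> abse_ge0 _).
rewrite (eq_measure_integral (distribution P0 X0')).
  by rewrite ge0_integral_distribution.
by move=> A mA _; exact/esym/XX.
Qed.

Lemma same_law_Ex : intg P0 (fun w => f (X0 w)) ->
  Ex P (fun w => f (X w)) = Ex P0 (fun w => f (X0 w)).
Proof.
move=> fi; have fi' := same_law_intg fi; congr fine.
have mf' : measurable_fun setT (EFin \o f) by exact/measurable_EFinP.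
have <- := @integral_distribution _ _ _ _ _ P0 X0' _ mf' fi.
have <- := @integral_distribution _ _ _ _ _ P X' _ mf' fi'.
by apply: eq_measure_integral => A mA _; exact/esym/XX.
Qed.

End law_transfer.

(** The points [2^j m] with [p <= m < 2p] and [p = 2^l] cut the integers into blocks whose endpoints
    have ratio at most [1 + 1/p]. By monotonicity an average inside a block is squeezed between
    those at its ends. Integer multiples of powers of two thus play the part of a geometric sequence
    with ratio close to 1. *)
Lemma dyadic_average_cvg (R : realType) (s : nat -> R) (a : R) :
  0 <= a -> (forall m n, (m <= n)%N -> s m <= s n) -> s 0%N = 0 ->
  (forall m, (0 < m)%N ->
     (2 ^ j * m)%:R^-1 * s (2 ^ j * m)%N @[j --> \oo] --> a) ->
  n%:R^-1 * s n @[n --> \oo] --> a.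
Proof.
move=> a0 s_nd s0 blocks; apply/cvgrPdist_le => e e0.
(* The errors to absorb are [(1 + del)(a + del) - a] and [a - (1 - del)(a - del)]; for [del <= 1]
   both are at most [del (a + 2)]. *)
pose del := Num.min 1 (e / (a + 2)).
have del0 : 0 < del by rewrite lt_min ltr01 divr_gt0// ltr_wpDl.
have del1 : del <= 1 by rewrite ge_min lexx.
have dele : del * (a + 2) <= e.
  by rewrite -ler_pdivlMr ?ltr_wpDl// ge_min lexx orbT.
have [l ldel] : exists l, ((2 ^ l)%:R : R)^-1 <= del.
  have := @cvg_geometric R 1 2^-1; rewrite ger0_norm// invf_lt1// ltr1n => /(_ isT).
  move=> /cvgrPdist_le/(_ _ del0)[l _ /(_ _ (leqnn l))].
  rewrite sub0r normrN /geometric /= mul1r => h; exists l.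
  by rewrite natrX -exprVn; apply: le_trans h; exact: ler_norm.
pose p := (2 ^ l)%N.
(* Only finitely many multipliers occur, so one [J] serves them all. The range includes [2p] because
   the upper endpoint uses [m + 1] with [m < 2p]. *)
have [J _ HJ] : \forall j \near \oo, forall m : 'I_(2 * p).+1, (0 < m)%N ->
    `|a - (2 ^ j * m)%:R^-1 * s (2 ^ j * m)%N| <= del.
  apply: filter_forall => m; case: (posnP m) => [->|m0]; first exact: nearW.
  by have /cvgrPdist_le/(_ _ del0) := blocks _ m0; apply: filterS.
exists (2 ^ (J + l))%N => // n /= Jn.
have n0 : (0 < n)%N by rewrite (leq_trans _ Jn)// expn_gt0.
pose t := trunc_log 2 n; have /andP[tn nt] := trunc_log_bounds (isT : 1 < 2)%N n0.
have Jt : (J + l <= t)%N by rewrite trunc_log_max.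
(* Dropping the last [j] binary digits of [n] keeps its [l + 1] leading ones, which is why
   [p <= m < 2p]. *)
pose j := (t - l)%N; have jl : (j + l = t)%N by rewrite subnK// (leq_trans (leq_addl _ _) Jt).
have Jj : (J <= j)%N by rewrite leq_subRL ?(leq_trans (leq_addl _ _) Jt)// addnC.
pose m := (n %/ 2 ^ j)%N.
have pm : (p <= m)%N by rewrite leq_divRL ?expn_gt0// -expnD addnC jl.
have p0 : (0 < p)%N by rewrite expn_gt0.
have m0 : (0 < m)%N by rewrite (leq_trans p0).
have mp : (m < 2 * p)%N by rewrite ltn_divLR ?expn_gt0// -expnS -expnD addSn addnC jl.
have mn : (2 ^ j * m <= n)%N by rewrite mulnC leq_trunc_div.
have nm : (n <= 2 ^ j * m.+1)%N by rewrite mulnC ltnW// ltn_ceil ?expn_gt0.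
have /= := HJ _ Jj (Ordinal (leqW mp)) m0.
have /= := HJ _ Jj (Ordinal (mp : (m.+1 < (2 * p).+1)%N)) isT.
have sm := s_nd _ _ mn; have sM := s_nd _ _ nm.
rewrite !ler_distlC => /andP[_ U] /andP[L _].
have nR : 0 < n%:R :> R by rewrite ltr0n.
have jm0 : 0 < (2 ^ j * m)%:R :> R by rewrite ltr0n muln_gt0 expn_gt0.
have jM0 : 0 < (2 ^ j * m.+1)%:R :> R by rewrite ltr0n muln_gt0 expn_gt0.
rewrite ler_pdivrMl// in U; rewrite ler_pdivlMl// in L.
have mR : (del * m%:R >= 1).
  have p0R : 0 < p%:R :> R by rewrite ltr0n.
  have : del * p%:R >= 1 by rewrite -ler_pdivrMr// mul1r.
  by move=> h; apply: (le_trans h); rewrite ler_pM2l// ler_nat.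
have Mn : (2 ^ j * m.+1)%:R <= n%:R * (1 + del) :> R.
  have -> : (2 ^ j * m.+1)%:R = (2 ^ j * m)%:R + (2 ^ j)%:R :> R by rewrite mulnS addnC natrD.
  rewrite mulrDr mulr1 lerD ?ler_nat//.
  apply: (@le_trans _ _ ((2 ^ j * m)%:R * del)); last by apply: ler_wpM2r; [exact: ltW|rewrite ler_nat].
  by rewrite natrM -mulrA ler_peMr// mulrC.
have mN : n%:R * (1 - del) <= (2 ^ j * m)%:R :> R.
  have n1 : n%:R <= (2 ^ j * m)%:R * (1 + del).
    apply: le_trans (_ : (2 ^ j * m.+1)%:R <= _); first by rewrite ler_nat.
    rewrite mulnS natrD [_ + (_ * m)%:R]addrC mulrDr mulr1 lerD2l natrM -mulrA ler_peMr//.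
    by rewrite mulrC.
  nra.
apply/andP; split.
- rewrite ler_pdivlMl//; apply: le_trans sm; apply: le_trans L.
  have dle : del <= e by nra.
  (* If [a <= del], the factor [a - del] is nonpositive and the count [2^j m] must be bounded above
     by [n] rather than below. *)
  have [ad|ad] := leP a del.
    apply: (@le_trans _ _ (n%:R * (a - del))); first by rewrite ler_wpM2l// lerB.
    by apply: ler_wnM2r; rewrite ?subr_le0// ler_nat.
  apply: (@le_trans _ _ (n%:R * (1 - del) * (a - del))); last by rewrite ler_wpM2r// subr_ge0 ltW.
  rewrite -mulrA ler_wpM2l//; nra.
- rewrite ler_pdivrMl//; apply: le_trans sM _; apply: le_trans U _.
  apply: (@le_trans _ _ (n%:R * (1 + del) * (a + del))); first by apply: ler_wpM2r => //; rewrite addr_ge0// ltW.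
  rewrite -mulrA ler_wpM2l//; nra.
Qed.

(** * Strong law of large numbers *)

(** A sum of doubling terms is at most twice its last term, and the last term counted is below [x].
    The second conjunct carries the geometric sum through the induction. *)
Lemma dyadic_tail_bound (R : realType) (x : R) (m J : nat) : 0 <= x ->
  \sum_(0 <= j < J) (2 ^ j * m)%:R * ((2 ^ j * m)%:R < x)%R%:R <= 2 * x.
Proof.
move=> x0; suff: \sum_(0 <= j < J) (2 ^ j * m)%:R * ((2 ^ j * m)%:R < x)%R%:R <= 2 * x /\
  \sum_(0 <= j < J) (2 ^ j * m)%:R * ((2 ^ j * m)%:R < x)%R%:R <= (2 ^ J * m)%:R :> R by case.
elim: J => [|J [IH1 IH2]]; first by rewrite big_geq// mulr_ge0.
rewrite big_nat_recr//=.
have -> : (2 ^ J.+1 * m)%:R = 2 * (2 ^ J * m)%:R :> R by rewrite expnS -mulnA natrM.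
move: IH1 IH2; set S := \sum_(_ <= _ < _) _; set c := (2 ^ J * m)%:R.
have c0 : 0 <= c by rewrite /c.
by case: ltP => cx IH1 IH2; rewrite ?mulr1 ?mulr0; split; lra.
Qed.

(** Once [2^j m] has reached [x], the terms halve at each step and the first of them is at most
    [x]. *)
Lemma dyadic_head_bound (R : realType) (x : R) (m J : nat) : 0 <= x -> (0 < m)%N ->
  \sum_(0 <= j < J) (2 ^ j * m)%:R^-1 * (x * (x <= (2 ^ j * m)%:R)%R%:R) ^+ 2 <= 2 * x.
Proof.
move=> x0 m0; pose c J := (2 ^ J * m)%:R : R.
have c0 i : 0 < c i by rewrite ltr0n muln_gt0 expn_gt0.
have cS i : c i.+1 = 2 * c i by rewrite /c expnS -mulnA natrM.
have xc i : x ^+ 2 / c i = x * (x / c i) by rewrite expr2 mulrA.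
pose S J := \sum_(0 <= j < J) (c j)^-1 * (x * (x <= c j)%R%:R) ^+ 2.
have xci i : 0 <= x ^+ 2 / c i by rewrite divr_ge0// ?sqr_ge0// ltW.
(* The sum runs over [j < J], so its last threshold is [c J / 2]; hence the case split at [2 x]. The
   subtracted [2 x^2 / c J] is the whole remaining tail of the geometric series, which makes the
   bound inductive. *)
have [H1 H2] : (c J < 2 * x -> S J = 0) /\ (2 * x <= c J -> S J <= 2 * x - 2 * (x ^+ 2 / c J)).
  elim: J => [|J [IH1 IH2]].
    split; first by rewrite /S big_geq.
    move=> xc0; rewrite /S big_geq// xc.
    have : x / c 0%N <= 1 by rewrite ler_pdivrMr// mul1r; lra.
    by move: (x / _) => u u1; nra.
  rewrite /S big_nat_recr//= -/(S J) cS; split.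
    move=> cx; have cx' : c J < x by lra.
    by rewrite IH1 ?leNgt ?cx' ?mulr0 ?expr0n ?mulr0 ?addr0//; have := c0 J; lra.
  move=> cx; have cx' : x <= c J by lra.
  have e (a : R) : a != 0 -> 2 * (x ^+ 2 / (2 * a)) = x ^+ 2 / a by move=> a0; field.
  rewrite cx' mulr1 [_^-1 * _]mulrC e ?gt_eqF//.
  have [cx2|cx2] := ltP (c J) (2 * x).
    rewrite IH1// add0r xc.
    have : x / c J <= 1 by rewrite ler_pdivrMr// mul1r.
    by move: (x / _) => u u1; nra.
  by have := IH2 cx2; lra.
have [cx|cx] := ltP (c J) (2 * x); first by rewrite -/(S J) H1// mulr_ge0.
by rewrite -/(S J) (le_trans (H2 cx))// gerBl mulr_ge0.
Qed.

Lemma measurable_fun_bigsum d (T : measurableType d) (R : realType) (I : Type)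
    (s : seq I) (F : I -> T -> R) : (forall i, measurable_fun setT (F i)) ->
  measurable_fun setT (fun w => \sum_(i <- s) F i w).
Proof.
move=> mF; elim: s => [|i s ih]; first by under eq_fun do rewrite big_nil; exact: measurable_cst.
by under eq_fun do rewrite big_cons; exact: measurable_funD.
Qed.

Section slln_nonneg.
Context d (T : measurableType d) (R : realType) (P : probability T R).
Variable X : nat -> T -> R.
Hypothesis mX : forall i, measurable_fun setT (X i).
Hypothesis iX : intg P (X 0%N).
Hypothesis sameX : forall i, same_law P P (X 0%N) (X i).
Hypothesis pwX : forall i j, i != j -> indep2 P (X i) (X j).
Hypothesis X_ge0 : forall i w, 0 <= X i w.

Let trunc (c x : R) : R := x * (x <= c)%R%:R.
Let tail (c x : R) : R := (c < x)%R%:R.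

Let mtrunc c : measurable_fun setT (trunc c).
Proof.
rewrite (_ : trunc c = fun x => x * \1_[set` `]-oo, c]] x).
  by apply: measurable_funM => //; exact: measurable_indic.
by apply/funext => x; rewrite /trunc indicE mem_setE in_itv.
Qed.

Let mtail c : measurable_fun setT (tail c).
Proof.
rewrite (_ : tail c = \1_[set` `]c, +oo[]); first exact: measurable_indic.
by apply/funext => x; rewrite /tail indicE mem_setE in_itv andbT.
Qed.

Let trunc_bound (c x : R) : 0 <= x -> 0 <= c -> `|trunc c x| <= c.
Proof.
by move=> x0 c0; rewrite /trunc; case: (leP x c) => xc; rewrite ?mulr1 ?mulr0 ?normr0 ?ger0_norm.
Qed.

Let intg_bdd (f : T -> R) (c : R) : measurable_fun setT f -> (forall w, `|f w| <= c) -> intg P f.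
Proof. by move=> mf fc; apply: (intg_le mf (intg_cst P c)). Qed.

Let avg N w := N%:R^-1 * \sum_(0 <= i < N) X i w.
Let mu N := Ex P (fun w => trunc N%:R (X 0%N w)).
Let bad (N : nat) (e : R) := [set w | e <= `|avg N w - mu N|].

Let mavg N : measurable_fun setT (avg N).
Proof.
by apply: measurable_funM => //; exact: measurable_fun_bigsum.
Qed.

Let mbad N e : measurable (bad N e).
Proof.
rewrite (_ : bad N e = (fun w => `|avg N w - mu N|) @^-1` [set` `[e, +oo[]); last first.
  by apply/seteqP; split => w; rewrite /bad /= in_itv/= andbT.
rewrite -[X in measurable X]setTI.
have : measurable_fun setT (fun w => `|avg N w - mu N|).
  by apply: measurableT_comp => //; exact: measurable_funB.
by apply.
Qed.

Let same_Ex (f : R -> R) i : measurable_fun setT f -> intg P (fun w => f (X 0%N w)) ->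
  Ex P (fun w => f (X i w)) = Ex P (fun w => f (X 0%N w)).
Proof. by move=> mf fi; exact: (same_law_Ex (mX 0%N) (mX i) (@sameX i) mf fi). Qed.

Let intg_tail c i : intg P (fun w => tail c (X i w)).
Proof.
apply: (@intg_bdd _ 1); first exact: measurableT_comp (mtail c) (mX i).
by move=> w; rewrite /tail; case: (_ < _); rewrite ?normr1 ?normr0.
Qed.

Let intg_trunc2 (c : R) : 0 <= c -> intg P (fun w => trunc c (X 0%N w) ^+ 2).
Proof.
move=> c0; apply: (@intg_bdd _ (c ^+ 2)).
  by apply: measurable_funX; exact: measurableT_comp (mtrunc c) (mX 0%N).
by move=> w; rewrite normrX lerXn2r ?nnegrE// trunc_bound.
Qed.

(** Union bound for the event that truncation at [N] alters some term, plus Chebyshev for the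
    truncated sum. One truncation level for the whole row keeps the summands identically
    distributed, and pairwise independence removes the cross terms of the variance. *)
Let row_bound (N : nat) (e : R) : (0 < N)%N -> 0 < e ->
  fine (P (bad N e)) <=
  Ex P (fun w => N%:R * tail N%:R (X 0%N w) +
                 (e ^- 2) * (N%:R^-1 * trunc N%:R (X 0%N w) ^+ 2)).
Proof.
move=> N0 e0; have NR : 0 < N%:R :> R by rewrite ltr0n.
pose Y i w := trunc N%:R (X i w) - mu N.
have mY i : measurable_fun setT (Y i).
  by apply: measurable_funB => //; exact: measurableT_comp (mtrunc _) (mX i).
have itr i : intg P (fun w => trunc N%:R (X i w)).
  apply: (@intg_bdd _ N%:R); first exact: measurableT_comp (mtrunc _) (mX i).
  by move=> w; rewrite trunc_bound// ltW.
have iY i : intg P (Y i) by apply: intgB => //; exact: intg_cst.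
have EY i : Ex P (Y i) = 0.
  by rewrite ExB ?Ex_cst//; [rewrite same_Ex ?subrr|exact: intg_cst].
have iYY i j : intg P (fun w => Y i w * Y j w).
  have bY k w : `|Y k w| <= N%:R + `|mu N|.
    by rewrite (le_trans (ler_normB _ _))// lerD// trunc_bound// ltW.
  apply: (@intg_bdd _ ((N%:R + `|mu N|) ^+ 2)); first exact: measurable_funM.
  by move=> w; rewrite normrM expr2 ler_pM.
have EYY i j : Ex P (fun w => Y i w * Y j w) =
    (i == j)%:R * Ex P (fun w => Y 0%N w * Y 0%N w).
  have [<-|ij] := eqVneq i j; rewrite ?mul1r ?mul0r.
    have mf : measurable_fun setT (fun x => (trunc N%:R x - mu N) * (trunc N%:R x - mu N)).
      by apply: measurable_funM; apply: measurable_funB.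
    exact: (same_Ex i mf (iYY 0%N 0%N)).
  have mf : measurable_fun setT (fun x => trunc N%:R x - mu N) by apply: measurable_funB.
  have := Ex_indepM (indep2_comp mf mf (pwX ij)) (iY i) (iY j).
  by case=> _ ->; rewrite EY mul0r.
pose V w := \sum_(0 <= i < N) \sum_(0 <= j < N) Y i w * Y j w.
have iV : intg P V by apply: intg_sum => i _; apply: intg_sum => j _; exact: iYY.
have iT : intg P (fun w => \sum_(0 <= i < N) tail N%:R (X i w)) by apply: intg_sum.
have EV : Ex P V <= N%:R * Ex P (fun w => trunc N%:R (X 0%N w) ^+ 2).
  have -> : Ex P V = N%:R * Ex P (fun w => Y 0%N w * Y 0%N w).
    rewrite Ex_sum; last by move=> i _; apply: intg_sum => j _; exact: iYY.
    under eq_big_nat => i iN.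
      rewrite Ex_sum; last by move=> j _; exact: iYY.
      under eq_bigr do rewrite EYY.
      rewrite (bigD1_seq i) ?mem_index_iota ?iota_uniq//= eqxx mul1r big1 ?addr0.
        over.
      by move=> j; rewrite eq_sym => /negbTE ->; rewrite mul0r.
    by rewrite sumr_const_nat subn0 mulr_natl.
  rewrite ler_wpM2l//; apply: (@le_trans _ _ (Ex P (fun w => trunc N%:R (X 0%N w) ^+ 2
      - 2 * mu N * trunc N%:R (X 0%N w) + mu N ^+ 2))).
    rewrite le_eqVlt; apply/orP; left; apply/eqP; apply: eq_Rintegral => w _; rewrite /Y; ring.
  rewrite ExD ?Ex_cst ?ExB ?ExZ//; [|exact: intg_trunc2 (ltW _)|exact: intgZ| |exact: intg_cst].
    by rewrite -/(mu N); have := sqr_ge0 (mu N); nra.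
  by apply: intgB; [exact: intg_trunc2 (ltW _)|exact: intgZ].
apply: (@le_trans _ _ (Ex P (fun w => \sum_(0 <= i < N) tail N%:R (X i w) + (e * N%:R) ^- 2 * V w))).
  rewrite -Ex_indic//; apply: Ex_le; [exact: intg_indic|by apply: intgD => //; exact: intgZ|].
  move=> w; have VE : V w = (\sum_(0 <= i < N) Y i w) ^+ 2 by rewrite expr2 big_distrlr.
  have VV : 0 <= (e * N%:R) ^- 2 * V w by rewrite VE mulr_ge0 ?sqr_ge0// invr_ge0 sqr_ge0.
  have TT : 0 <= \sum_(0 <= i < N) tail N%:R (X i w) by rewrite sumr_ge0.
  rewrite indicE; case: (boolP (w \in _)) => [|_]; last by rewrite addr_ge0.
  rewrite inE => wb.
  (* Either some term exceeds [N], and the tail sum alone is at least 1, or truncation changes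
     nothing and the Chebyshev quotient is at least 1. *)
  have [[i iN Ni]|noi] := pselect (exists2 i, (i < N)%N & N%:R < X i w).
    rewrite (bigD1_seq i) ?mem_index_iota ?iota_uniq//= /tail Ni.
    by rewrite -addrA lerDl addr_ge0// sumr_ge0.
  apply: (@le_trans _ _ ((e * N%:R) ^- 2 * V w)); last by rewrite lerDr.
  have VN : V w = (N%:R * (avg N w - mu N)) ^+ 2.
    rewrite VE /avg; congr (_ ^+ 2); rewrite mulrBr mulVKf ?gt_eqF//.
    rewrite mulr_natl -[X in mu N *+ X]subn0 -sumr_const_nat -sumrB.
    apply: eq_big_nat => i /= iN; rewrite /Y /trunc leNgt.
    by case: ltP => [Ni|]; [case: noi; exists i|rewrite mulr1].
  rewrite VN -ler_pdivrMl ?invr_gt0 ?exprn_gt0 ?mulr_gt0// invrK mulr1 mulrC exprMn [leRHS]exprMn.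
  rewrite ler_wpM2l ?sqr_ge0// -[leRHS]real_normK ?num_real//.
  by rewrite lerXn2r ?nnegrE// ltW.
have iT2 := intg_trunc2 (ltW NR).
rewrite [leLHS]ExD//; last exact: intgZ.
rewrite [leRHS]ExD; [|exact: intgZ|by do 2 apply: intgZ].
rewrite ExZ// ExZ// ExZ; last exact: intgZ.
rewrite ExZ// Ex_sum// lerD//.
  under eq_bigr do rewrite same_Ex//.
  by rewrite sumr_const_nat subn0 mulr_natl.
apply: (le_trans (ler_wpM2l _ EV)); first by rewrite invr_ge0 sqr_ge0.
rewrite exprMn invfM -!mulrA ler_wpM2l ?invr_ge0 ?sqr_ge0// mulrA.
by rewrite (_ : N%:R ^- 2 * N%:R = N%:R^-1)//; field; rewrite gt_eqF.
Qed.

(** Summing inside the expectation reduces the row bounds to the two pointwise dyadic estimates at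
    [x = X_0]. The result does not depend on [J], so the bad events along [2^j m] have summable
    probabilities and Borel-Cantelli applies. *)
Let fin_sum_bound (m J : nat) (e : R) : (0 < m)%N -> 0 < e ->
  \sum_(0 <= j < J) fine (P (bad (2 ^ j * m) e)) <= (2 + 2 * e ^- 2) * Ex P (X 0%N).
Proof.
move=> m0 e0; have c0 j : (0 < 2 ^ j * m)%N by rewrite muln_gt0 expn_gt0.
have iTT j : intg P (fun w => trunc (2 ^ j * m)%:R (X 0%N w) ^+ 2) by exact: intg_trunc2.
have iRow j : intg P (fun w => (2 ^ j * m)%:R * tail (2 ^ j * m)%:R (X 0%N w) +
   e ^- 2 * ((2 ^ j * m)%:R^-1 * trunc (2 ^ j * m)%:R (X 0%N w) ^+ 2)).
  by apply: intgD; [exact: intgZ|do 2 apply: intgZ].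
apply: le_trans (_ : _ <= \sum_(0 <= j < J) Ex P (fun w =>
   (2 ^ j * m)%:R * tail (2 ^ j * m)%:R (X 0%N w) +
   e ^- 2 * ((2 ^ j * m)%:R^-1 * trunc (2 ^ j * m)%:R (X 0%N w) ^+ 2))) _.
  by apply: ler_sum => j _; exact: row_bound.
rewrite -Ex_sum// -ExZ//; apply: Ex_le; [exact: intg_sum|exact: intgZ|].
move=> w; rewrite big_split/= -mulr_sumr mulrDl lerD//; first exact: dyadic_tail_bound.
rewrite [2 * _]mulrC -mulrA ler_wpM2l ?invr_ge0 ?sqr_ge0//.
exact: dyadic_head_bound.
Qed.

Let bad_finite (m : nat) (e : R) : (0 < m)%N -> 0 < e ->
  {ae P, forall w, \forall j \near \oo, `|avg (2 ^ j * m) w - mu (2 ^ j * m)| < e}.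
Proof.
move=> m0 e0; pose B j := bad (2 ^ j * m) e.
have mB j : measurable (B j) by exact: mbad.
have PB : (\sum_(j <oo) P (B j) < +oo)%E.
  apply: (@le_lt_trans _ _ ((2 + 2 * e ^- 2) * Ex P (X 0%N))%:E); last exact: ltry.
  apply: lime_le; first by apply: is_cvg_nneseries => n _ _; exact: measure_ge0.
  apply: nearW => n; apply: le_trans (_ : _ <= (\sum_(0 <= j < n) fine (P (B j)))%:E)%E _.
    rewrite -sumEFin; apply: lee_sum => j _; rewrite fineK//; exact: fin_num_measure.
  by rewrite lee_fin; exact: fin_sum_bound.
exists (lim_sup_set B); split.
- by apply: bigcap_measurable => // n _; apply: bigcup_measurable.
- exact: lim_sup_set_cvg0.
- move=> w /= nw n _; apply: contrapT => h; apply: nw.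
  exists n => // j /= nj; rewrite ltNge; apply/negP => bj; apply: h.
  by exists j.
Qed.

Let mu_cvg : mu N @[N --> \oo] --> Ex P (X 0%N).
Proof.
have [|||||_ +] := @Ex_dominated _ T R P (fun N w => trunc N%:R (X 0%N w)) (X 0%N) (X 0%N) => //.
- by move=> n; exact: measurableT_comp (mtrunc _) (mX 0%N).
- move=> w; apply: cvg_near_cst; near=> n; rewrite /trunc.
  suff -> : X 0%N w <= n%:R by rewrite mulr1.
  by near: n; exact: nbhs_infty_ger.
- by move=> n w; rewrite /trunc; case: (X 0%N w <= n%:R);
    rewrite ?mulr1 ?mulr0 ?normr0 ?ger0_norm.
Unshelve. all: by end_near. Qed.

Lemma slln_nonneg :
  {ae P, forall w, n%:R^-1 * \sum_(0 <= i < n) X i w @[n --> \oo] --> Ex P (X 0%N)}.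
Proof.
have : {ae P, forall w, forall m l : nat, (0 < m)%N -> \forall j \near \oo,
    `|avg (2 ^ j * m) w - mu (2 ^ j * m)| < l.+1%:R^-1}.
  apply/ae_foralln => m; apply/ae_foralln => l.
  have [->|m0] := posnP m; first by apply: aeW.
  have : 0 < l.+1%:R^-1 :> R by rewrite invr_gt0.
  by move/(bad_finite m0); apply: filterS => w + _.
apply: filterS => w H; apply: dyadic_average_cvg.
- exact: Ex_ge0.
- move=> m n mn; rewrite (big_cat_nat (leq0n m) mn)//= lerDl; exact: sumr_ge0.
- by rewrite big_geq.
- move=> m m0.
  have c : (2 ^ j * m)%N @[j --> \oo] --> \oo.
    apply/cvgnyPge => A; near=> j.
    apply: (@leq_trans j); first by near: j; exact: nbhs_infty_ge.
    by rewrite (leq_trans (ltnW (ltn_expl j (isT : 1 < 2)%N)))// leq_pmulr.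
  have muc := cvg_comp _ _ c mu_cvg.
  rewrite -[X in _ --> X]addr0.
  rewrite (_ : (fun j => _) = (fun j =>
     mu (2 ^ j * m) + (avg (2 ^ j * m) w - mu (2 ^ j * m)))); last first.
    by apply/funext => j; rewrite addrC subrK.
  apply: cvgD => //; apply/cvgr0Pnorm_lt => e e0.
  have [l le] : exists l : nat, l.+1%:R^-1 <= e.
    exists (Num.truncn e^-1); rewrite -[leRHS]invrK lef_pV2 ?posrE ?invr_gt0//.
    by rewrite ltW// truncnS_gt.
  by have := H m l m0; apply: filterS => j h; exact: lt_le_trans h le.
Unshelve. all: by end_near. Qed.

End slln_nonneg.

Theorem slln d (T : measurableType d) (R : realType) (P : probability T R)
    (X : nat -> T -> R) :
  (forall i, measurable_fun setT (X i)) -> intg P (X 0%N) ->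
  (forall i, same_law P P (X 0%N) (X i)) ->
  (forall i j, i != j -> indep2 P (X i) (X j)) ->
  {ae P, forall w, n%:R^-1 * \sum_(0 <= i < n) X i w @[n --> \oo] --> Ex P (X 0%N)}.
Proof.
move=> mX iX sX pX.
have part (f : R -> R) : measurable_fun setT f -> intg P (fun w => f (X 0%N w)) ->
    (forall x, 0 <= f x) ->
    {ae P, forall w, n%:R^-1 * \sum_(0 <= i < n) f (X i w) @[n --> \oo] -->
       Ex P (fun w => f (X 0%N w))}.
  move=> mf fi f0; apply: (@slln_nonneg _ T R P (fun i w => f (X i w))) => //.
  - by move=> i; exact: measurableT_comp.
  - move=> i A mA; have := sX i (f @^-1` A); apply.
    by rewrite -[Y in measurable Y]setTI; exact: mf.
  - by move=> i j ij; apply: indep2_comp; last exact: pX.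
pose fp (x : R) := Num.max x 0; pose fn (x : R) := Num.max (- x) 0.
have mfp : measurable_fun setT fp by apply: measurable_maxr.
have mfn : measurable_fun setT fn by apply: measurable_maxr.
have fE x : x = fp x - fn x.
  by rewrite /fp /fn; case: (leP x 0) => x0; case: leP => x1; lra.
have ifp : intg P (fun w => fp (X 0%N w)).
  apply: (intg_le _ (intg_norm iX)); first exact: measurableT_comp.
  by move=> w; rewrite /fp ger0_norm ?le_max ?lexx ?orbT// ge_max ler_norm normr_ge0.
have ifn : intg P (fun w => fn (X 0%N w)).
  apply: (intg_le _ (intg_norm iX)); first exact: measurableT_comp.
  by move=> w; rewrite /fn ger0_norm ?le_max ?lexx ?orbT// ge_max normr_ge0 -normrN ler_norm.
have hp : _ := part fp mfp ifp (fun x => ltac:(by rewrite /fp le_max lexx orbT)).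
have hn : _ := part fn mfn ifn (fun x => ltac:(by rewrite /fn le_max lexx orbT)).
apply: filterS2 hp hn => w {}hp {}hn.
rewrite (_ : Ex P (X 0%N) = Ex P (fun w => fp (X 0%N w)) - Ex P (fun w => fn (X 0%N w))); last first.
  by rewrite -ExB//; apply: eq_Rintegral => v _; exact: fE.
rewrite (_ : (fun n => _) = (fun n => n%:R^-1 * \sum_(0 <= i < n) fp (X i w) -
    n%:R^-1 * \sum_(0 <= i < n) fn (X i w))); first exact: cvgB.
apply/funext => n; rewrite -mulrBr -sumrB; congr (_ * _).
by apply: eq_bigr => i _; exact: fE.
Qed.

(** * Conditional probabilities *)

Section inner_regularity.
Import HBSimple HBNNSimple.

(** [E] is an arbitrary set. A simple function [h] below the indicator of [E]&[B] with integral
    above [c] exists by definition of the integral; the set where [h > 0] is measurable, lies in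
    [E]&[B], and has measure at least the integral of [h], since [h <= 1]. *)
Lemma inner_regular_indic d (T : measurableType d) (R : realType)
    (P : probability T R) (E B : set T) (c : R) : measurable B ->
  (c%:E < \int[P]_(w in B) (\1_E w)%:E)%E ->
  exists K, [/\ measurable K, K `<=` E `&` B & (c%:E <= P K)%E].
Proof.
move=> mB; rewrite integral_mkcond ge0_integralTE; last first.
  by move=> w; rewrite patchE; case: ifP => // _; rewrite lee_fin.
move=> /ereal_sup_gt [_ /= [h hE <-]].
rewrite (_ : sintegral P h = \int[P]_w (h w)%:E)%E => [ch|]; last first.
  by rewrite integral_nnsfun// patch_setT.
have hE' w : h w <= \1_(E `&` B) w.
  have := hE w; rewrite patchE !indicE in_setI.
  by case: (w \in B); rewrite ?andbT ?andbF lee_fin.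
have mK : measurable (h @^-1` [set x | 0 < x]).
  have -> : [set x : R | 0 < x] = `]0, +oo[%classic.
    by apply/seteqP; split => x /=; rewrite in_itv/= andbT.
  by rewrite -[X in measurable X]setTI; exact: measurable_funPT.
exists (h @^-1` [set x | 0 < x]); split => //.
- move=> w /= hw; have := lt_le_trans hw (hE' w).
  by rewrite indicE ltr0n lt0b inE.
- apply: (le_trans (ltW ch)); rewrite -[X in P X]setIT -integral_indic//.
  apply: ge0_le_integral => //.
  + by move=> w _; rewrite lee_fin.
  + exact/measurable_EFinP.
  + exact/measurable_EFinP/measurable_indic.
  + move=> w _; rewrite lee_fin; have : 0 <= h w by exact: fun_ge0.
    rewrite le_eqVlt => /orP[/eqP <-//|hw].
    rewrite [leRHS]indicE mem_set//; apply: le_trans (hE' w) _.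
    by rewrite indicE; case: (_ \in _).
Qed.

End inner_regularity.

Section conditional_probability.
Context d (T : measurableType d) (R : realType) (P : probability T R).
Context dU (U : measurableType dU) (f : T -> U).
Hypothesis mf : measurable_fun setT f.
Let G := sigma_of f.

Let Gm A : G A -> measurable A.
Proof. by move=> [B mB <-]; exact: mf. Qed.

Lemma sigma_of_gt (Z : T -> R) (a : R) : sigma_of Z `<=` G -> G [set w | a < Z w].
Proof.
apply; exists `]a, +oo[%classic => //.
by apply/seteqP; split => w; rewrite setTI/= in_itv/= andbT.
Qed.

Lemma sigma_of_lt (Z : T -> R) (a : R) : sigma_of Z `<=` G -> G [set w | Z w < a].
Proof.
apply; exists `]-oo, a[%classic => //.
by apply/seteqP; split => w; rewrite setTI/= in_itv/=.
Qed.

Lemma is_cond_probability_ge0 (E : set T) (Z : T -> R) :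
  is_cond_probability P G E Z -> {ae P, forall w, 0 <= Z w}.
Proof.
move=> [Zm iZ ZE].
suff : {ae P, forall w, forall l : nat, - l.+1%:R^-1 <= Z w}.
  apply: filterS => w H; rewrite leNgt; apply/negP => Zw.
  have Zw' : 0 < - Z w by rewrite oppr_gt0.
  have := H (Num.truncn (- Z w)^-1); rewrite leNgt => /negP; apply.
  rewrite ltrNr -[ltRHS]invrK ltf_pV2 ?posrE ?invr_gt0//; exact: truncnS_gt.
apply/ae_foralln => l; pose D := [set w | Z w < - l.+1%:R^-1].
have GD : G D by exact: sigma_of_lt.
exists D; split; first exact: Gm.
- have I0 : (0 <= \int[P]_(w in D) (Z w)%:E)%E.
    by rewrite ZE//; apply: integral_ge0 => w _; rewrite lee_fin.
  have I1 : (\int[P]_(w in D) (Z w)%:E <= (- l.+1%:R^-1)%:E * P D)%E.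
    rewrite -integral_cst//; last exact: Gm.
    apply: le_integral => //; [exact: Gm| | |].
    + by apply: (integrableS measurableT) iZ => //; exact: Gm.
    + by apply: finite_measure_integrable_cst => //; exact: Gm.
    + by move=> w; rewrite inE lee_fin => /ltW.
  apply/eqP; rewrite -measure_le0 leNgt; apply/negP => PD.
  have := le_trans I0 I1; rewrite leNgt => /negP; apply.
  by rewrite nmule_rlt0 ?lte_fin ?oppr_lt0 ?invr_gt0.
- by move=> w /= /negP; rewrite -ltNge.
Qed.

Variables (E : nat -> set T) (Z : nat -> T -> R).
Hypothesis ZE : forall n, is_cond_probability P G (E n) (Z n).

(** [B n k] is the event that [n + k] is the first index from [n] on at which [Z] exceeds [eta]. It
    belongs to [G], so over it the indicator of [E (n + k)] integrates to at least [eta] times its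
    measure. Gluing measurable subsets of these pieces gives [V n], of measure at least [eta / 2]
    times that of [lim_sup_set D]. *)
Let limsup_gt (eta : R) : 0 < eta -> P.-negligible (lim_sup_set E) ->
  P (lim_sup_set (fun n => [set w | eta < Z n w])) = 0%E.
Proof.
move=> eta0 [N [mN N0 EN]]; pose D n := [set w | eta < Z n w].
have GD n : G (D n) by apply: sigma_of_gt; case: (ZE n).
pose B n := seqDU (fun k => D (n + k)%N).
have GB n k : G (B n k).
  have := @seqDU_measurable _ (g_sigma_algebra_preimageType f) (fun k => D (n + k)%N).
  by apply => j; exact: GD.
(* Halving [eta] creates the strict inequality that inner approximation requires. *)
have HK n k : exists K, [/\ measurable K, K `<=` E (n + k)%N `&` B n k &
    ((eta / 2)%:E * P (B n k) <= P K)%E].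
  have mB := Gm (GB n k).
  have PBfin : P (B n k) \is a fin_num by exact: fin_num_measure.
  have [PB0|PB0] := eqVneq (P (B n k)) 0%E.
    by exists set0; split => //; rewrite PB0 mule0 measure_ge0.
  have [|K [mK KE cK]] := @inner_regular_indic _ _ _ P (E (n + k)%N) (B n k)
      (eta / 2 * fine (P (B n k))) mB.
    have [_ iZ <-//] := ZE (n + k)%N.
    have PBgt : 0 < fine (P (B n k)) by rewrite fine_gt0// lt0e PB0 measure_ge0/= -ge0_fin_numE.
    apply: (@lt_le_trans _ _ (eta%:E * P (B n k))%E).
      by rewrite -{2}(fineK PBfin) -EFinM lte_fin ltr_pM2r// ltr_pdivrMr// ltr_pMr// ltr1n.
    rewrite -integral_cst//; apply: le_integral => //.
    + exact: finite_measure_integrable_cst.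
    + by apply: (integrableS measurableT) iZ.
    + by move=> w; rewrite inE lee_fin => Bw; have := subset_seqDU Bw; exact: ltW.
  exists K; split => //; by rewrite -(fineK PBfin) -EFinM.
pose K n k := sval (cid (HK n k)).
have mK n k : measurable (K n k) by rewrite /K; case: cid => ? [].
have KE n k : K n k `<=` E (n + k)%N `&` B n k by rewrite /K; case: cid => ? [].
have PK n k : ((eta / 2)%:E * P (B n k) <= P (K n k))%E by rewrite /K; case: cid => ? [].
pose V n := \bigcup_k K n k.
have mV n : measurable (V n) by exact: bigcupT_measurable.
(* A point of [V n] lies in some [E (n + k)], whose index is at least [n]; so the limsup of [V] is
   inside that of [E]. *)
have V0 : P (lim_sup_set V) = 0%E.
  apply: (@subset_measure0 _ _ _ P _ _ _ mN _ N0).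
    by apply: bigcap_measurable => // n _; apply: bigcup_measurable.
  move=> w Vw; apply: EN => n _; have [j /= nj [k _ Kw]] := Vw n I.
  by exists (j + k)%N; [rewrite /= (leq_trans nj)// leq_addr|have [] := KE _ _ _ Kw].
have mD n : measurable (D n) by exact: Gm.
have mL : measurable (lim_sup_set D).
  by apply: bigcap_measurable => // n _; apply: bigcup_measurable.
have VD n : ((eta / 2)%:E * P (lim_sup_set D) <= P (V n))%E.
  apply: (@le_trans _ _ ((eta / 2)%:E * P (\bigcup_k D (n + k)%N))%E).
    rewrite lee_pmul2l//; last by rewrite lte_fin divr_gt0.
    apply: le_measure; rewrite ?inE//; first by apply: bigcupT_measurable => k; exact: mD.
    move=> w Lw; have [j /= nj Dj] := Lw n I.
    by exists (j - n)%N => //; rewrite subnKC.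
  rewrite seqDU_bigcup_eq measure_semi_bigcup; [|by move=> k; exact: Gm (GB n k)|exact: trivIset_seqDU|
     by apply: bigcupT_measurable => k; exact: Gm (GB n k)].
  have tK : trivIset setT (K n).
    move=> i j _ _ [w [Ki Kj]]; apply: (@trivIset_seqDU _ (fun k => D (n + k)%N) i j I I).
    by exists w; split; [have [] := KE _ _ _ Ki|have [] := KE _ _ _ Kj].
  rewrite measure_semi_bigcup; [|exact: mK|exact: tK|exact: mV].
  rewrite -nneseriesZl//.
  apply: lee_nneseries => [k _ _|k _]; last exact: PK.
  by rewrite mule_ge0// lee_fin divr_ge0// ltW.
have cV : P (\bigcup_(k >= n) V k) @[n --> \oo] --> 0%E.
  rewrite -V0; apply: lim_sup_set_cvg => //.
  by rewrite (le_lt_trans (probability_le1 _ _)) ?ltry//; apply: bigcup_measurable.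
have : ((eta / 2)%:E * P (lim_sup_set D) <= 0)%E.
  rewrite -(cvg_lim _ cV)//; apply: lime_ge; first by apply/cvg_ex; exists 0%E.
  apply: nearW => n; apply: (le_trans (VD n)); apply: le_measure; rewrite ?inE//.
    by apply: bigcup_measurable.
  by move=> w Vw; exists n => /=.
by rewrite pmule_rle0 ?lte_fin ?divr_gt0// measure_le0 => /eqP.
Qed.

Lemma cond_probability_cvg0 : P.-negligible (lim_sup_set E) ->
  {ae P, forall w, Z n w @[n --> \oo] --> (0 : R)}.
Proof.
move=> E0.
have H1 : {ae P, forall w, forall n, 0 <= Z n w}.
  by apply/ae_foralln => n; exact: is_cond_probability_ge0 (ZE n).
have H2 : {ae P, forall w, forall l : nat, \forall n \near \oo, Z n w <= l.+1%:R^-1}.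
  apply/ae_foralln => l; pose D n := [set w | l.+1%:R^-1 < Z n w].
  have GD n : G (D n) by apply: sigma_of_gt; case: (ZE n).
  exists (lim_sup_set D); split.
  - apply: bigcap_measurable => // n _; apply: bigcup_measurable => k _; exact: Gm.
  - by apply: limsup_gt.
  - move=> w /= nw n _; apply: contrapT => h; apply: nw.
    exists n => // j /= nj; rewrite leNgt; apply/negP => bj; apply: h.
    by exists j.
apply: filterS2 H1 H2 => w Z0 Z1.
apply/cvgr0Pnorm_le => e e0.
have [l le] : exists l : nat, l.+1%:R^-1 <= e.
  exists (Num.truncn e^-1); rewrite -[leRHS]invrK lef_pV2 ?posrE ?invr_gt0//.
  by rewrite ltW// truncnS_gt.
apply: filterS (Z1 l) => n Zn; rewrite ger0_norm//.
exact: le_trans Zn le.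
Qed.

End conditional_probability.

(** * Gaussian laws *)

(** The Radon-Nikodym derivative and [normal_pdf] have the same integral over every measurable set,
    hence agree almost everywhere. *)
Lemma ge0_integral_normal_prob (R : realType) (m s : R) (f : R -> \bar R) :
  measurable_fun setT f -> (forall x, 0 <= f x)%E ->
  (\int[normal_prob m s]_x f x =
   \int[lebesgue_measure]_x (f x * (normal_pdf m s x)%:E))%E.
Proof.
move=> mf f0; have dom := normal_prob_dominates m s.
rewrite -(Radon_Nikodym_SigmaFinite.change_of_variables dom)//.
have mpdf : measurable_fun setT (EFin \o normal_pdf m s).
  by apply/measurable_EFinP; exact: measurable_normal_pdf.
have mRN := measurable_int _ (Radon_Nikodym_SigmaFinite.f_integrable dom).
apply: ae_eq_integral => //; [exact: emeasurable_funM..|].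
apply: ae_eqe_mul2l; apply: integral_ae_eq => //.
- exact: Radon_Nikodym_SigmaFinite.f_integrable.
- by move=> E _ mE; rewrite -Radon_Nikodym_SigmaFinite.f_integral.
Qed.

Section gaussian_moments.
Context d (T : measurableType d) (R : realType) (P : probability T R).

Lemma ge0_integral_normal_law (X : T -> R) (m s : R) (f : R -> R) :
  measurable_fun setT X ->
  (forall A : set R, measurable A -> P (X @^-1` A) = normal_law m s A) ->
  measurable_fun setT f -> (forall x, 0 <= f x) ->
  (\int[P]_w (f (X w))%:E =
   if (s == 0)%R then (f m)%:E
   else \int[lebesgue_measure]_x (f x * normal_pdf m s x)%:E)%E.
Proof.
move=> mX XE mf f0; pose X' : {mfun T >-> measurableTypeR R} :=
  HB.pack X (isMeasurableFun.Build _ _ _ (measurableTypeR R) X mX).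
have mf' : @measurable_fun _ _ (measurableTypeR R) _ setT (EFin \o f) by exact/measurable_EFinP.
have := @ge0_integral_distribution _ _ _ _ _ P X' (EFin \o f) mf' (fun x => f0 x).
move=> <-; rewrite /normal_law in XE; case: (boolP (s == 0)) => s0.
- rewrite s0 in XE.
  transitivity (\int[@dirac _ (measurableTypeR R) m R]_x (EFin \o f) x)%E.
    by apply: eq_measure_integral => A mA _; exact: XE.
  by rewrite integral_dirac// diracT mul1e.
- rewrite (negbTE s0) in XE.
  transitivity (\int[normal_prob m s]_x (EFin \o f) x)%E.
    by apply: eq_measure_integral => A mA _; exact: XE.
  by rewrite ge0_integral_normal_prob.
Qed.

Lemma normal_law_mgf (X : T -> R) (m s t : R) :
  measurable_fun setT X ->
  (forall A : set R, measurable A -> P (X @^-1` A) = normal_law m s A) ->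
  intg P (fun w => expR (t * X w)) /\
  Ex P (fun w => expR (t * X w)) = expR (m * t + s ^+ 2 * t ^+ 2 / 2).
Proof.
move=> mX XE.
have mf : measurable_fun setT (fun x : R => expR (t * x)).
  by apply: measurableT_comp => //; exact: measurable_funM.
have I : (\int[P]_w (expR (t * X w))%:E = (expR (m * t + s ^+ 2 * t ^+ 2 / 2))%:E)%E.
  rewrite (ge0_integral_normal_law mX XE mf); last by move=> x; exact: expR_ge0.
  have [->|s0] := eqVneq s 0; first by rewrite expr0n/= !mul0r addr0 mulrC.
  (* Completing the square: tilting a normal density by [exp (t x)] shifts its mean by [s^2 t] and
     multiplies it by a constant. *)
  transitivity (\int[lebesgue_measure]_x
     ((expR (m * t + s ^+ 2 * t ^+ 2 / 2))%:E * (normal_pdf (m + s ^+ 2 * t) s x)%:E))%E.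
    apply: eq_integral => x _; rewrite -EFinM; congr EFin.
    rewrite !normal_pdfE// /normal_fun mulrCA [RHS]mulrCA -!expRD; congr (_ * expR _).
    by field.
  rewrite integralZl//; last exact: integrable_normal_pdf.
  by rewrite integral_normal_pdf mule1.
split; last by rewrite /Rintegral I.
apply/integrableP; split; first by apply/measurable_EFinP; exact: measurableT_comp mf mX.
under eq_integral do rewrite /= ger0_norm ?expR_ge0//.
by rewrite I ltry.
Qed.

Lemma normal_law_expR_sqr (X : T -> R) (m s : R) :
  measurable_fun setT X ->
  (forall A : set R, measurable A -> P (X @^-1` A) = normal_law m s A) ->
  exists2 lam, 0 < lam & intg P (fun w => expR (lam * X w ^+ 2)).
Proof.
move=> mX XE; have [s0|s0] := eqVneq s 0.
  exists (1 : R); first exact: ltr01.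
  have mf : measurable_fun setT (fun x : R => expR (1 * x ^+ 2)).
    by apply: measurableT_comp => //; apply: measurable_funM => //; exact: measurable_funX.
  apply/integrableP; split; first by apply/measurable_EFinP; exact: measurableT_comp mf mX.
  under eq_integral do rewrite /= ger0_norm ?expR_ge0//.
  rewrite (ge0_integral_normal_law mX XE mf); last by move=> x; exact: expR_ge0.
  by rewrite s0 eqxx ltry.
have s2 : 0 < s ^+ 2 by rewrite exprn_even_gt0.
(* With this [lam] the weighted density is dominated by a multiple of the normal density of standard
   deviation [2 s]; the difference of exponents is a sum of two squares over [8 s^2]. *)
exists (8 * s ^+ 2)^-1; first by rewrite invr_gt0 mulr_gt0.
have mf : measurable_fun setT (fun x : R => expR ((8 * s ^+ 2)^-1 * x ^+ 2)).
  by apply: measurableT_comp => //; apply: measurable_funM => //; exact: measurable_funX.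
apply/integrableP; split; first by apply/measurable_EFinP; exact: measurableT_comp mf mX.
under eq_integral do rewrite /= ger0_norm ?expR_ge0//.
rewrite (ge0_integral_normal_law mX XE mf); last by move=> x; exact: expR_ge0.
rewrite (negbTE s0).
have s20 : 2 * s != 0 by rewrite mulf_neq0.
pose K := normal_peak s / normal_peak (2 * s) * expR (m ^+ 2 / (4 * s ^+ 2)).
apply: (@le_lt_trans _ _ (\int[lebesgue_measure]_x (K%:E * (normal_pdf m (2 * s) x)%:E))%E).
  apply: ge0_le_integral => //.
  - by move=> x _; rewrite lee_fin mulr_ge0 ?expR_ge0 ?normal_pdf_ge0.
  - by apply/measurable_EFinP; apply: measurable_funM => //; exact: measurable_normal_pdf.
  - apply/measurable_EFinP; apply: measurable_funM => //; exact: measurable_normal_pdf.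
  - move=> x _; rewrite -EFinM lee_fin !normal_pdfE// /K /normal_fun.
    have pk : normal_peak (2 * s) != 0 by rewrite gt_eqF// normal_peak_gt0.
    have pkE (a b u v : R) : b != 0 -> a / b * u * (b * v) = a * (u * v) by move=> b0; field.
    rewrite pkE// mulrCA -!expRD.
    rewrite ler_wpM2l ?normal_peak_ge0// ler_expR.
    rewrite -subr_ge0.
    have -> : m ^+ 2 / (4 * s ^+ 2) + - (x - m) ^+ 2 / ((2 * s) ^+ 2 *+ 2) -
       ((8 * s ^+ 2)^-1 * x ^+ 2 + - (x - m) ^+ 2 / (s ^+ 2 *+ 2)) =
       (2 * m ^+ 2 + 3 * (x - m) ^+ 2 - x ^+ 2) / (8 * s ^+ 2) by field.
    have -> : 2 * m ^+ 2 + 3 * (x - m) ^+ 2 - x ^+ 2 =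
      (m - (x - m)) ^+ 2 + (x - m) ^+ 2 by ring.
    by rewrite divr_ge0// ?addr_ge0 ?sqr_ge0// mulr_ge0// sqr_ge0.
rewrite integralZl//; last exact: integrable_normal_pdf.
by rewrite integral_normal_pdf mule1 ltry.
Qed.

(** The weight [V] is there for iteration: the derivative has the same form with weight [V X], so
    all orders follow by induction. *)
Lemma mgf_derivative (V X : T -> R) :
  measurable_fun setT V -> measurable_fun setT X ->
  (forall t, intg P (fun w => V w * expR (t * X w))) ->
  (forall t, intg P (fun w => V w * X w * expR (t * X w))) /\
  forall t : R, derive1 (fun t : R => Ex P (fun w => V w * expR (t * X w))) t =
            Ex P (fun w => V w * X w * expR (t * X w)).
Proof.
move=> mV mX iV.
(* For [|x - t| <= 1], bounding both [|X|] and [exp ((x - t) X)] by [exp |X|] leaves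
   [exp (t X + 2 |X|)], which is one of the two exponentials at [t + 2] and [t - 2]. *)
pose G (t : R) w : R := `|V w * expR ((t + 2) * X w)| + `|V w * expR ((t - 2) * X w)|.
have iG t : intg P (G t) by apply: (@intgD _ _ _ P _ _ (intg_norm (iV (t + 2))) (intg_norm (iV (t - 2)))).
have bound (t x : R) w : `|x - t| <= 1 -> `|V w * X w * expR (x * X w)| <= G t w.
  move=> xt; rewrite /G !normrM -!mulrA -mulrDr ler_wpM2l//.
  rewrite !(ger0_norm (expR_ge0 _)).
  have h1 : `|X w| <= expR `|X w|.
    by have := expR_ge1Dx `|X w|; lra.
  have h2 : expR (x * X w) <= expR (t * X w + `|X w|).
    rewrite ler_expR -lerBlDl -mulrBl (le_trans (ler_norm _))// normrM.
    by rewrite ler_piMl.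
  apply: (@le_trans _ _ (expR (t * X w + 2 * `|X w|))).
    rewrite (_ : 2 * _ = `|X w| + `|X w|); last by ring.
    rewrite addrA expRD [leRHS]mulrC ler_pM// ?expR_ge0//.
  have [X0|X0] := leP 0 (X w).
    by rewrite ger0_norm// -mulrDl lerDl expR_ge0.
  by rewrite ltr0_norm// mulrN -mulrBl lerDr expR_ge0.
have iVX t : intg P (fun w => V w * X w * expR (t * X w)).
  apply: (intg_le _ (iG t)); last by move=> w; apply: bound; rewrite subrr normr0.
  apply: measurable_funM; first exact: measurable_funM.
  by apply: measurableT_comp => //; exact: measurable_funM.
split => // t.
have dE (x : R) w : is_derive x (1 : R) (fun t : R => V w * expR (t * X w)) (V w * X w * expR (x * X w)).
  have h1 : is_derive x (1 : R) (fun t : R => t * X w) (X w).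
    by apply: is_derive_eq; rewrite scaler0 add0r /GRing.scale/= mulr1.
  have h2 := @is_derive1_comp R expR (fun t => t * X w) x _ _ (is_derive_expR _) h1.
  rewrite (_ : V w * X w * _ = V w *: (expR (x * X w) * X w)); last by rewrite /GRing.scale/=; ring.
  exact: (is_deriveZ (V w) h2).
have tI : `]t - 1, t + 1[%classic t by rewrite /= in_itv/= ltrBlDr ltrDl ltr01.
rewrite (@differentiation_under_integral _ _ _ P (fun t w => V w * expR (t * X w))
   setT measurableT t (t - 1) (t + 1) tI _ _ (G t)).
- by apply: eq_Rintegral => w _; rewrite partial1of2E; have [_ ->] := dE t w.
- by move=> x _; exact: iV.
- by move=> x w _ _; have [] := dE x w.
- by move=> w; rewrite addr_ge0.
- exact: iG.
- move=> x w; rewrite /= in_itv/= => /andP[x1 x2] _; rewrite partial1of2E; have [_ ->] := dE x w.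
  by apply: bound; rewrite ler_norml; apply/andP; split; lra.
Qed.

End gaussian_moments.

Section gaussian_pair.
Context d (T : measurableType d) (R : realType) (P : probability T R).

Lemma mgf_intg (V X : T -> R) (n : nat) :
  measurable_fun setT V -> measurable_fun setT X ->
  (forall t, intg P (fun w => V w * expR (t * X w))) ->
  forall t, intg P (fun w => V w * X w ^+ n * expR (t * X w)).
Proof.
move=> mV mX iV; elim: n => [|n IH] t.
  rewrite (_ : (fun w => _) = fun w => V w * expR (t * X w))//.
  by apply/funext => w; rewrite expr0 mulr1.
have mVn : measurable_fun setT (fun w => V w * X w ^+ n).
  by apply: measurable_funM => //; exact: measurable_funX.
have [iVn _] := mgf_derivative mVn mX IH.
rewrite (_ : (fun w => _) = fun w => V w * X w ^+ n * X w * expR (t * X w)); first exact: iVn.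
by apply/funext => w; rewrite exprSr mulrA.
Qed.

(** All derivatives of the zero function vanish. The induction keeps the factor [exp (t X)] for
    every [t], and [t = 0] is taken only at the end. *)
Lemma zero_mgf_moments (V X : T -> R) (n : nat) :
  measurable_fun setT V -> measurable_fun setT X ->
  (forall t, intg P (fun w => V w * expR (t * X w))) ->
  (forall t, Ex P (fun w => V w * expR (t * X w)) = 0) ->
  intg P (fun w => V w * X w ^+ n) /\ Ex P (fun w => V w * X w ^+ n) = 0.
Proof.
move=> mV mX iV V0.
have iVn := mgf_intg n mV mX iV.
have E0 (Y : T -> R) : (fun w => Y w * expR (0 * X w)) = Y.
  by apply/funext => w; rewrite mul0r expR0 mulr1.
suff H : forall t, Ex P (fun w => V w * X w ^+ n * expR (t * X w)) = 0.
  by have := H 0; have := iVn 0; rewrite E0.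
elim: n {iVn} => [|n IH] t.
  rewrite -[RHS](V0 t); apply: eq_Rintegral => w _.
  by rewrite expr0 mulr1.
have mVn : measurable_fun setT (fun w => V w * X w ^+ n).
  by apply: measurable_funM => //; exact: measurable_funX.
have [_ dVn] := mgf_derivative mVn mX (mgf_intg n mV mX iV).
transitivity (Ex P (fun w => V w * X w ^+ n * X w * expR (t * X w))).
  by apply: eq_Rintegral => w _; rewrite exprSr mulrA.
rewrite -dVn (_ : (fun t : R => _) = cst 0); last exact/funext.
by rewrite derive1_cst.
Qed.

Lemma normal_law_moments (X : T -> R) (m s : R) :
  measurable_fun setT X ->
  (forall A : set R, measurable A -> P (X @^-1` A) = normal_law m s A) ->
  [/\ intg P X, intg P (fun w => X w ^+ 2), Ex P X = m &
      Ex P (fun w => X w ^+ 2) = m ^+ 2 + s ^+ 2].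
Proof.
move=> mX XE; have mgf t := normal_law_mgf t mX XE.
have m1 : measurable_fun setT (fun _ : T => 1 : R) by exact: measurable_cst.
have i1 t : intg P (fun w => 1 * expR (t * X w)).
  by under eq_fun do rewrite mul1r; case: (mgf t).
have [iX dX] := mgf_derivative m1 mX i1.
have m1X : measurable_fun setT (fun w => 1 * X w) by exact: measurable_funM.
have [iX2 dX2] := mgf_derivative m1X mX iX.
pose g (t : R) := expR (m * t + s ^+ 2 * t ^+ 2 / 2).
have dg (t : R) : is_derive t (1 : R) g ((m + s ^+ 2 * t) * g t).
  have h : is_derive t (1 : R) (fun t : R => m * t + s ^+ 2 / 2 * (t * t)) (m + s ^+ 2 * t).
    by apply: is_derive_eq; rewrite /GRing.scale/=; field.
  have := @is_derive1_comp R expR _ t _ _ (is_derive_expR _) h.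
  rewrite (_ : _ \o _ = g); last first.
    by apply/funext => x; rewrite /= /g; congr expR; field.
  rewrite mulrC /g (_ : m * t + s ^+ 2 * t ^+ 2 / 2 = m * t + s ^+ 2 / 2 * (t * t)); last by field.
  by [].
have gE : (fun t : R => Ex P (fun w => 1 * expR (t * X w))) = g.
  apply/funext => t; rewrite /g -(mgf t).2; apply: eq_Rintegral => w _.
  by rewrite mul1r.
have E1 t : Ex P (fun w => 1 * X w * expR (t * X w)) = (m + s ^+ 2 * t) * g t.
  by rewrite -dX gE derive1E; have [_ ->] := dg t.
have E2 : Ex P (fun w => 1 * X w * X w * expR (0 * X w)) = s ^+ 2 + m ^+ 2.
  rewrite -dX2 (_ : (fun t : R => _) = (fun t => (m + s ^+ 2 * t) * g t)); last first.
    by apply/funext => t; exact: E1.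
  have h1 : is_derive (0 : R) (1 : R) (fun t : R => m + s ^+ 2 * t) (s ^+ 2).
    by apply: is_derive_eq; rewrite /GRing.scale/=; ring.
  have [_ ] := is_deriveM h1 (dg 0).
  rewrite derive1E => ->; rewrite /GRing.scale/= /g !mulr0 !addr0 expr0n/= mulr0 mul0r addr0 expR0.
  ring.
have e1 : (fun w => 1 * X w * expR (0 * X w)) = X.
  by apply/funext => w; rewrite mul1r mul0r expR0 mulr1.
have e2 : (fun w => 1 * X w * X w * expR (0 * X w)) = (fun w => X w ^+ 2).
  by apply/funext => w; rewrite mul1r mul0r expR0 mulr1.
split.
- by have := iX 0; rewrite e1.
- by have := iX2 0; rewrite e2.
- by have := E1 0; rewrite e1 => ->; rewrite /g !mulr0 expr0n/= mulr0 mul0r !addr0 expR0 mulr1.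
- by rewrite -e2 E2 addrC.
Qed.

Variables U X : T -> R.
Hypotheses (mU : measurable_fun setT U) (mX : measurable_fun setT X).
Hypothesis gUX : forall a b : R, gaussian P (fun w => a * U w + b * X w).

Lemma gaussian_pair_sqr :
  [/\ intg P U, intg P X, intg P (fun w => U w ^+ 2), intg P (fun w => X w ^+ 2)
    & intg P (fun w => U w * X w)].
Proof.
have [m [s [_ H1]]] := gUX 1 0; have [m' [s' [_ H2]]] := gUX 0 1.
have e1 : (fun w => 1 * U w + 0 * X w) = U by apply/funext => w; rewrite mul1r mul0r addr0.
have e2 : (fun w => 0 * U w + 1 * X w) = X by apply/funext => w; rewrite mul1r mul0r add0r.
rewrite e1 in H1; rewrite e2 in H2.
have [? ? _ _] := normal_law_moments mU H1; have [? ? _ _] := normal_law_moments mX H2.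
by split => //; exact: intg_mul.
Qed.

Let vU := Ex P (fun w => U w ^+ 2) - Ex P U ^+ 2.
Let vX := Ex P (fun w => X w ^+ 2) - Ex P X ^+ 2.
Let cUX := Ex P (fun w => U w * X w) - Ex P U * Ex P X.

(** For fixed [a] and [b] only a one-dimensional normal law is known. Its two parameters are
    recovered from the first two moments, which are polynomials in [a] and [b] with the moments of
    the pair as coefficients. *)
Lemma gaussian_pair_mgf (a b : R) : intg P (fun w => expR (a * U w + b * X w)) /\
  Ex P (fun w => expR (a * U w + b * X w)) =
  expR (a * Ex P U + b * Ex P X + (a ^+ 2 * vU + 2 * a * b * cUX + b ^+ 2 * vX) / 2).
Proof.
have [iU iX iU2 iX2 iUX] := gaussian_pair_sqr.
have [m [s [_ H]]] := gUX a b.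
have mab : measurable_fun setT (fun w => a * U w + b * X w).
  by apply: measurable_funD; apply: measurable_funM.
have [_ _ Em Es] := normal_law_moments mab H.
have := normal_law_mgf 1 mab H.
rewrite (_ : (fun w => expR (1 * _)) = fun w => expR (a * U w + b * X w)); last first.
  by apply/funext => w; rewrite mul1r.
move=> [? ->]; split => //; congr expR.
have {}Em : m = a * Ex P U + b * Ex P X by rewrite -Em ExD ?ExZ//; exact: intgZ.
have {}Es : m ^+ 2 + s ^+ 2 = a ^+ 2 * Ex P (fun w => U w ^+ 2)
    + 2 * a * b * Ex P (fun w => U w * X w) + b ^+ 2 * Ex P (fun w => X w ^+ 2).
  rewrite -Es -!ExZ// -!ExD//; try (by apply: intgZ); last by apply: intgD; apply: intgZ.
  by apply: eq_Rintegral => w _; ring.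
have -> : s ^+ 2 = m ^+ 2 + s ^+ 2 - m ^+ 2 by ring.
by rewrite Es Em /vU /vX /cUX; field.
Qed.

(** The regression slope [cUX / vX] kills the mixed term of the quadratic exponent, so the moment
    generating function of [(u, X)] is a product. Factorisation of moments is then extracted one
    variable at a time. *)
Lemma gaussian_residual : vX != 0 -> exists alpha : R, forall i n,
  let u w := U w - alpha * X w in
  intg P (fun w => u w ^+ i * X w ^+ n) /\
  Ex P (fun w => u w ^+ i * X w ^+ n) = Ex P (fun w => u w ^+ i) * Ex P (fun w => X w ^+ n).
Proof.
move=> vX0; exists (cUX / vX) => i n u.
have mu : measurable_fun setT u by apply: measurable_funB => //; exact: measurable_funM.
pose q a := a * (Ex P U - cUX / vX * Ex P X) + a ^+ 2 * (vU - cUX ^+ 2 / vX) / 2.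
pose q' b := b * Ex P X + b ^+ 2 * vX / 2.
have mgf a b : intg P (fun w => expR (a * u w) * expR (b * X w)) /\
    Ex P (fun w => expR (a * u w) * expR (b * X w)) = expR (q a) * expR (q' b).
  have := gaussian_pair_mgf a (b - a * (cUX / vX)).
  rewrite (_ : (fun w => expR _) = fun w => expR (a * u w) * expR (b * X w)); last first.
    by apply/funext => w; rewrite -expRD /u; congr expR; ring.
  by move=> [? ->]; split => //; rewrite -expRD; congr expR; rewrite /q /q'; field.
have mgfu a : intg P (fun w => expR (a * u w)) /\ Ex P (fun w => expR (a * u w)) = expR (q a).
  have := mgf a 0; rewrite /q' mul0r expr0n/= !mul0r addr0 expR0 mulr1.
  by under eq_fun do rewrite mul0r expR0 mulr1.
have mgfX b : intg P (fun w => expR (b * X w)) /\ Ex P (fun w => expR (b * X w)) = expR (q' b).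
  have := mgf 0 b; rewrite /q mul0r expr0n/= !mul0r addr0 expR0 mul1r.
  by under eq_fun do rewrite mul0r expR0 mul1r.
have me (Y : T -> R) a : measurable_fun setT Y -> measurable_fun setT (fun w => expR (a * Y w)).
  by move=> mY; apply: measurableT_comp => //; exact: measurable_funM.
have mgf_int (Y : T -> R) k : measurable_fun setT Y ->
    (forall a, intg P (fun w => expR (a * Y w))) -> intg P (fun w => Y w ^+ k).
  move=> mY iY; have := @mgf_intg (fun=> 1) Y k (@measurable_cst _ _ _ _ _ _) mY _ 0.
  rewrite (_ : (fun w => 1 * Y w ^+ k * _) = fun w => Y w ^+ k); last first.
    by apply/funext => w; rewrite mul0r expR0 mul1r mulr1.
  by apply => t; under eq_fun do rewrite mul1r.
have iXn k : intg P (fun w => X w ^+ k) by apply: mgf_int => // b; case: (mgfX b).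
have iun k : intg P (fun w => u w ^+ k) by apply: mgf_int => // a; case: (mgfu a).
(* Differentiation in [b] with weight [exp (a u) - exp (q a)] turns the exponential of [X] into a
   power while that of [u] stays. *)
have step1 a : intg P (fun w => expR (a * u w) * X w ^+ n) /\
    Ex P (fun w => expR (a * u w) * X w ^+ n) = expR (q a) * Ex P (fun w => X w ^+ n).
  have [|||iV EV] := @zero_mgf_moments (fun w => expR (a * u w) - expR (q a)) X n _ mX.
  - by apply: measurable_funB => //; exact: me.
  - move=> b; under eq_fun do rewrite mulrBl; apply: intgB; first by case: (mgf a b).
    by apply: intgZ; case: (mgfX b).
  - move=> b; under eq_Rintegral do rewrite mulrBl.
    rewrite ExB ?ExZ; [|by case: (mgfX b)|by case: (mgf a b)|by apply: intgZ; case: (mgfX b)].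
    by rewrite (mgf a b).2 (mgfX b).2 subrr.
  have e : (fun w => expR (a * u w) * X w ^+ n) =
      (fun w => (expR (a * u w) - expR (q a)) * X w ^+ n + expR (q a) * X w ^+ n).
    by apply/funext => w; ring.
  rewrite e; split; first by apply: intgD => //; exact: intgZ.
  by rewrite ExD ?ExZ ?EV ?add0r//; exact: intgZ.
(* The roles are now exchanged: the weight is the centred power of [X], and differentiation in [a]
   produces the powers of [u]. *)
have [|||iV EV] := @zero_mgf_moments (fun w => X w ^+ n - Ex P (fun w => X w ^+ n)) u i _ mu.
- by apply: measurable_funB => //; exact: measurable_funX.
- move=> a; under eq_fun do rewrite mulrBl [X in X - _]mulrC; apply: intgB; first by case: (step1 a).
  by apply: intgZ; case: (mgfu a).
- move=> a; under eq_Rintegral do rewrite mulrBl [X in X - _]mulrC.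
  rewrite ExB ?ExZ; [|by case: (mgfu a)|by case: (step1 a)|by apply: intgZ; case: (mgfu a)].
  by rewrite (step1 a).2 (mgfu a).2 mulrC subrr.
have e : (fun w => u w ^+ i * X w ^+ n) =
    (fun w => (X w ^+ n - Ex P (fun w => X w ^+ n)) * u w ^+ i + Ex P (fun w => X w ^+ n) * u w ^+ i).
  by apply/funext => w; ring.
rewrite e; split; first by apply: intgD => //; exact: intgZ.
by rewrite ExD ?ExZ ?EV ?add0r 1?mulrC//; exact: intgZ.
Qed.

End gaussian_pair.

(** * Moment determinacy *)

Lemma exp_coeff_sum_le (R : realType) (x : R) (n : nat) : 0 <= x ->
  \sum_(0 <= i < n) x ^+ i / i`!%:R <= expR x.
Proof.
move=> x0; have nd : nondecreasing_seq (series (exp_coeff x)).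
  apply/nondecreasing_seqP => k; rewrite /series /= big_nat_recr//= lerDl.
  by rewrite /exp_coeff /= divr_ge0// exprn_ge0.
exact: (nondecreasing_cvgn_le nd (is_cvg_series_exp_coeff x) n).
Qed.

Lemma bernoulli_ge (R : realType) (a : R) (n : nat) : 0 <= a <= 1 ->
  1 - n%:R * a <= (1 - a) ^+ n.
Proof.
move=> /andP[a0 a1]; elim: n => [|n IH]; first by rewrite mul0r subr0 expr0.
rewrite exprS; apply: (@le_trans _ _ ((1 - a) * (1 - n%:R * a))).
  have : 0 <= n%:R * a * a :> R by rewrite !mulr_ge0.
  by rewrite -natr1; nra.
by rewrite ler_wpM2l// subr_ge0.
Qed.

(* Pointwise limit of the polynomials (1 - s^n)^(n 2^n) in s = e^(-v): a step at
   s = 1/2. The factor n in the exponent also gives the limit 0 at s = 1/2. *)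
Lemma step_approximation (R : realType) (v : R) : 0 <= v ->
  (1 - expR (- (n%:R * v))) ^+ (n * 2 ^ n) @[n --> \oo] --> ((ln 2 < v)%R%:R : R).
Proof.
move=> v0; have e01 n : 0 <= expR (- (n%:R * v)) <= 1.
  by rewrite expR_ge0 expR_le1 oppr_le0 mulr_ge0.
have two n : (2 ^ n)%:R = expR (n%:R * ln 2) :> R.
  by rewrite natrX expRM_natl lnK// posrE.
have [v2|v2] := ltP (ln 2) v; apply/cvgrPdist_le => e e0.
- have del0 : 0 < v - ln 2 by rewrite subr_gt0.
  near=> n; have n0 : 0 < n%:R :> R by rewrite ltr0n; near: n; exact: nbhs_infty_gt.
  have ne : 2 / ((v - ln 2) ^+ 2 * e) <= n%:R by near: n; exact: nbhs_infty_ger.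
  have b1 := bernoulli_ge (n * 2 ^ n) (e01 n).
  have b2 : (1 - expR (- (n%:R * v))) ^+ (n * 2 ^ n) <= 1.
    have /andP[? ?] := e01 n.
    by apply: exprn_ile1; rewrite ?subr_ge0// gerBl.
  rewrite ger0_norm ?subr_ge0// lerBlDr -lerBlDl; apply: le_trans b1.
  rewrite lerB// natrM two -mulrA -expRD.
  rewrite (_ : _ + _ = - (n%:R * (v - ln 2))); last by ring.
  rewrite expRN ler_pdivrMr ?expR_gt0//.
  (* Bernoulli leaves an error [n exp (- n (v - ln 2))]; the quadratic lower bound on the
     exponential is what beats the prefactor [n]. *)
  have h := @expR_ge1Dxn R (n%:R * (v - ln 2)) 1 (mulr_ge0 (ltW n0) (ltW del0)).
  apply: (@le_trans _ _ (e * ((n%:R * (v - ln 2)) ^+ 2 / 2))); last first.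
    by rewrite ler_pM2l//; apply: le_trans h; rewrite lerDr.
  have d2 : 0 < (v - ln 2) ^+ 2 * e by rewrite mulr_gt0// exprn_gt0.
  rewrite ler_pdivrMr// in ne.
  rewrite exprMn; move: ne; set D := (_ - _) ^+ 2 => ne; nra.
- near=> n; have n0 : e^-1 <= n%:R by near: n; exact: nbhs_infty_ger.
  have /andP[? ?] := e01 n.
  rewrite sub0r normrN ger0_norm ?exprn_ge0 ?subr_ge0//.
  apply: (@le_trans _ _ (expR (- n%:R))).
    apply: (@le_trans _ _ (expR (- (2 ^ n)%:R^-1) ^+ (n * 2 ^ n))).
      apply: lerXn2r; rewrite ?nnegrE ?expR_ge0 ?subr_ge0//.
      apply: le_trans (expR_ge1Dx _); rewrite lerB// two -expRN ler_expR lerN2.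
      by rewrite ler_wpM2l.
    have p2 : (2 ^ n)%:R != 0 :> R by rewrite pnatr_eq0 expn_eq0.
    by rewrite -expRM_natl ler_expR natrM mulrN -mulrA divff// mulr1.
  rewrite expRN -[leRHS]invrK lef_pV2 ?posrE ?expR_gt0 ?invr_gt0//.
  apply: (le_trans n0); apply: le_trans (expR_ge1Dx _); by rewrite lerDr.
Unshelve. all: by end_near. Qed.

Section moment_determinacy.
Context d (T : measurableType d) (R : realType) (P : probability T R).

Section laplace.
Variables (W Q : T -> R) (lam : R).
Hypotheses (mW : measurable_fun setT W) (mQ : measurable_fun setT Q).
Hypothesis Q_ge0 : forall w, 0 <= Q w.
Hypothesis lam0 : 0 < lam.
Hypothesis iWQ : intg P (fun w => W w * expR (lam * Q w)).
Hypothesis WQ0 : forall j, Ex P (fun w => W w * Q w ^+ j) = 0.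

Let me a : measurable_fun setT (fun w => expR (a * Q w)).
Proof. by apply: measurableT_comp => //; exact: measurable_funM. Qed.

Let mWQ j a : measurable_fun setT (fun w => W w * Q w ^+ j * expR (a * Q w)).
Proof.
by apply: measurable_funM => //; apply: measurable_funM => //; exact: measurable_funX.
Qed.

(** The power is paid for by a second copy of [exp (kap Q)], since [(kap Q)^j / j!] is at most that
    exponential; hence the condition [2 kap <= lam]. *)
Let dom (kap : R) j w : 0 < kap -> 2 * kap <= lam ->
  `|W w| * Q w ^+ j * expR (kap * Q w) <= (j`!%:R / kap ^+ j) * `|W w * expR (lam * Q w)|.
Proof.
move=> k0 kl; rewrite normrM (ger0_norm (expR_ge0 _)) mulrCA -mulrA ler_wpM2l//.
have Qj : Q w ^+ j <= j`!%:R / kap ^+ j * expR (kap * Q w).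
  have := exp_coeff_sum_le j.+1 (mulr_ge0 (ltW k0) (Q_ge0 w)).
  rewrite big_nat_recr//= exprMn => h.
  have {}h : kap ^+ j * Q w ^+ j / j`!%:R <= expR (kap * Q w).
    apply: le_trans h; rewrite lerDr; apply: sumr_ge0 => i _.
    by rewrite divr_ge0// exprn_ge0// mulr_ge0// ltW.
  rewrite ler_pdivrMr ?ltr0n ?fact_gt0// in h.
  rewrite mulrAC ler_pdivlMr ?exprn_gt0// mulrC (le_trans h)// mulrC//.
apply: (le_trans (ler_wpM2r (expR_ge0 _) Qj)).
rewrite -[leLHS]mulrA -expRD ler_wpM2l ?divr_ge0 ?exprn_ge0 ?(ltW k0)// ler_expR.
by rewrite -mulrDl (_ : kap + kap = 2 * kap); [exact: ler_wpM2r|ring].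
Qed.

Let iWQe (kap : R) j a : 0 < kap -> 2 * kap <= lam -> a <= kap ->
  intg P (fun w => W w * Q w ^+ j * expR (a * Q w)).
Proof.
move=> k0 kl ak; apply: (intg_le _ (intgZ (j`!%:R / kap ^+ j) (intg_norm iWQ))) => // w.
apply: le_trans (dom j w k0 kl); rewrite !normrM (ger0_norm (expR_ge0 _)).
rewrite [X in _ * X * _]ger0_norm ?exprn_ge0// ler_wpM2l ?mulr_ge0 ?exprn_ge0//.
by rewrite ler_expR ler_wpM2r.
Qed.

(** Analytic continuation along the half-line in steps of constant length [kap]: the power series of
    [exp (- kap Q)] is integrated term by term, dominated through [exp (kap Q)]. Expansion at
    [m kap] uses moments of every order, so the induction on [m] is over all [j] at once. *)
Let laplace_step (kap : R) (m j : nat) : 0 < kap -> 2 * kap <= lam ->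
  Ex P (fun w => W w * Q w ^+ j * expR (- (m%:R * kap) * Q w)) = 0.
Proof.
move=> k0 kl; elim: m j => [|m IH] j.
  rewrite -[RHS](WQ0 j); apply: eq_Rintegral => w _.
  by rewrite mul0r oppr0 mul0r expR0 mulr1.
have mk : - (m%:R * kap) <= kap.
  by rewrite lerNl (le_trans (_ : _ <= 0)) ?oppr_le0 ?mulr_ge0// ltW.
have iE i := iWQe (i + j) k0 kl mk.
pose F N w := \sum_(0 <= i < N) ((- kap) ^+ i / i`!%:R) *
   (W w * Q w ^+ (i + j) * expR (- (m%:R * kap) * Q w)).
have FE N w : F N w = (W w * Q w ^+ j * expR (- (m%:R * kap) * Q w)) *
    \sum_(0 <= i < N) (- kap * Q w) ^+ i / i`!%:R.
  rewrite mulr_sumr; apply: eq_bigr => i _; rewrite exprMn exprD; ring.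
have EF N : Ex P (F N) = 0.
  rewrite Ex_sum; last by move=> i _; apply: intgZ; exact: (iE i).
  rewrite big1// => i _; rewrite ExZ; last exact: (iE i).
  by rewrite IH mulr0.
have [|||||_] := @Ex_dominated _ T R P F
    (fun w => W w * Q w ^+ j * expR (- (m.+1%:R * kap) * Q w))
    (fun w => (j`!%:R / kap ^+ j) * `|W w * expR (lam * Q w)|).
- move=> N; apply: intg_measurable; apply: intg_sum => i _; apply: intgZ; exact: (iE i).
- exact: mWQ.
- by apply: intgZ; exact: intg_norm.
- move=> w; under eq_fun do rewrite FE.
  have -> : W w * Q w ^+ j * expR (- (m.+1%:R * kap) * Q w) =
      W w * Q w ^+ j * expR (- (m%:R * kap) * Q w) * expR (- kap * Q w).
    by rewrite -[RHS]mulrA -expRD; congr (_ * expR _); rewrite -natr1; ring.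
  apply: cvgMr; exact: is_cvg_series_exp_coeff.
- move=> N w; apply: le_trans (dom j w k0 kl); rewrite FE !normrM -!mulrA ler_wpM2l//.
  rewrite [X in X * _]ger0_norm ?exprn_ge0// ler_wpM2l ?exprn_ge0//.
  apply: (@le_trans _ _ (1 * expR (kap * Q w))); last by rewrite mul1r.
  apply: ler_pM => //.
    rewrite ger0_norm ?expR_ge0// expR_le1 mulNr oppr_le0 !mulr_ge0// ltW//.
  apply: le_trans (exp_coeff_sum_le N (mulr_ge0 (ltW k0) (Q_ge0 w))).
  apply: le_trans (ler_norm_sum _ _ _) _; apply: ler_sum => i _.
  rewrite normrM normrX normrM normrN (ger0_norm (ltW k0)) (ger0_norm (Q_ge0 w)).
  by rewrite [X in _ * X]ger0_norm// invr_ge0.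
under eq_fun do rewrite EF.
by move/(cvg_unique (@Rhausdorff R)) => /(_ _ (cvg_cst 0)) ->.
Qed.

Lemma zero_moments_laplace (mu : R) : 0 <= mu ->
  intg P (fun w => W w * expR (- (mu * Q w))) /\
  Ex P (fun w => W w * expR (- (mu * Q w))) = 0.
Proof.
move=> mu0.
(* Cut [mu] into [m] equal steps of length at most [lam / 2]. For [mu = 0] no step is taken, but
   [kap] must still be positive. *)
pose m := (Num.truncn (2 * mu / lam)).+1.
pose kap := if mu == 0 then lam / 2 else mu / m%:R.
have m0 : 0 < m%:R :> R by rewrite ltr0n.
have k0 : 0 < kap.
  rewrite /kap; case: eqVneq => [_|mun]; first by rewrite divr_gt0.
  by rewrite divr_gt0// lt_neqAle eq_sym mun.
have kl : 2 * kap <= lam.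
  rewrite /kap; case: eqVneq => [_|mun]; first by rewrite mulrC divfK.
  by rewrite mulrA ler_pdivrMr// [leRHS]mulrC -ler_pdivrMr// ltW// truncnS_gt.
have E (k : nat) : k%:R * kap = mu -> (fun w => W w * expR (- (mu * Q w))) =
   (fun w => W w * Q w ^+ 0 * expR (- (k%:R * kap) * Q w)).
  by move=> ->; apply/funext => w; rewrite expr0 mulr1 mulNr.
have [k kE] : exists k : nat, k%:R * kap = mu.
  rewrite /kap; case: eqVneq => [->|mun]; first by exists 0%N; rewrite mul0r.
  by exists m; rewrite mulrCA divff ?mulr1// gt_eqF.
rewrite (E k kE); split; last exact: laplace_step.
by apply: (iWQe 0 k0 kl); rewrite lerNl (le_trans (_ : _ <= 0)) ?oppr_le0 ?mulr_ge0// ltW.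
Qed.

(** The step function is a bounded pointwise limit of polynomials in [exp (- mu Q)], whose monomials
    are covered by the Laplace transforms. The choice [mu = ln 2 / c] moves the jump to [Q = c]. *)
Lemma zero_moments_tail (c : R) : 0 < c -> Ex P (fun w => W w * (c < Q w)%R%:R) = 0.
Proof.
move=> c0; pose mu := ln 2 / c.
have ln20 : 0 < ln 2 :> R by rewrite ln_gt0// ltr1n.
have mu0 : 0 < mu by rewrite divr_gt0.
have cmu w : (c < Q w)%R = (ln 2 < mu * Q w).
  by rewrite /mu mulrAC ltr_pdivlMr// ltr_pM2l.
have iW : intg P W.
  have := (zero_moments_laplace (lexx 0)).1; rewrite (_ : (fun w => _) = W)//.
  by apply/funext => w; rewrite mul0r oppr0 expR0 mulr1.
pose F n w := W w * (1 - expR (- (n%:R * (mu * Q w)))) ^+ (n * 2 ^ n).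
have FE n : F n = (fun w => \sum_(i < (n * 2 ^ n).+1)
    ((-1) ^+ i *+ 'C(n * 2 ^ n, i)) * (W w * expR (- (i%:R * n%:R * mu * Q w)))).
  apply/funext => w; rewrite /F exprBn mulr_sumr; apply: eq_bigr => i _.
  rewrite expr1n mulr1 -expRM_natl -mulrnAl mulrCA; congr (_ * (_ * expR _)).
  by ring.
have iF n (i : nat) := zero_moments_laplace (mulr_ge0 (mulr_ge0 (ler0n R i) (ler0n R n)) (ltW mu0)).
have EF n : Ex P (F n) = 0.
  rewrite FE Ex_sum; last by move=> i _; apply: intgZ; exact: (iF n i).1.
  rewrite big1// => i _; rewrite ExZ; last exact: (iF n i).1.
  by rewrite (iF n i).2 mulr0.
have b01 n w : 0 <= 1 - expR (- (n%:R * (mu * Q w))) <= 1.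
  rewrite subr_ge0 expR_le1 oppr_le0 gerBl expR_ge0 andbT.
  exact: mulr_ge0 (ler0n _ _) (mulr_ge0 (ltW mu0) (Q_ge0 w)).
have [|||||_] := @Ex_dominated _ T R P F (fun w => W w * (c < Q w)%R%:R) (fun w => `|W w|).
- by move=> n; rewrite FE; apply: intg_measurable; apply: intg_sum => i _; apply: intgZ; exact: (iF n i).1.
- apply: measurable_funM => //.
  rewrite (_ : (fun w => _) = \1_[set` `]c, +oo[] \o Q); last first.
    by apply/funext => w; rewrite /= indicE mem_setE in_itv andbT.
  by apply: measurableT_comp => //; exact: measurable_indic.
- exact: intg_norm.
- move=> w; rewrite cmu; apply: cvgMr; apply: step_approximation.
  by rewrite mulr_ge0 ?(ltW mu0).
- move=> n w; rewrite normrM ler_piMr// ger0_norm; have /andP[? ?] := b01 n w.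
    exact: exprn_ile1.
  exact: exprn_ge0.
under eq_fun do rewrite EF.
by move/(cvg_unique (@Rhausdorff R)) => /(_ _ (cvg_cst 0)) ->.
Qed.

End laplace.

Theorem moment_determinacy (W X : T -> R) (lam : R) :
  measurable_fun setT W -> measurable_fun setT X -> intg P (fun w => W w ^+ 2) ->
  0 < lam -> intg P (fun w => expR (lam * X w ^+ 2)) ->
  (forall n, intg P (fun w => W w * X w ^+ n)) ->
  (forall n, Ex P (fun w => W w * X w ^+ n) = 0) ->
  forall A, measurable A -> Ex P (fun w => W w * \1_A (X w)) = 0.
Proof.
move=> mW mX iW2 lam0 iX iWX WX0.
have iW : intg P W by exact: intg_sqr.
have EW : Ex P W = 0.
  by rewrite -(WX0 0%N); apply: eq_Rintegral => w _; rewrite expr0 mulr1.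
have tail (a c : R) : 0 < c -> Ex P (fun w => W w * (c < (X w - a) ^+ 2)%R%:R) = 0.
  (* With exponent [lam / 4] the squared exponential is [exp (lam/2 (X - a)^2)], at most
     [exp (lam a^2) exp (lam X^2)]; so its product with the square integrable [W] is integrable. *)
  apply: (@zero_moments_tail W (fun w => (X w - a) ^+ 2) (lam / 4)) => //.
  - by apply: measurable_funX; exact: measurable_funB.
  - by move=> w; exact: sqr_ge0.
  - by rewrite divr_gt0.
  - have me (b : R) : measurable_fun setT (fun w => expR (b * (X w - a) ^+ 2)).
      apply: measurableT_comp => //; apply: measurable_funM => //.
      by apply: measurable_funX; exact: measurable_funB.
    apply: (@intg_mul _ _ _ P W (fun w => expR (lam / 4 * (X w - a) ^+ 2))) => //.
    apply: (intg_le _ (intgZ (expR (lam * a ^+ 2)) iX)).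
      exact: measurable_funX.
    move=> w; rewrite ger0_norm ?exprn_ge0 ?expR_ge0// -expRM_natl -expRD ler_expR.
    have h : 0 <= lam / 2 * (X w + a) ^+ 2 by rewrite mulr_ge0 ?sqr_ge0// ltW// divr_gt0.
    by rewrite -subr_ge0 (_ : _ - _ = lam / 2 * (X w + a) ^+ 2)//; field.
  - move=> j; have e : (fun w => W w * ((X w - a) ^+ 2) ^+ j) =
        (fun w => \sum_(i < (2 * j).+1) ((-1) ^+ i * a ^+ i *+ 'C(2 * j, i)) * (W w * X w ^+ (2 * j - i))).
      apply/funext => w; rewrite -exprM exprBn mulr_sumr; apply: eq_bigr => i _.
      rewrite -[X in _ * X = _]mulr_natr -[X in _ = X * _]mulr_natr.
      by move: (X w ^+ _) ((-1) ^+ i) (_%:R) => u v t; ring.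
    rewrite e Ex_sum => [|i _]; last exact: intgZ.
    by rewrite big1// => i _; rewrite ExZ// WX0 mulr0.
move=> A mA; apply: (@Ex_pi_lambda _ T R P _ _ (@RGenCInfty.G R) X W mX iW _ _ EW _ A mA).
- exact: RGenCInfty.measurableE.
- move=> _ _ [x ->] [y ->]; exists (Num.max x y).
  by rewrite predeqE => z/=; rewrite !in_itv/= !andbT ge_max; split => [[-> ->]|/andP[]].
move=> _ [x ->].
(* Complements of tails of [(X - a)^2] are closed intervals. Centre [x + n + 1] and radius [n + 1]
   give [[x, x + 2(n + 1)]], which increases to the half-line from [x]. *)
pose F n w := W w * (1 - (n.+1%:R ^+ 2 < (X w - (x + n.+1%:R)) ^+ 2)%R%:R).
have mind (a c : R) : measurable_fun setT (fun w => (c < (X w - a) ^+ 2)%R%:R : R).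
  rewrite (_ : (fun w => _) = \1_[set` `]c, +oo[] \o (fun w => (X w - a) ^+ 2)); last first.
    by apply/funext => w; rewrite /= indicE mem_setE in_itv andbT.
  apply: measurableT_comp; first exact: measurable_indic.
  by apply: measurable_funX; exact: measurable_funB.
have mF n : measurable_fun setT (F n).
  by apply: measurable_funM => //; exact: measurable_funB.
have EF n : Ex P (F n) = 0.
  under eq_Rintegral do rewrite /F mulrBr mulr1.
  rewrite ExB//.
    by rewrite EW tail ?subr0// exprn_gt0.
  apply: (intg_le _ (intg_norm iW)); first exact: measurable_funM.
  by move=> w; rewrite normrM; case: (_ < _); rewrite ?normr1 ?normr0 ?mulr1 ?mulr0.
have FE n w : F n w = W w * ((x <= X w) && (X w <= x + 2 * n.+1%:R))%R%:R.
  have n0 : 0 < n.+1%:R :> R by [].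
  congr (_ * _); rewrite ltNge -[X in X <= _]real_normK ?num_real//.
  rewrite ler_pXn2r ?nnegrE ?(ltW n0)// ler_distl.
  rewrite (_ : x + n.+1%:R - n.+1%:R = x); last by ring.
  rewrite (_ : x + n.+1%:R + n.+1%:R = x + 2 * n.+1%:R); last by ring.
  by case: (_ && _); rewrite ?subr0 ?subrr.
have [|||||_] := @Ex_dominated _ T R P F
   (fun w => W w * \1_`[x, +oo[ (X w)) (fun w => `|W w|).
- exact: mF.
- by apply: measurable_funM => //; apply: measurableT_comp => //; exact: measurable_indic.
- exact: intg_norm.
- move=> w; apply: cvg_near_cst; near=> n; rewrite FE indicE mem_setE in_itv/= andbT.
  suff -> : X w <= x + 2 * n.+1%:R by rewrite andbT.
  have : X w - x <= n%:R by near: n; exact: nbhs_infty_ger.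
  by rewrite -natr1; have : 0 <= n%:R :> R by []; lra.
- by move=> n w; rewrite FE normrM; case: (_ && _); rewrite ?normr1 ?normr0 ?mulr1 ?mulr0.
under eq_fun do rewrite EF.
by move/(cvg_unique (@Rhausdorff R)) => /(_ _ (cvg_cst 0)) ->.
Unshelve. all: by end_near. Qed.

End moment_determinacy.

(** * Polynomial regression *)

Section polynomial_regression.
Context d (T : measurableType d) (R : realType) (P : probability T R).

Lemma intg_sqrD (f g : T -> R) : measurable_fun setT f -> measurable_fun setT g ->
  intg P (fun w => f w ^+ 2) -> intg P (fun w => g w ^+ 2) ->
  intg P (fun w => (f w + g w) ^+ 2).
Proof.
move=> mf mg fi gi; apply: (intg_le _ (intgZ 2 (intgD fi gi))).
  by apply: measurable_funX; exact: measurable_funD.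
move=> w; rewrite ger0_norm ?sqr_ge0//; have := sqr_ge0 (f w - g w).
by move: (f w) (g w) => a b; nra.
Qed.

Lemma intg_sqrZ (a : R) (f : T -> R) : intg P (fun w => f w ^+ 2) ->
  intg P (fun w => (a * f w) ^+ 2).
Proof. by move=> fi; under eq_fun do rewrite exprMn; exact: intgZ. Qed.

Lemma intg_sqr_sum (I : Type) (s : seq I) (F : I -> T -> R) :
  (forall i, measurable_fun setT (F i)) -> (forall i, intg P (fun w => F i w ^+ 2)) ->
  intg P (fun w => (\sum_(i <- s) F i w) ^+ 2).
Proof.
move=> mF iF; elim: s => [|i s ih].
  by under eq_fun do rewrite big_nil expr0n; exact: intg_cst.
by under eq_fun do rewrite big_cons; apply: intg_sqrD => //; exact: measurable_fun_bigsum.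
Qed.

Lemma measurable_horner (p : {poly R}) : measurable_fun setT (fun x : R => p.[x]).
Proof.
under eq_fun do rewrite horner_coef.
by apply: measurable_fun_bigsum => i; apply: measurable_funM => //; exact: measurable_funX.
Qed.

Variables U X : T -> R.
Hypotheses (mU : measurable_fun setT U) (mX : measurable_fun setT X).
Hypothesis gUX : forall a b : R, gaussian P (fun w => a * U w + b * X w).
Hypothesis vX : Ex P (fun w => X w ^+ 2) - Ex P X ^+ 2 != 0.

(** In the expansion of [(u + alpha X)^j] each power of [u] is replaced by its mean; what remains is
    a sum of centred powers of [u] times powers of [X]. The bound on [size g] keeps the regression
    within the first [j] powers, and square integrability is recorded for moment determinacy. *)
Lemma gaussian_poly_regression (j : nat) : exists g : {poly R},
  [/\ (size g <= j.+1)%N,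
      intg P (fun w => (U w ^+ j - g.[X w]) ^+ 2),
      forall n, intg P (fun w => (U w ^+ j - g.[X w]) * X w ^+ n) &
      forall n, Ex P (fun w => (U w ^+ j - g.[X w]) * X w ^+ n) = 0].
Proof.
have [alpha H] := gaussian_residual mU mX gUX vX.
pose u w := U w - alpha * X w.
have iu i n : intg P (fun w => u w ^+ i * X w ^+ n) by case: (H i n).
have Eu i n : Ex P (fun w => u w ^+ i * X w ^+ n) = Ex P (fun w => u w ^+ i) * Ex P (fun w => X w ^+ n).
  by case: (H i n).
have iX n : intg P (fun w => X w ^+ n).
  by have := iu 0%N n; under eq_fun do rewrite expr0 mul1r.
have mu : measurable_fun setT u by apply: measurable_funB => //; exact: measurable_funM.
pose m i := Ex P (fun w => u w ^+ i).
pose g : {poly R} := \poly_(i < j.+1) (alpha ^+ i * m (j - i)%N * 'C(j, i)%:R).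
pose t i w := (u w ^+ (j - i) - m (j - i)%N) * X w ^+ i.
have WE w : U w ^+ j - g.[X w] = \sum_(i < j.+1) (alpha ^+ i * 'C(j, i)%:R) * t i w.
  rewrite (_ : U w = u w + alpha * X w); last by rewrite /u subrK.
  rewrite exprDn horner_poly -sumrB; apply: eq_bigr => i _.
  rewrite exprMn /t -mulr_natr.
  by move: (_%:R) (m _) (u w ^+ _) (alpha ^+ _) (X w ^+ _) => a b a' b' c; ring.
have tE i n : (fun w => t i w * X w ^+ n) =
    (fun w => u w ^+ (j - i) * X w ^+ (i + n) - m (j - i)%N * X w ^+ (i + n)).
  by apply/funext => w; rewrite /t exprD; ring.
have it i n : intg P (fun w => t i w * X w ^+ n).
  by rewrite tE; apply: intgB => //; exact: intgZ.
have Et i n : Ex P (fun w => t i w * X w ^+ n) = 0.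
  by rewrite tE ExB ?ExZ ?Eu ?subrr//; exact: intgZ.
have mt i : measurable_fun setT (t i).
  apply: measurable_funM; last exact: measurable_funX.
  by apply: measurable_funB => //; exact: measurable_funX.
have it2 i : intg P (fun w => t i w ^+ 2).
  rewrite (_ : (fun w => _) = fun w => (u w ^+ (j - i) * X w ^+ i + - m (j - i)%N * X w ^+ i) ^+ 2).
    apply: intg_sqrD.
    - by apply: measurable_funM; exact: measurable_funX.
    - by apply: measurable_funM => //; exact: measurable_funX.
    - by under eq_fun do rewrite exprMn -!exprM; exact: iu.
    - by apply: intg_sqrZ; under eq_fun do rewrite -exprM; exact: iX.
  by apply/funext => w; congr (_ ^+ 2); rewrite /t; ring.
exists g; split.
- exact: size_poly.
- under eq_fun do rewrite WE.
  apply: intg_sqr_sum => i; first exact: measurable_funM.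
  exact: intg_sqrZ.
- move=> n; under eq_fun do (rewrite WE mulr_suml; under eq_bigr do rewrite -mulrA).
  by apply: intg_sum => i _; exact: intgZ.
- move=> n; under eq_Rintegral do (rewrite WE mulr_suml; under eq_bigr do rewrite -mulrA).
  rewrite Ex_sum => [|i _]; last exact: intgZ.
  by rewrite big1// => i _; rewrite ExZ// Et mulr0.
Qed.

End polynomial_regression.

(** * Nonsingular covariance of the powers of a Gaussian variable *)

Section powers_covariance.
Context d (T : measurableType d) (R : realType) (P : probability T R).
Variable X : T -> R.
Hypothesis mX : measurable_fun setT X.
Hypothesis gX : gaussian P X.
Hypothesis vX : Ex P (fun w => X w ^+ 2) - Ex P X ^+ 2 != 0.

Lemma gaussian_intg_exp n : intg P (fun w => X w ^+ n).
Proof.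
have [m [s [_ XE]]] := gX.
have := @mgf_intg _ T R P (fun=> 1) X n (@measurable_cst _ _ _ _ _ _) mX _ 0.
rewrite (_ : (fun w => 1 * X w ^+ n * _) = fun w => X w ^+ n); last first.
  by apply/funext => w; rewrite mul0r expR0 mul1r mulr1.
apply => t; under eq_fun do rewrite mul1r.
by case: (normal_law_mgf t mX XE).
Qed.

(** Nonzero variance forces [s != 0], so the law is absolutely continuous and does not charge the
    finite root set. *)
Lemma gaussian_poly_neq0 (p : {poly R}) : p != 0 -> {ae P, forall w, p.[X w] != 0}.
Proof.
move=> p0; have [m [s [_ XE]]] := gX; have [_ _ Em Es] := normal_law_moments mX XE.
have s0 : s != 0.
  by apply: contra vX => /eqP s0; rewrite Es Em s0 expr0n addr0 subrr.
pose Z := [set x | p.[x] = 0].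
have fZ : finite_set Z.
  apply: contrapT => /(@infinite_set_fset _ _ (size p))[B BZ].
  rewrite leqNgt => /negP; apply; apply: max_poly_roots => //; last exact: fset_uniq.
  by apply/allP => x xB; apply/rootP/BZ.
have mZ : measurable Z.
  rewrite (_ : Z = (fun x => p.[x]) @^-1` [set 0]); last by apply/seteqP; split.
  by rewrite -[Y in measurable Y]setTI; exact: measurable_horner.
exists (X @^-1` Z); split.
- by rewrite -[Y in measurable Y]setTI; exact: mX.
- rewrite XE// /normal_law (negbTE s0).
  have /null_content_dominatesP := normal_prob_dominates m s.
  apply => //; apply: countable_lebesgue_measure0; exact: finite_set_countable.
- by move=> w /= /negP; rewrite negbK => /eqP.
Qed.

(** A vector [v] in the kernel makes the variance of [p(X)] vanish, where [p] has coefficients [v].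
    Then [p - M] vanishes almost surely at [X] and must be the zero polynomial. *)
Lemma powers_cov_unit (k : nat) :
  \matrix_(i < k, j < k) (Ex P (fun w => X w ^+ i.+1 * X w ^+ j.+1) -
     Ex P (fun w => X w ^+ i.+1) * Ex P (fun w => X w ^+ j.+1)) \in unitmx.
Proof.
set S := \matrix_(i, j) _.
rewrite -row_free_unit -kermx_eq0; apply/rowV0P => v /sub_kermxP vS.
pose p : {poly R} := \sum_(i < k) v 0 i *: 'X^(i.+1).
pose M := Ex P (fun w => p.[X w]).
have iX := gaussian_intg_exp.
have pE x : p.[x] = \sum_(i < k) v 0 i * x ^+ i.+1.
  by rewrite horner_sum; apply: eq_bigr => i _; rewrite hornerZ hornerXn.
pose Y (i : nat) w := X w ^+ i.+1 - Ex P (fun w => X w ^+ i.+1).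
have EYE (i j : nat) : (fun w => Y i w * Y j w) = (fun w => X w ^+ (i.+1 + j.+1)
    - Ex P (fun w => X w ^+ j.+1) * X w ^+ i.+1 - Ex P (fun w => X w ^+ i.+1) * Y j w).
  by apply/funext => w; rewrite /Y exprD; ring.
have iY j : intg P (Y j) by apply: intgB => //; exact: intg_cst.
have iYY (i j : nat) : intg P (fun w => Y i w * Y j w).
  by rewrite EYE; do 2 (apply: intgB; last exact: intgZ).
have EYY (i j : 'I_k) : Ex P (fun w => Y i w * Y j w) = S i j.
  rewrite EYE ExB; [|by apply: intgB => //; exact: intgZ|exact: intgZ].
  rewrite ExB//; last exact: intgZ.
  rewrite !ExZ// (_ : Ex P (Y j) = 0) ?mulr0 ?subr0; last first.
    by rewrite ExB ?Ex_cst ?subrr//; exact: intg_cst.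
  by rewrite mxE [X in _ - X]mulrC; congr (_ - _); apply: eq_Rintegral => w _; rewrite exprD.
have pM w : p.[X w] - M = \sum_(i < k) v 0 i * Y i w.
  rewrite pE /M; under eq_Rintegral do rewrite pE.
  rewrite Ex_sum => [|i _]; last exact: intgZ.
  by rewrite -sumrB; apply: eq_bigr => i _; rewrite ExZ// /Y mulrBr.
have pM2 w : (p.[X w] - M) ^+ 2 = \sum_(i < k) \sum_(j < k) v 0 i * v 0 j * (Y i w * Y j w).
  rewrite pM expr2 big_distrlr; apply: eq_bigr => i _; apply: eq_bigr => j _ /=; ring.
have E0 : Ex P (fun w => (p.[X w] - M) ^+ 2) = 0.
  under eq_Rintegral do rewrite pM2.
  rewrite Ex_sum => [|i _]; last by apply: intg_sum => j _; exact: intgZ.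
  transitivity (\sum_(j < k) v 0 j * (v *m S) 0 j).
    under [RHS]eq_bigr do rewrite mxE mulr_sumr.
    rewrite exchange_big; apply: eq_bigr => i _ /=.
    rewrite Ex_sum => [|j _]; last exact: intgZ.
    by apply: eq_bigr => j _; rewrite ExZ// EYY; ring.
  by rewrite vS big1// => j _; rewrite mxE mulr0.
have i2 : intg P (fun w => (p.[X w] - M) ^+ 2).
  by under eq_fun do rewrite pM2; do 2 (apply: intg_sum => ? _); exact: intgZ.
have ae0 : {ae P, forall w, (p - M%:P).[X w] = 0}.
  have := Ex_eq0_ae i2 (fun w => sqr_ge0 _) E0; apply: filterS => w /eqP.
  rewrite sqrf_eq0 => /eqP h.
  by rewrite hornerD hornerN hornerC.
have p0 : p - M%:P = 0.
  apply/eqP; apply: contrapT => /negP pn0.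
  have [N [mN N0 TN]] : {ae P, forall w, False}.
    by apply: filterS2 ae0 (gaussian_poly_neq0 pn0) => w /eqP -> .
  have : P setT = 0.
    by rewrite -N0; congr (P _); apply/seteqP; split => w _ //; apply: TN.
  by rewrite probability_setT => /eqP; rewrite onee_eq0.
(* [p] starts at degree 1, so subtracting the constant [M] leaves the coefficient of degree [i + 1]
   equal to [v_i]. *)
apply/rowP => i; rewrite mxE.
have := congr1 (fun q : {poly R} => q`_i.+1) p0.
rewrite coefD coefN coefC subr0 coef0 coef_sum (bigD1 i)//= coefZ coefXn eqxx mulr1.
rewrite big1 ?addr0// => l li; rewrite coefZ coefXn eqSS.
by rewrite (_ : (i == l :> nat) = false) ?mulr0//; apply/negbTE; rewrite eq_sym.
Qed.

End powers_covariance.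

(** * The errors-in-variables model *)

Section independent_systems_lemmas.
Context d (T : measurableType d) (R : realType) (P : probability T R).

Lemma sigma_of_preimage dU (U : measurableType dU) (f : T -> U) (A : set U) :
  measurable A -> sigma_of f (f @^-1` A).
Proof. by move=> mA; exists A => //; rewrite setTI. Qed.

Lemma independent_systems4 (F0 F1 F2 F3 : set (set T)) :
  independent_systems P (tnth [tuple F0; F1; F2; F3]) ->
  forall A0 A1 A2 A3, F0 A0 -> F1 A1 -> F2 A2 -> F3 A3 ->
  P (A0 `&` A1 `&` A2 `&` A3) =
  (fine (P A0) * fine (P A1) * fine (P A2) * fine (P A3))%:E.
Proof.
move=> indep A0 A1 A2 A3 FA0 FA1 FA2 FA3.
pose A (i : 'I_4) := tnth [tuple A0; A1; A2; A3] i.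
pose J := [fset i | i in enum 'I_4]%fset.
have memJ i : i \in J by apply/imfsetP; exists i => //=; rewrite mem_enum.
have : forall i, i \in J -> tnth [tuple F0; F1; F2; F3] i (A i).
  by move=> i _; case: i => [[|[|[|[|//]]]]] ?.
move=> /indep; rewrite (_ : \bigcap_(i in _) A i = A0 `&` A1 `&` A2 `&` A3).
  move=> ->; congr EFin.
  rewrite (perm_big (enum 'I_4)); last first.
    apply: uniq_perm; [exact: fset_uniq|exact: enum_uniq|].
    by move=> i; rewrite memJ mem_enum.
  by rewrite big_enum/= !big_ord_recl big_ord0 mulr1 !mulrA.
apply/seteqP; split => [w Aw|w [[[? ?] ?] ?]].
  by do 3?split; [have := Aw ord0|have := Aw (inord 1)|have := Aw (inord 2)|have := Aw (inord 3)];
    move=> /(_ (memJ _)); rewrite /A (tnth_nth set0) /= ?inordK.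
by case=> [[|[|[|[|//]]]]] ? _.
Qed.

Lemma independent_systems_pair (I : choiceType) (F : I -> set (set T)) (i j : I) :
  independent_systems P F -> i != j -> forall A B, F i A -> F j B ->
  P (A `&` B) = (fine (P A) * fine (P B))%:E.
Proof.
move=> indep ij A B FA FB.
pose C l := if l == i then A else B.
have Ci : C i = A by rewrite /C eqxx.
have Cj : C j = B by rewrite /C eq_sym (negbTE ij).
have := indep [fset i; j]%fset C.
rewrite (_ : \bigcap_(l in _) C l = A `&` B); last first.
  apply/seteqP; split => w.
    by move=> Cw; split; [rewrite -Ci|rewrite -Cj]; apply: Cw; rewrite /= !inE eqxx ?orbT.
  by move=> [Aw Bw] l; rewrite /= !inE => /orP[|] /eqP ->; rewrite ?Ci ?Cj.
move=> -> => [|l]; last by rewrite !inE => /orP[|] /eqP ->; rewrite ?Ci ?Cj.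
by rewrite big_fsetU1 ?inE//= big_seq_fset1 Ci Cj.
Qed.

Lemma covarianceEx (X Y : T -> R) : intg P X -> intg P Y ->
  intg P (fun w => X w * Y w) ->
  covariance P X Y = (Ex P (fun w => X w * Y w) - Ex P X * Ex P Y)%:E.
Proof.
move=> iX iY iXY; rewrite covarianceE; try exact/Lfun1_integrable.
by rewrite unlock -[(X * Y)%R]/(fun w => X w * Y w) !ExEFin.
Qed.

Lemma dotE (m : nat) (u v : 'cV[R]_m) : dot u v = \sum_(j < m) u j 0 * v j 0.
Proof. by rewrite /dot mxE; apply: eq_bigr => j _; rewrite mxE. Qed.

End independent_systems_lemmas.

Section errors_in_variables_model.
Context (R : realType) (q k : nat) (hk : (0 < k)%N)
  (d0 : measure_display) (T0 : measurableType d0) (P0 : probability T0 R)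
  (y xi e eps x delta : {RV P0 >-> R}) (z : {RV P0 >-> q.-tuple R})
  (c : 'cV[R]_q) (beta0 : R) (beta : 'cV[R]_k)
  (h_y : forall w, y w = dot c (tuple_col (z w)) + beta0
                         + dot beta (powers k (xi w)) + e w + eps w)
  (h_x : forall w, x w = xi w + delta w)
  (h_indep : independent_systems P0
     (tnth [tuple sigma_of xi; sigma_of e; sigma_of z;
                  sigma_of (fun w => (eps w, delta w))]))
  (h_e2 : (e : T0 -> R) \in Lfun P0 2%:E)
  (h_z2 : forall j : 'I_q, (fun w => tnth (z w) j) \in Lfun P0 2%:E)
  (h_Sz : cov_mx P0 z \in unitmx)
  (h_sx : (0 < 'V_P0[x])%E)
  (h_e0 : ('E_P0[e] = 0)%E)
  (h_gauss : jointly_gaussian P0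
     (tnth [tuple (eps : T0 -> R); (delta : T0 -> R); (xi : T0 -> R)])).

Let mxi : measurable_fun setT xi. Proof. exact: measurable_funPT. Qed.
Let me : measurable_fun setT e. Proof. exact: measurable_funPT. Qed.
Let meps : measurable_fun setT eps. Proof. exact: measurable_funPT. Qed.
Let mx : measurable_fun setT x. Proof. exact: measurable_funPT. Qed.
Let mz : measurable_fun setT z. Proof. exact: measurable_funPT. Qed.
Let med : measurable_fun setT (fun w => (eps w, delta w)).
Proof. exact/measurable_fun_pair. Qed.

Let fP A : measurable A -> P0 A \is a fin_num.
Proof. by move=> mA; exact: fin_num_measure. Qed.

Let pre d' (S' : measurableType d') (f : T0 -> S') A :
  measurable_fun setT f -> measurable A -> measurable (f @^-1` A).
Proof. by move=> mf mA; rewrite -[X in measurable X]setTI; exact: mf. Qed.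

Let indep4 A0 A1 A2 A3 : measurable A0 -> measurable A1 -> measurable A2 -> measurable A3 ->
  P0 (xi @^-1` A0 `&` e @^-1` A1 `&` z @^-1` A2 `&` (fun w => (eps w, delta w)) @^-1` A3) =
  (P0 (xi @^-1` A0) * P0 (e @^-1` A1) * P0 (z @^-1` A2) *
   P0 ((fun w => (eps w, delta w)) @^-1` A3))%E.
Proof.
move=> m0 m1 m2 m3.
rewrite (independent_systems4 h_indep); try exact: sigma_of_preimage.
by rewrite !EFinM !fineK//; apply: fP; exact: pre.
Qed.

Let g3 w := (xi w, (eps w, delta w)).

Let g3z : indep2 P0 g3 z.
Proof.
apply: indep2_pair => // A B C mA mB mC.
have := indep4 mA measurableT mC mB; rewrite !preimage_setT setIT probability_setT mule1.
by rewrite setIAC muleAC.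
Qed.

Let zxi_ed : indep2 P0 (fun w => (z w, xi w)) (fun w => (e w, (eps w, delta w))).
Proof.
have m2 : measurable_fun setT (fun w => (e w, (eps w, delta w))) by exact/measurable_fun_pair.
apply: indep2_pair => // A B D mA mB mD.
have mAB : measurable (z @^-1` A `&` xi @^-1` B) by apply: measurableI; exact: pre.
have ABE : P0 (z @^-1` A `&` xi @^-1` B) = (P0 (z @^-1` A) * P0 (xi @^-1` B))%E.
  have := indep4 mB measurableT mA measurableT.
  by rewrite !preimage_setT !setIT probability_setT !mule1 setIC muleC.
rewrite setIC -ABE muleC; apply: pair_indep_event => // C1 C2 mC1 mC2.
have -> : P0 (e @^-1` C1 `&` (fun w => (eps w, delta w)) @^-1` C2) =
    (P0 (e @^-1` C1) * P0 ((fun w => (eps w, delta w)) @^-1` C2))%E.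
  have := indep4 measurableT mC1 measurableT mC2.
  by rewrite !preimage_setT !setIT !setTI probability_setT !mule1 !mul1e.
rewrite ABE [(P0 (z @^-1` A) * _)%E]muleC muleA.
rewrite [(_ * P0 (xi @^-1` B))%E]muleC muleA -[RHS]muleA [(P0 _ * P0 (z @^-1` A))%E in RHS]muleC muleA.
rewrite -(indep4 mB mC1 mA mC2); congr (P0 _).
by apply/seteqP; split => w /=; tauto.
Qed.

(** With [e] independent of all the other primitive variables jointly, its zero mean removes it from
    every product with a function of [(z, x)]. *)
Let zg3_e : indep2 P0 (fun w => ((z w, xi w), (eps w, delta w))) e.
Proof.
apply: indep2_pair => //; first exact/measurable_fun_pair.
move=> A B C mA mB mC; have := zxi_ed mA (measurableX mC mB).
rewrite -setIA (_ : (fun w => (e w, (eps w, delta w))) @^-1` (C `*` B) =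
  (fun w => (eps w, delta w)) @^-1` B `&` e @^-1` C); last by apply/seteqP; split => w [].
move=> ->; rewrite -muleA; congr (_ * _)%E.
have := indep4 measurableT mC measurableT mB.
by rewrite !preimage_setT !setIT !setTI probability_setT !mule1 !mul1e setIC muleC.
Qed.

Let gxi (a b : R) : gaussian P0 (fun w => a * xi w + b * x w).
Proof.
(* Coefficients in the order [eps], [delta], [xi], after substituting [x = xi + delta]. *)
have := h_gauss (fun i => nth 0 [:: 0; b; a + b] i).
rewrite (_ : (fun w => \sum_(i < 3) _) = fun w => a * xi w + b * x w)//.
by apply/funext => w; rewrite !big_ord_recl big_ord0 !(tnth_nth (eps : T0 -> R))/= h_x; ring.
Qed.

Let geps (a b : R) : gaussian P0 (fun w => a * eps w + b * x w).
Proof.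
have := h_gauss (fun i => nth 0 [:: a; b; b] i).
rewrite (_ : (fun w => \sum_(i < 3) _) = fun w => a * eps w + b * x w)//.
by apply/funext => w; rewrite !big_ord_recl big_ord0 !(tnth_nth (eps : T0 -> R))/= h_x; ring.
Qed.

Let gx : gaussian P0 x.
Proof.
have := gxi 0 1; rewrite (_ : (fun w => _) = x)//.
by apply/funext => w; rewrite mul0r add0r mul1r.
Qed.

Let vx : Ex P0 (fun w => x w ^+ 2) - Ex P0 x ^+ 2 != 0.
Proof.
have [_ ix _ ix2 _] := gaussian_pair_sqr mxi mx gxi.
apply: contraTN h_sx => /eqP v0; rewrite -leNgt.
rewrite /variance covarianceEx// -expr2.
by rewrite (_ : Ex P0 (fun w => x w * x w) = Ex P0 (fun w => x w ^+ 2)) ?v0.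
Qed.

Let ixn n : intg P0 (fun w => x w ^+ n). Proof. exact: gaussian_intg_exp. Qed.

Let mzj (j : 'I_q) : measurable_fun setT (fun w => tnth (z w) j).
Proof. exact: (measurableT_comp (measurable_tnth j) mz). Qed.

Let izj2 (j : 'I_q) : intg P0 (fun w => tnth (z w) j ^+ 2).
Proof. exact: Lfun2_integrable_sqr. Qed.

Let izj (j : 'I_q) : intg P0 (fun w => tnth (z w) j).
Proof. exact: intg_sqr. Qed.

Let ie : intg P0 e.
Proof. by apply: intg_sqr => //; exact: Lfun2_integrable_sqr. Qed.

Let Ee : Ex P0 e = 0.
Proof. by rewrite /Rintegral; move: h_e0; rewrite unlock => ->. Qed.

(** The first two conclusions are the population normal equations, to be fed to the law of large
    numbers; the third identifies the conditional expectation given [(z, x)]. The error splits as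
    [W + e], where [W] depends on [(xi, eps, delta)] only. *)
Lemma model_regression : exists (b0 : R) (b : 'cV[R]_k),
  let eta w := y w - (dot c (tuple_col (z w)) + b0 + dot b (powers k (x w))) in
  [/\ forall n, intg P0 (fun w => eta w * x w ^+ n) /\ Ex P0 (fun w => eta w * x w ^+ n) = 0,
      forall j, intg P0 (fun w => eta w * tnth (z w) j) /\
                Ex P0 (fun w => eta w * tnth (z w) j) = 0 &
      forall B, measurable B -> Ex P0 (fun w => eta w * \1_B (z w, x w)) = 0].
Proof.
pose g j := sval (cid (gaussian_poly_regression mxi mx gxi vx j)).
have gP j : [/\ (size (g j) <= j.+1)%N,
      intg P0 (fun w => (xi w ^+ j - (g j).[x w]) ^+ 2),
      forall n, intg P0 (fun w => (xi w ^+ j - (g j).[x w]) * x w ^+ n) &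
      forall n, Ex P0 (fun w => (xi w ^+ j - (g j).[x w]) * x w ^+ n) = 0].
  by rewrite /g; case: cid.
have [g' [szg' i2' in' E0']] := gaussian_poly_regression meps mx geps vx 1.
(* The regression on [x] of everything in [y] except [c^T z] and [e]. Since [eps] may be correlated
   with [delta], it contributes the affine term [g']. Degree at most [k] allows the split into an
   intercept and [k] slopes. *)
pose G : {poly R} := beta0%:P + (\sum_(j < k) beta j 0 *: g j.+1 + g').
have szG : (size G <= k.+1)%N.
  rewrite (leq_trans (size_polyD _ _))// geq_max (leq_trans (size_polyC_leq1 _))//=.
  rewrite (leq_trans (size_polyD _ _))// geq_max (leq_trans szg') ?ltnS// andbT.
  rewrite (leq_trans (size_sum _ _ _))//; apply/bigmax_leqP => j _.
  rewrite (leq_trans (size_scale_leq _ _))//; have [szg _ _ _] := gP j.+1.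
  by rewrite (leq_trans szg)// !ltnS.
pose W w := \sum_(j < k) beta j 0 * (xi w ^+ j.+1 - (g j.+1).[x w]) + (eps w ^+ 1 - g'.[x w]).
exists G`_0, (\col_j G`_j.+1) => eta.
have lin w : G`_0 + dot (\col_j G`_j.+1) (powers k (x w)) = G.[x w].
  rewrite (horner_coef_wide _ szG) big_ord_recl expr0 mulr1 dotE; congr (_ + _).
  by apply: eq_bigr => j _; rewrite !mxE.
have etaE w : eta w = W w + e w.
  have betaE : dot beta (powers k (xi w)) = \sum_(j < k) beta j 0 * xi w ^+ j.+1.
    by rewrite dotE; apply: eq_bigr => j _; rewrite mxE.
  have WEw : W w = \sum_(j < k) beta j 0 * xi w ^+ j.+1 -
      \sum_(j < k) (beta j 0 *: g j.+1).[x w] + (eps w - g'.[x w]).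
    rewrite /W expr1 -sumrB; congr (_ + _).
    by apply: eq_bigr => j _; rewrite mulrBr hornerZ.
  rewrite /eta h_y -[X in _ - X]addrA lin betaE WEw /G !hornerD hornerC horner_sum.
  ring.
have mpoly (p : {poly R}) : measurable_fun setT (fun w => p.[x w]).
  by apply: measurableT_comp; [exact: measurable_horner|].
have mW1 j : measurable_fun setT (fun w => xi w ^+ j - (g j).[x w]).
  by apply: measurable_funB => //; exact: measurable_funX.
have mW2 : measurable_fun setT (fun w => eps w ^+ 1 - g'.[x w]).
  by apply: measurable_funB => //; exact: measurable_funX.
have mW : measurable_fun setT W.
  apply: measurable_funD => //; apply: measurable_fun_bigsum => j.
  exact: measurable_funM.
have iW2 : intg P0 (fun w => W w ^+ 2).
  apply: intg_sqrD => //.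
    by apply: measurable_fun_bigsum => j; exact: measurable_funM.
  apply: intg_sqr_sum => j; first exact: measurable_funM.
  by apply: intg_sqrZ; case: (gP j.+1).
have Wx n : (fun w => W w * x w ^+ n) = (fun w => \sum_(j < k) beta j 0 *
    ((xi w ^+ j.+1 - (g j.+1).[x w]) * x w ^+ n) + (eps w ^+ 1 - g'.[x w]) * x w ^+ n).
  apply/funext => w; rewrite /W mulrDl mulr_suml; congr (_ + _).
  by apply: eq_bigr => j _; rewrite mulrA.
have iWx n : intg P0 (fun w => W w * x w ^+ n).
  rewrite Wx; apply: intgD => //; apply: intg_sum => j _; apply: intgZ.
  by case: (gP j.+1).
have EWx n : Ex P0 (fun w => W w * x w ^+ n) = 0.
  have ij (j : 'I_k) : intg P0 (fun w => (xi w ^+ j.+1 - (g j.+1).[x w]) * x w ^+ n).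
    by case: (gP j.+1).
  rewrite Wx ExD//; last by apply: intg_sum => j _; exact: intgZ.
  rewrite E0' addr0 Ex_sum => [|j _]; last exact: intgZ.
  by rewrite big1// => j _; rewrite ExZ//; case: (gP j.+1) => _ _ _ ->; rewrite mulr0.
have iW : intg P0 W by exact: intg_sqr.
have EW : Ex P0 W = 0.
  by rewrite -(EWx 0%N); apply: eq_Rintegral => w _; rewrite expr0 mulr1.
have [m [s [_ XE]]] := gx.
have [lam lam0 ilam] := normal_law_expR_sqr mx XE.
have EWA A : measurable A -> Ex P0 (fun w => W w * \1_A (x w)) = 0.
  exact: (moment_determinacy mW mx iW2 lam0 ilam iWx EWx).
(* [W] and [x] are written as functions of the triple [g3], so that they inherit jointly its
   independence from [z]. *)
pose fW (u : R * (R * R)) := \sum_(j < k) beta j 0 *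
   (u.1 ^+ j.+1 - (g j.+1).[u.1 + u.2.2]) + (u.2.1 ^+ 1 - g'.[u.1 + u.2.2]).
pose fx (u : R * (R * R)) := u.1 + u.2.2.
have m1 : measurable_fun setT (fun u : R * (R * R) => u.1) by exact: measurable_fst.
have m21 : measurable_fun setT (fun u : R * (R * R) => u.2.1).
  by apply: measurableT_comp; [exact: measurable_fst|exact: measurable_snd].
have m22 : measurable_fun setT (fun u : R * (R * R) => u.2.2).
  by apply: measurableT_comp; [exact: measurable_snd|exact: measurable_snd].
have mfx : measurable_fun setT fx by exact: measurable_funD.
have mfp (p : {poly R}) : measurable_fun setT (fun u => p.[fx u]).
  by apply: (measurableT_comp (measurable_horner p)).
have mfW : measurable_fun setT fW.
  apply: measurable_funD.
    apply: measurable_fun_bigsum => j; apply: measurable_funM => //.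
    by apply: measurable_funB => //; exact: measurable_funX.
  by apply: measurable_funB => //; exact: measurable_funX.
have WE : W = fun w => fW (g3 w).
  by apply/funext => w; rewrite /W /fW /= h_x.
have xE : x = (fun w => fx (g3 w)) :> (T0 -> R) by apply/funext => w; rewrite h_x.
have mtn (j : 'I_q) : measurable_fun setT (fun t : q.-tuple R => tnth t j) by exact: measurable_tnth.
have W_zj j : indep2 P0 W (fun w => tnth (z w) j).
  by rewrite WE; apply: (indep2_comp mfW (mtn j)).
pose S := ((q.-tuple R * R) * (R * R))%type.
have e_of (f : S -> R) : measurable_fun setT f ->
    indep2 P0 e (fun w => f ((z w, xi w), (eps w, delta w))).
  move=> mf A B mA mB; rewrite setIC muleC.
  by apply: (indep2_comp mf (@measurable_id _ R setT) zg3_e).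
have m11 : measurable_fun setT (fun s : S => s.1.1).
  by apply: measurableT_comp; [exact: measurable_fst|exact: measurable_fst].
have msx : measurable_fun setT (fun s : S => s.1.2 + s.2.2).
  apply: measurable_funD.
    by apply: measurableT_comp; [exact: measurable_snd|exact: measurable_fst].
  by apply: measurableT_comp; [exact: measurable_snd|exact: measurable_snd].
have xdE w : xi w + delta w = x w by rewrite h_x.
have ind_ge (A : set R) : measurable A -> intg P0 (fun w => \1_A (x w)).
  by move=> mA; apply: (intg_indic P0 (A := x @^-1` A)); exact: pre.
split.
- move=> n.
  have ex : indep2 P0 e (fun w => x w ^+ n).
    have := e_of (fun s => (s.1.2 + s.2.2) ^+ n) (measurable_funX n msx).
    by under eq_fun do rewrite /= xdE.
  have [iex Eex] := Ex_indepM ex ie (ixn n).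
  have -> : (fun w => eta w * x w ^+ n) = (fun w => W w * x w ^+ n + e w * x w ^+ n).
    by apply/funext => w; rewrite etaE mulrDl.
  split; first exact: intgD.
  by rewrite ExD// EWx Eex Ee mul0r addr0.
- move=> j.
  have ez : indep2 P0 e (fun w => tnth (z w) j).
    exact: (e_of (fun s => tnth s.1.1 j) (measurableT_comp (mtn j) m11)).
  have [iez Eez] := Ex_indepM ez ie (izj j).
  have [iWz EWz] := Ex_indepM (W_zj j) iW (izj j).
  have -> : (fun w => eta w * tnth (z w) j) = (fun w => W w * tnth (z w) j + e w * tnth (z w) j).
    by apply/funext => w; rewrite etaE mulrDl.
  split; first exact: intgD.
  by rewrite ExD// EWz Eez Ee EW !mul0r addr0.
move=> B mB; have mzx : measurable_fun setT (fun w => (z w, x w)) by exact/measurable_fun_pair.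
have iB : intg P0 (fun w => \1_B (z w, x w)).
  by apply: (intg_indic P0 (A := (fun w => (z w, x w)) @^-1` B)); exact: pre.
have eB : indep2 P0 e (fun w => \1_B (z w, x w) : R).
  have mf : measurable_fun setT (fun s : S => \1_B (s.1.1, s.1.2 + s.2.2) : R).
    by apply: measurableT_comp; [exact: measurable_indic|exact/measurable_fun_pair].
  have := e_of _ mf.
  by under eq_fun do rewrite /= xdE.
have [ieB EeB] := Ex_indepM eB ie iB.
have iWB : intg P0 (fun w => W w * \1_B (z w, x w)).
  exact: (intgMindic (pre mzx mB) iW).
under eq_Rintegral do rewrite etaE mulrDl.
rewrite ExD// EeB Ee mul0r addr0.
(* The [e] part is gone. On a rectangle [C] times [A] the factor [W \1_A(x)] has mean zero by moment
   determinacy and is independent of [\1_C(z)]; the Dynkin argument passes to general [B]. *)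
move: B mB {iB eB ieB EeB iWB}.
apply: (@Ex_pi_lambda _ T0 R P0 _ _
  [set A | exists A1, measurable A1 /\ exists A2, measurable A2 /\ A = A1 `*` A2]
  (fun w => (z w, x w))) => //.
- rewrite measurable_prod_measurableType //; congr (<<s _ >>).
  rewrite predeqE; split => [[A mA [B mB <-]]|[A [mA [B [mB ->]]]]].
    by exists A; split => //; exists B.
  by exists A => //; exists B.
- move=> /= _ _ [X1 [mX1 [X2 [mX2 ->]]]] [Y1 [mY1 [Y2 [mY2 ->]]]].
  rewrite -setXI; exists (X1 `&` Y1); split; first exact: measurableI.
  by exists (X2 `&` Y2); split => //; exact: measurableI.
move=> _ [C [mC [A [mA ->]]]].
have iWA : intg P0 (fun w => W w * \1_A (x w)) by exact: (intgMindic (pre mx mA) iW).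
have iC : intg P0 (fun w => \1_C (z w)).
  by apply: (intg_indic P0 (A := z @^-1` C)); exact: pre.
have WC : indep2 P0 (fun w => W w * \1_A (x w)) (fun w => \1_C (z w) : R).
  have m1A : measurable_fun setT (fun u => fW u * \1_A (fx u)).
    by apply: measurable_funM => //; apply: measurableT_comp => //; exact: measurable_indic.
  have mC1 : measurable_fun setT (fun t : q.-tuple R => \1_C t : R) by exact: measurable_indic.
  by rewrite WE xE; exact: (indep2_comp m1A mC1 g3z).
have [_ EWC] := Ex_indepM WC iWA iC.
transitivity (Ex P0 (fun w => W w * \1_A (x w) * \1_C (z w))).
  apply: eq_Rintegral => w _; rewrite -mulrA; congr (_ * _).
  by rewrite !indicE in_setX -mulnb natrM mulrC.
by rewrite EWC EWA// mul0r.
Qed.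

(** Independence of [z] and [x] makes the covariance of the regressors block diagonal, with the
    covariance of [z] and that of the powers of [x] as blocks. *)
Lemma model_design (r := fun w => col_mx (tuple_col (z w)) (powers k (x w))) :
  [/\ forall i, intg P0 (fun w => r w i 0),
      forall i j, intg P0 (fun w => r w i 0 * r w j 0) &
      \matrix_(i, j) (Ex P0 (fun w => r w i 0 * r w j 0) -
        Ex P0 (fun w => r w i 0) * Ex P0 (fun w => r w j 0)) \in unitmx].
Proof.
have rl (i : 'I_q) : (fun w => r w (lshift k i) 0) = (fun w => tnth (z w) i).
  by apply/funext => w; rewrite /r col_mxEu mxE.
have rr (i : 'I_k) : (fun w => r w (rshift q i) 0) = (fun w => x w ^+ i.+1).
  by apply/funext => w; rewrite /r col_mxEd mxE.
have zx (i : 'I_q) n : intg P0 (fun w => tnth (z w) i * x w ^+ n) /\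
    Ex P0 (fun w => tnth (z w) i * x w ^+ n) =
    Ex P0 (fun w => tnth (z w) i) * Ex P0 (fun w => x w ^+ n).
  apply: Ex_indepM => //.
  have mf : measurable_fun setT (fun u : R * (R * R) => (u.1 + u.2.2) ^+ n).
    apply: measurable_funX; apply: measurable_funD; first exact: measurable_fst.
    by apply: measurableT_comp; [exact: measurable_snd|exact: measurable_snd].
  move=> A B mA mB; rewrite setIC muleC.
  have := indep2_comp mf (measurable_tnth i) g3z mB mA.
  by under eq_fun do rewrite /= -h_x.
have ir i : intg P0 (fun w => r w i 0).
  by case: (split_ordP i) => j ->; rewrite ?rl ?rr.
have rM i j (f g : T0 -> R) : (fun w => r w i 0) = f -> (fun w => r w j 0) = g ->
  (fun w => r w i 0 * r w j 0) = (fun w => f w * g w) by move=> <- <-.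
have irr i j : intg P0 (fun w => r w i 0 * r w j 0).
  case: (split_ordP i) => i' ->; case: (split_ordP j) => j' ->.
  - by rewrite (rM _ _ _ _ (rl i') (rl j')); exact: intg_mul.
  - by rewrite (rM _ _ _ _ (rl i') (rr j')); exact: (zx _ _).1.
  - rewrite (rM _ _ _ _ (rr i') (rl j')).
    by under eq_fun do rewrite mulrC; exact: (zx _ _).1.
  - rewrite (rM _ _ _ _ (rr i') (rr j')).
    by under eq_fun do rewrite -exprD.
split => //.
set S := \matrix_(i, j) _.
pose Sp := \matrix_(i < k, j < k) (Ex P0 (fun w => x w ^+ i.+1 * x w ^+ j.+1) -
     Ex P0 (fun w => x w ^+ i.+1) * Ex P0 (fun w => x w ^+ j.+1)).
have -> : S = block_mx (cov_mx P0 z) 0 0 Sp.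
  apply/matrixP => i j; rewrite mxE.
  case: (split_ordP i) => i' ->; case: (split_ordP j) => j' ->.
  - rewrite (rM _ _ _ _ (rl i') (rl j')) !rl block_mxEul mxE covarianceEx//.
    exact: intg_mul.
  - by rewrite (rM _ _ _ _ (rl i') (rr j')) rl rr block_mxEur mxE (zx _ _).2 subrr.
  - rewrite (rM _ _ _ _ (rr i') (rl j')) rl rr block_mxEdl mxE.
    under eq_Rintegral do rewrite mulrC.
    by rewrite (zx _ _).2 mulrC subrr.
  - by rewrite (rM _ _ _ _ (rr i') (rr j')) !rr block_mxEdr mxE.
rewrite unitmxE det_ublock unitrM -!unitmxE h_Sz.
exact: powers_cov_unit.
Qed.

End errors_in_variables_model.

(** * Limit of the least squares predictor *)

Section ols_limit.
Context (R : realType).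

Lemma cvg_near_eq (f g : nat -> R) (l : R) : (\forall n \near \oo, f n = g n) ->
  g n @[n --> \oo] --> l -> f n @[n --> \oo] --> l.
Proof.
by move=> fg; apply: cvg_trans; apply: near_eq_cvg; apply: filterS fg => n ->.
Qed.

Lemma cvg_bigsum (I : Type) (s : seq I) (u : I -> nat -> R) (l : I -> R) :
  (forall i, u i n @[n --> \oo] --> l i) ->
  \sum_(i <- s) u i n @[n --> \oo] --> \sum_(i <- s) l i.
Proof.
move=> ul; elim: s => [|i s ih].
  by under eq_fun do rewrite big_nil; rewrite big_nil; exact: cvg_cst.
by under eq_fun do rewrite big_cons; rewrite big_cons; apply: cvgD.
Qed.

Lemma cvg_bigprod (I : Type) (s : seq I) (u : I -> nat -> R) (l : I -> R) :
  (forall i, u i n @[n --> \oo] --> l i) ->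
  \prod_(i <- s) u i n @[n --> \oo] --> \prod_(i <- s) l i.
Proof.
move=> ul; elim: s => [|i s ih].
  by under eq_fun do rewrite big_nil; rewrite big_nil; exact: cvg_cst.
by under eq_fun do rewrite big_cons; rewrite big_cons; apply: cvgM.
Qed.

Lemma cvg_det (m : nat) (A : nat -> 'M[R]_m) (B : 'M[R]_m) :
  (forall i j, A n i j @[n --> \oo] --> B i j) -> \det (A n) @[n --> \oo] --> \det B.
Proof.
move=> AB; rewrite /determinant; apply: cvg_bigsum => s.
apply: cvgMr; eapply cvg_bigprod => i; exact: AB.
Qed.

(** The determinant is a polynomial in the entries, so it is eventually nonzero; from there on the
    adjugate formula applies. *)
Lemma cvg_invmx (m : nat) (A : nat -> 'M[R]_m) (B : 'M[R]_m) : B \in unitmx ->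
  (forall i j, A n i j @[n --> \oo] --> B i j) ->
  (\forall n \near \oo, A n \in unitmx) /\
  forall i j, invmx (A n) i j @[n --> \oo] --> invmx B i j.
Proof.
move=> uB AB; have dB : \det B != 0 by rewrite -unitfE -unitmxE.
have dA := cvg_det AB.
have uA : \forall n \near \oo, A n \in unitmx.
  have : \forall n \near \oo, `|\det B - \det (A n)| < `|\det B|.
    by move/cvgrPdist_lt : dA; apply; rewrite normr_gt0.
  apply: filterS => n; rewrite unitmxE unitfE; apply: contraTN => /eqP ->.
  by rewrite subr0 ltxx.
split=> // i j.
have adj : \adj (A n) i j @[n --> \oo] --> \adj B i j.
  under eq_fun do rewrite mxE; rewrite mxE /cofactor; apply: cvgMr.
  apply: cvg_det => i' j'; under eq_fun do rewrite !mxE; rewrite !mxE; exact: AB.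
rewrite (_ : invmx B i j = (\det B)^-1 * \adj B i j); last by rewrite /invmx uB mxE.
apply: (@cvg_near_eq _ (fun n => (\det (A n))^-1 * \adj (A n) i j)); last first.
  by apply: cvgM => //; exact: cvgV.
near=> n; have un : A n \in unitmx by near: n.
by rewrite /invmx un mxE.
Unshelve. all: by end_near. Qed.

(** Pseudo-inversion is discontinuous where the rank drops. Eventual invertibility of the sample
    covariance allows its replacement by the ordinary inverse before limits are taken. *)
Lemma mpinv_unit (m : nat) (A : 'M[R]_m) : A \in unitmx -> mpinv A = invmx A.
Proof.
move=> uA; apply: (mpinv_unique (mpinvP A)).
by split; rewrite ?mulmxV ?mulVmx ?mul1mx ?trmx1// mulmxKV.
Qed.

Definition avg (n : nat) (f : nat -> R) : R := n%:R^-1 * \sum_(1 <= i < n.+1) f i.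

Lemma smeanE (m n : nat) (u : nat -> 'cV[R]_m) a : smean n u a 0 = avg n (fun i => u i a 0).
Proof. by rewrite /smean !mxE summxE. Qed.

Lemma scovE (m p n : nat) (u : nat -> 'cV[R]_m) (v : nat -> 'cV[R]_p) a b : (0 < n)%N ->
  scov n u v a b = avg n (fun i => u i a 0 * v i b 0) -
                   avg n (fun i => u i a 0) * avg n (fun i => v i b 0).
Proof.
move=> n0; have nn : n%:R != 0 :> R by rewrite pnatr_eq0 -lt0n.
have sub (l : nat) (A B : 'cV[R]_l) i : (A - B) i 0 = A i 0 - B i 0 by rewrite !mxE.
rewrite /scov mxE summxE.
under eq_bigr do rewrite mxE big_ord1 [X in _ * X]mxE !sub.
rewrite -!smeanE; set U := smean n u a 0; set V := smean n v b 0.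
have SU : \sum_(1 <= i < n.+1) u i a 0 = n%:R * U.
  by rewrite /U smeanE /avg mulVKf.
have SV : \sum_(1 <= i < n.+1) v i b 0 = n%:R * V.
  by rewrite /V smeanE /avg mulVKf.
rewrite (eq_bigr (fun i => u i a 0 * v i b 0 - V * u i a 0 - (U * v i b 0 - U * V))); last first.
  by move=> i _; ring.
rewrite !sumrB -!mulr_sumr SU SV sumr_const_nat subSS subn0 -mulr_natl /avg.
by move: (\sum_(1 <= i < n.+1) _) => X; field.
Qed.

Lemma dotBr (m : nat) (u v w : 'cV[R]_m) : dot u (v - w) = dot u v - dot u w.
Proof. by rewrite /dot mulmxBr !mxE. Qed.

Section predictor.
Variables (q k : nat) (y : nat -> R) (z : nat -> 'cV[R]_q) (x : nat -> R).
Variables (th : 'cV[R]_(q + k)) (b0 : R).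
Let r i := col_mx (z i) (powers k (x i)).
Let eta i := y i - (dot th (r i) + b0).
Let Y i : 'cV[R]_1 := (y i)%:M.
Let H i : 'cV[R]_1 := (eta i)%:M.

Let YE i : Y i = th^T *m r i + b0%:M + H i.
Proof.
rewrite [th^T *m _]mx11_scalar -/(dot th (r i)) -!raddfD/= /Y; congr (_ %:M).
by rewrite /eta addrC subrK.
Qed.

Let smeanY n : (0 < n)%N -> smean n Y = th^T *m smean n r + b0%:M + smean n H.
Proof.
move=> n0; have nn : n%:R != 0 :> R by rewrite pnatr_eq0 -lt0n.
rewrite /smean; under eq_bigr do rewrite YE.
rewrite !big_split/= !scalerDr -scalemxAr -mulmx_sumr; congr (_ + _ + _).
rewrite sumr_const_nat subSS subn0 (_ : b0%:M *+ n = n%:R *: b0%:M); last by rewrite scaler_nat.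
by rewrite scalerA mulVf// scale1r.
Qed.

(** Centring removes the intercept. For an invertible sample covariance the estimation error is
    therefore its inverse applied to [scov n r H]. *)
Let scovY n : (0 < n)%N -> scov n r Y = scov n r r *m th + scov n r H.
Proof.
move=> n0; rewrite /scov -scalemxAl -scalerDr mulmx_suml -big_split/=.
congr (_ *: _); apply: eq_bigr => i _.
rewrite -mulmxA -mulmxDr; congr (_ *m _).
rewrite smeanY// YE -[th in RHS]trmxK -trmx_mul -linearD/=; congr (_^T).
rewrite mulmxBr; move: (th^T *m r i) (th^T *m _) (H i) (smean n H) => a a' b b'.
rewrite opprD addrACA; congr (_ + _).
by rewrite opprD addrACA subrr addr0.
Qed.

(** In centred form the estimated intercept disappears, and only the coefficients and the two sample
    means have to converge. *)
Lemma ols_predictorE n z0 x0 : ols_predictor k y z x n z0 x0 =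
  dot (ols_coef k y z x n) (col_mx z0 (powers k x0) - smean n r) + smean n Y 0 0.
Proof.
rewrite /ols_predictor /ols_beta0 /ols_c /ols_beta; set C := ols_coef k y z x n.
have dotC (u : 'cV[R]_q) (v : 'cV[R]_k) : dot C (col_mx u v) = dot (usubmx C) u + dot (dsubmx C) v.
  by rewrite /dot -{1}[C]vsubmxK tr_col_mx mul_row_col mxE.
have sr : smean n r = col_mx (smean n z) (smean n (fun i => powers k (x i))).
  rewrite /smean -scale_col_mx; congr (_ *: _); elim/big_rec3 : _ => [|i a b c _ ->].
    by rewrite col_mx0.
  by rewrite add_col_mx.
by rewrite dotBr sr !dotC -/Y; ring.
Qed.

Variables (mu : 'cV[R]_(q + k)) (M : 'M[R]_(q + k)).
Hypothesis cvg_r : forall a, avg n (fun i => r i a 0) @[n --> \oo] --> mu a 0.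
Hypothesis cvg_rr : forall a b, avg n (fun i => r i a 0 * r i b 0) @[n --> \oo] --> M a b.
Hypothesis cvg_eta : avg n eta @[n --> \oo] --> 0.
Hypothesis cvg_reta : forall a, avg n (fun i => r i a 0 * eta i) @[n --> \oo] --> 0.
Hypothesis unit_S : \matrix_(a, b) (M a b - mu a 0 * mu b 0) \in unitmx.

(** A statement about one fixed sequence of observations: randomness enters later, through the
    almost sure validity of the four limits assumed here. *)
Lemma ols_predictor_cvg z0 x0 : ols_predictor k y z x n z0 x0 @[n --> \oo] -->
  dot th (col_mx z0 (powers k x0)) + b0.
Proof.
have HE i : H i 0 0 = eta i by rewrite mxE eqxx.
have n_gt0 : \forall n \near \oo, (0 < n)%N by exact: nbhs_infty_gt.
have cS a b : scov n r r a b @[n --> \oo] --> (\matrix_(a, b) (M a b - mu a 0 * mu b 0)) a b.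
  rewrite mxE; apply: (@cvg_near_eq _ (fun n => avg n (fun i => r i a 0 * r i b 0) -
    avg n (fun i => r i a 0) * avg n (fun i => r i b 0))); last first.
    by apply: cvgB; [exact: cvg_rr|apply: cvgM; exact: cvg_r].
  by near=> n; rewrite scovE//; near: n.
have cH a : scov n r H a 0 @[n --> \oo] --> 0.
  apply: (@cvg_near_eq _ (fun n => avg n (fun i => r i a 0 * eta i) -
    avg n (fun i => r i a 0) * avg n eta)); last first.
    rewrite [X in _ --> X](_ : 0 = 0 - mu a 0 * 0); last by rewrite mulr0 subr0.
    by apply: cvgB; [exact: cvg_reta|apply: cvgM; [exact: cvg_r|exact: cvg_eta]].
  near=> n.
  rewrite scovE; last by near: n.
  by congr (_ - _ * _); congr avg; apply/funext => i; rewrite HE.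
have [uS iS] := cvg_invmx unit_S cS.
have ccoef a : ols_coef k y z x n a 0 @[n --> \oo] --> th a 0.
  (* The estimation error is a convergent matrix times a vector tending to 0. *)
  have cd : th a 0 + \sum_j invmx (scov n r r) a j * scov n r H j 0 @[n --> \oo] --> th a 0.
    rewrite -[X in _ --> X]addr0; apply: cvgD; first exact: cvg_cst.
    rewrite [X in _ --> X](_ : 0 = \sum_j invmx (\matrix_(a, b) (M a b - mu a 0 * mu b 0)) a j * 0).
      by apply: cvg_bigsum => j; apply: cvgM; [exact: iS|exact: cH].
    by rewrite big1// => j _; rewrite mulr0.
  move: cd; apply: cvg_near_eq; near=> n.
  have un : scov n r r \in unitmx by near: n.
  rewrite /ols_coef -/Y -/r mpinv_unit// scovY; last by near: n.
  by rewrite mulmxDr mulKmx// !mxE.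
have cY : smean n Y 0 0 @[n --> \oo] --> dot th mu + b0.
  have : \sum_j th j 0 * avg n (fun i => r i j 0) + b0 + avg n eta @[n --> \oo] --> dot th mu + b0 + 0.
    apply: cvgD => //; apply: cvgD; last exact: cvg_cst.
    by rewrite dotE; apply: cvg_bigsum => j; apply: cvgMr.
  rewrite addr0; apply: cvg_near_eq; near=> n.
  rewrite smeanY; last by near: n.
  rewrite !mxE eqxx mulr1n summxE; congr (_ + _ + _ * _).
    by apply: eq_bigr => j _; rewrite !mxE summxE.
  by apply: eq_bigr => i _; rewrite HE.
under eq_fun do rewrite ols_predictorE.
rewrite (_ : dot th _ + b0 = dot th (col_mx z0 (powers k x0) - mu) + (dot th mu + b0)); last first.
  by rewrite dotBr; ring.
apply: cvgD => //; under eq_fun do rewrite dotE; rewrite dotE.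
apply: cvg_bigsum => j; apply: cvgM => //.
under eq_fun do rewrite !mxE summxE; rewrite !mxE; apply: cvgB; first exact: cvg_cst.
exact: cvg_r.
Unshelve. all: by end_near. Qed.

End predictor.
End ols_limit.

(** * Almost sure uniqueness of conditional expectations *)

Section cond_expectation_uniqueness.
Context d (T : measurableType d) (R : realType) (P : probability T R).
Context dU (U : measurableType dU) (f : T -> U).
Hypothesis mf : measurable_fun setT f.

(** The set where [Z > L] belongs to the conditioning sigma-algebra, so the nonnegative function
    [Z - L] restricted to it has integral zero. *)
Let le_ae (Z L : T -> R) : sigma_of Z `<=` sigma_of f -> sigma_of L `<=` sigma_of f ->
  intg P Z -> intg P L ->
  (forall A, sigma_of f A -> Ex P (fun w => Z w * \1_A w) = Ex P (fun w => L w * \1_A w)) ->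
  {ae P, forall w, Z w <= L w}.
Proof.
move=> Zf Lf iZ iL ZL; pose A := [set w | 0 < Z w - L w].
have Af : sigma_of f A.
  have m (g : T -> R) : sigma_of g `<=` sigma_of f ->
      measurable_fun [set: g_sigma_algebra_preimageType f] (g : g_sigma_algebra_preimageType f -> R).
    by move=> gf _ B mB; apply: gf; exists B.
  have := measurable_funB (m Z Zf) (m L Lf) measurableT (measurable_itv `]0, +oo[).
  by rewrite setTI; congr (measurable _); apply/seteqP; split => w /=; rewrite in_itv/= andbT.
have mA : measurable A by case: Af => B mB <-; exact: mf.
have iA g : intg P g -> intg P (fun w => g w * \1_A w) by exact: intgMindic.
have : {ae P, forall w, Z w * \1_A w - L w * \1_A w = 0}.
  apply: Ex_eq0_ae.
  - by apply: intgB; exact: iA.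
  - move=> w; rewrite -mulrBl indicE; case: (boolP (w \in A)); rewrite ?mulr0//.
    by rewrite inE /A mulr1 => /ltW.
  - by rewrite ExB ?ZL ?subrr//; exact: iA.
apply: filterS => w; rewrite -mulrBl indicE; case: (boolP (w \in A)).
  by rewrite inE mulr1 => + Zw; rewrite /A/= Zw ltxx.
by rewrite notin_setE /A/= => /negP; rewrite -leNgt subr_le0.
Qed.

Lemma ae_eq_of_integrals (Z L : T -> R) :
  sigma_of Z `<=` sigma_of f -> sigma_of L `<=` sigma_of f ->
  intg P Z -> intg P L ->
  (forall A, sigma_of f A -> Ex P (fun w => Z w * \1_A w) = Ex P (fun w => L w * \1_A w)) ->
  {ae P, forall w, Z w = L w}.
Proof.
move=> Zf Lf iZ iL ZL.
have h1 := le_ae Zf Lf iZ iL ZL; have h2 := le_ae Lf Zf iL iZ (fun A fA => esym (ZL A fA)).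
by apply: filterS2 h1 h2 => w ? ?; apply/eqP; rewrite eq_le; apply/andP.
Qed.

End cond_expectation_uniqueness.

(** * Strong consistency and its conditional form *)

Theorem theorem4 (R : realType) (q k : nat) (hk : (2 <= k)%N)
  (* the model *)
  (d0 : measure_display) (T0 : measurableType d0) (P0 : probability T0 R)
  (y xi e eps x delta : {RV P0 >-> R}) (z : {RV P0 >-> q.-tuple R})
  (c : 'cV[R]_q) (beta0 : R) (beta : 'cV[R]_k)
  (h_y : forall w, y w = dot c (tuple_col (z w)) + beta0
                         + dot beta (powers k (xi w)) + e w + eps w)
  (h_x : forall w, x w = xi w + delta w)
  (* (a) *)
  (h_indep : independent_systems P0
     (tnth [tuple sigma_of xi; sigma_of e; sigma_of z;
                  sigma_of (fun w => (eps w, delta w))]))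
  (h_xi2 : (xi : T0 -> R) \in Lfun P0 2%:E)
  (h_e2 : (e : T0 -> R) \in Lfun P0 2%:E)
  (h_z2 : forall j : 'I_q, (fun w => tnth (z w) j) \in Lfun P0 2%:E)
  (h_eps2 : (eps : T0 -> R) \in Lfun P0 2%:E)
  (h_delta2 : (delta : T0 -> R) \in Lfun P0 2%:E)
  (* (b) *)
  (h_Sz : cov_mx P0 z \in unitmx)
  (h_sx : (0 < 'V_P0[x])%E)
  (* (c) *)
  (h_e0 : ('E_P0[e] = 0)%E) (h_eps0 : ('E_P0[eps] = 0)%E)
  (h_delta0 : ('E_P0[delta] = 0)%E)
  (* (d) *)
  (h_gauss : jointly_gaussian P0
     (tnth [tuple (eps : T0 -> R); (delta : T0 -> R); (xi : T0 -> R)]))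
  (* independent copies of the model, indexed by 0, 1, 2, ... *)
  (d : measure_display) (T : measurableType d) (P : probability T R)
  (ys xis es epss xs deltas : nat -> {RV P >-> R})
  (zs : nat -> {RV P >-> q.-tuple R})
  (h_copy : forall i : nat, same_law P0 P
     (model_vector y z xi e eps x delta)
     (model_vector (ys i) (zs i) (xis i) (es i) (epss i) (xs i) (deltas i)))
  (h_indep_copies : independent_systems P (fun i : nat => sigma_of
     (model_vector (ys i) (zs i) (xis i) (es i) (epss i) (xs i) (deltas i))))
  (* a version of the best predictor E[y_0 | z_0, x_0] *)
  (yhat0 : T -> R)
  (h_yhat0 : is_cond_expectation P
     (sigma_of (fun w => (zs 0%N w, xs 0%N w))) (ys 0%N) yhat0) :
  let ytilde0 (n : nat) (w : T) : R :=
    ols_predictor k (fun i => ys i w) (fun i => tuple_col (zs i w))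
      (fun i => xs i w) n (tuple_col (zs 0%N w)) (xs 0%N w) in
  {ae P, forall w, ytilde0 n w @[n --> \oo] --> yhat0 w}
  /\
  (forall tau : R, 0 < tau ->
   forall p : nat -> T -> R,
     (forall n : nat, (0 < n)%N -> is_cond_probability P
        (sigma_of (fun w => (zs 0%N w, xs 0%N w)))
        [set w | tau < `|ytilde0 n w - yhat0 w|] (p n)) ->
     {ae P, forall w, p n w @[n --> \oo] --> (0 : R)}).
Proof.
move=> ytilde0; have hk0 : (0 < k)%N by apply: leq_trans hk.
have [b0 [b [Hx Hz HB]]] := model_regression hk0 h_y h_x h_indep h_e2 h_z2 h_sx h_e0 h_gauss.
have [ir irr unitS] := model_design k h_x h_indep h_z2 h_Sz h_sx h_gauss.
pose U := (R * q.-tuple R * R * R * R * R * R)%type.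
pose M0 := model_vector y z xi e eps x delta : T0 -> U.
pose Ms i := model_vector (ys i) (zs i) (xis i) (es i) (epss i) (xs i) (deltas i) : T -> U.
have mM0 : measurable_fun setT M0 by do 6 apply: measurable_fun_pair => //.
have mMs i : measurable_fun setT (Ms i) by do 6 apply: measurable_fun_pair => //.
pose th := col_mx c b : 'cV[R]_(q + k).
pose rU (u : U) := col_mx (tuple_col u.1.1.1.1.1.2) (powers k u.1.2) : 'cV[R]_(q + k).
pose etaU (u : U) := u.1.1.1.1.1.1 - (dot th (rU u) + b0).
have m1 : measurable_fun setT (fun u : U => u.1.1.1.1.1).
  by do 4 (apply: measurableT_comp; first exact: measurable_fst); exact: measurable_fst.
have mpx : measurable_fun setT (fun u : U => u.1.2).
  by apply: measurableT_comp; [exact: measurable_snd|exact: measurable_fst].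
have mpz : measurable_fun setT (fun u : U => u.1.1.1.1.1.2).
  by apply: (measurableT_comp _ m1); exact: measurable_snd.
have mpy : measurable_fun setT (fun u : U => u.1.1.1.1.1.1).
  by apply: (measurableT_comp _ m1); exact: measurable_fst.
have mr a : measurable_fun setT (fun u => rU u a 0).
  case: (split_ordP a) => j ->.
    under eq_fun do rewrite col_mxEu mxE.
    exact: (measurableT_comp (measurable_tnth j) mpz).
  by under eq_fun do rewrite col_mxEd mxE; exact: measurable_funX.
have mdot : measurable_fun setT (fun u => dot th (rU u)).
  under eq_fun do rewrite dotE.
  by apply: measurable_fun_bigsum => j; exact: measurable_funM.
have meta : measurable_fun setT etaU.
  by apply: measurable_funB => //; exact: measurable_funD.
have dot_th (zz : 'cV[R]_q) (pp : 'cV[R]_k) : dot th (col_mx zz pp) = dot c zz + dot b pp.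
  by rewrite /dot tr_col_mx mul_row_col mxE.
have etaE w : y w - (dot c (tuple_col (z w)) + b0 + dot b (powers k (x w))) = etaU (M0 w).
  by rewrite /etaU dot_th addrAC.
have Ex_eta0 : intg P0 (fun w => etaU (M0 w)) /\ Ex P0 (fun w => etaU (M0 w)) = 0.
  have := Hx 0%N; rewrite (_ : (fun w => _ * _) = fun w => etaU (M0 w))//.
  by apply/funext => w; rewrite expr0 mulr1 etaE.
have Ex_reta0 a : intg P0 (fun w => rU (M0 w) a 0 * etaU (M0 w)) /\
    Ex P0 (fun w => rU (M0 w) a 0 * etaU (M0 w)) = 0.
  case: (split_ordP a) => j ->.
    have := Hz j; rewrite (_ : (fun w => _ * _) = fun w => rU (M0 w) (lshift k j) 0 * etaU (M0 w))//.
    by apply/funext => w; rewrite etaE mulrC col_mxEu mxE.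
  have := Hx j.+1; rewrite (_ : (fun w => _ * _) = fun w => rU (M0 w) (rshift q j) 0 * etaU (M0 w))//.
  by apply/funext => w; rewrite etaE mulrC col_mxEd mxE.
have slln_copy (phi : U -> R) : measurable_fun setT phi -> intg P0 (fun w => phi (M0 w)) ->
    {ae P, forall w, avg n (fun i => phi (Ms i w)) @[n --> \oo] --> Ex P0 (fun w => phi (M0 w))}.
  move=> mphi iphi.
  have preU A : measurable A -> measurable (phi @^-1` A).
    by move=> mA; rewrite -[S in measurable S]setTI; exact: mphi.
  (* Copy 0 is reserved for prediction and the averages start at index 1, so the law of large
     numbers is applied to the shifted sequence. Its limit is an expectation in the original
     model. *)
  have := @slln _ T R P (fun i w => phi (Ms i.+1 w)).
  rewrite (same_law_Ex mM0 (mMs 1%N) (h_copy 1%N) mphi iphi) => sl.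
  have {}sl := sl (fun i => measurableT_comp mphi (mMs i.+1))
    (same_law_intg mM0 (mMs 1%N) (h_copy 1%N) mphi iphi).
  have /sl {}sl : forall i, same_law P P (fun w => phi (Ms 1%N w)) (fun w => phi (Ms i.+1 w)).
    move=> i A mA; have mphiA := preU A mA.
    by rewrite -[LHS](h_copy 1%N _ mphiA) -[RHS](h_copy i.+1 _ mphiA).
  have /sl : forall i j, i != j -> indep2 P (fun w => phi (Ms i.+1 w)) (fun w => phi (Ms j.+1 w)).
    move=> i j ij A B mA mB.
    have sA l C : measurable C -> sigma_of (Ms l) ((fun w => phi (Ms l w)) @^-1` C).
      by move=> mC; exists (phi @^-1` C); [exact: preU|rewrite setTI].
    have ij1 : i.+1 != j.+1 by rewrite eqSS.
    rewrite (independent_systems_pair h_indep_copies ij1 (sA _ _ mA) (sA _ _ mB)).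
    have fP l C : measurable C -> P ((fun w => phi (Ms l w)) @^-1` C) \is a fin_num.
      move=> mC; apply: fin_num_measure; rewrite -[S in measurable S]setTI.
      exact: (measurableT_comp mphi (mMs l)).
    by rewrite EFinM !fineK ?fP.
  apply: filterS => w; apply: cvg_near_eq; apply: nearW => n.
  by rewrite /avg big_add1.
(* [yhat0] is an arbitrary version, so it is first identified almost everywhere with the linear
   predictor of [model_regression] evaluated at copy 0. *)
have L0 : {ae P, forall w, yhat0 w = dot th (rU (Ms 0%N w)) + b0}.
  have [yhatG iyhat yhatE] := h_yhat0.
  have mzx : measurable_fun setT (fun w => (zs 0%N w, xs 0%N w)) by apply: measurable_fun_pair.
  have idot : intg P (fun w => dot th (rU (Ms 0%N w)) + b0).
    apply: intgD; last exact: intg_cst.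
    under eq_fun do rewrite dotE; apply: intg_sum => j _; apply: intgZ.
    exact: (same_law_intg mM0 (mMs 0%N) (h_copy 0%N) (mr j) (ir j)).
  have ieta := same_law_intg mM0 (mMs 0%N) (h_copy 0%N) meta Ex_eta0.1.
  have ysE w : ys 0%N w = etaU (Ms 0%N w) + (dot th (rU (Ms 0%N w)) + b0) by rewrite /etaU subrK.
  apply: (ae_eq_of_integrals mzx) => //.
  - move=> _ [B mB <-].
    pose lin (v : q.-tuple R * R) := dot th (col_mx (tuple_col v.1) (powers k v.2)) + b0.
    exists (lin @^-1` B); last by rewrite !setTI.
    rewrite -[S in measurable S]setTI; have : measurable_fun setT lin.
      apply: measurable_funD => //; under eq_fun do rewrite dotE.
      apply: measurable_fun_bigsum => j; apply: measurable_funM => //.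
      case: (split_ordP j) => i ->.
        under eq_fun do rewrite col_mxEu mxE.
        exact: (measurableT_comp (measurable_tnth i) (@measurable_fst _ _ _ _)).
      by under eq_fun do rewrite col_mxEd mxE; apply: measurable_funX; exact: measurable_snd.
    by apply.
  - move=> A GA; have mA : measurable A by case: GA => B mB <-; exact: mzx.
    have -> : Ex P (fun w => yhat0 w * \1_A w) = Ex P (fun w => ys 0%N w * \1_A w).
      by rewrite -(Ex_setE P yhat0 mA) -(Ex_setE P (ys 0%N) mA); congr fine; exact: yhatE.
    case: GA => B mB AE.
    (* An event of the conditioning sigma-algebra is a condition on [(z, x)] of copy 0; transfer of
       laws reduces the claim to the original model. *)
    have etaB : Ex P (fun w => etaU (Ms 0%N w) * \1_A w) = 0.
      have mphi : measurable_fun setT (fun u : U => etaU u * \1_B (u.1.1.1.1.1.2, u.1.2)).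
        apply: measurable_funM => //; apply: measurableT_comp; first exact: measurable_indic.
        exact: measurable_fun_pair.
      have iphi : intg P0 (fun w => etaU (M0 w) * \1_B (z w, x w)).
        have mzx0 : measurable_fun setT (fun w => (z w, x w)) by apply: measurable_fun_pair.
        apply: (intgMindic (A := (fun w => (z w, x w)) @^-1` B)); last exact: Ex_eta0.1.
        by rewrite -[S in measurable S]setTI; exact: mzx0.
      have := same_law_Ex mM0 (mMs 0%N) (h_copy 0%N) mphi iphi.
      rewrite /= (_ : Ex P0 _ = 0).
        by move=> <-; apply: eq_Rintegral => w _; rewrite -AE setTI.
      by rewrite -(HB B mB); apply: eq_Rintegral => w _; rewrite etaE.
    under eq_Rintegral do rewrite ysE mulrDl.
    by rewrite ExD ?etaB ?add0r//; exact: intgMindic.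
have cvg_y : {ae P, forall w, ytilde0 n w @[n --> \oo] --> yhat0 w}.
  have c1 : {ae P, forall w, forall a, avg n (fun i => rU (Ms i w) a 0) @[n --> \oo] -->
      Ex P0 (fun w => rU (M0 w) a 0)}.
    by apply: filter_forall => a; apply: slln_copy (mr a) (ir a).
  have c2 : {ae P, forall w, forall a, forall a', avg n (fun i => rU (Ms i w) a 0 * rU (Ms i w) a' 0)
      @[n --> \oo] --> Ex P0 (fun w => rU (M0 w) a 0 * rU (M0 w) a' 0)}.
    apply: filter_forall => a; apply: filter_forall => a'.
    apply: (slln_copy (fun u => rU u a 0 * rU u a' 0)); last exact: irr.
    exact: measurable_funM.
  have c3 : {ae P, forall w, avg n (fun i => etaU (Ms i w)) @[n --> \oo] --> 0}.
    by rewrite -Ex_eta0.2; apply: slln_copy => //; exact: Ex_eta0.1.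
  have c4 : {ae P, forall w, forall a, avg n (fun i => rU (Ms i w) a 0 * etaU (Ms i w))
      @[n --> \oo] --> 0}.
    apply: filter_forall => a; rewrite -(Ex_reta0 a).2.
    apply: (slln_copy (fun u => rU u a 0 * etaU u)); last exact: (Ex_reta0 a).1.
    exact: measurable_funM.
  (* On the intersection of these almost sure events the deterministic limit applies path by path,
     with the regressors of copy 0 on that path as prediction point. *)
  have := ae_and c1 (ae_and c2 (ae_and c3 (ae_and c4 L0))).
  apply: filterS => w [h1 [h2 [h3 [h4 hL]]]]; rewrite hL.
  apply: (@ols_predictor_cvg R q k _ _ _ th b0 (\col_a Ex P0 (fun w => rU (M0 w) a 0))
    (\matrix_(a, a') Ex P0 (fun w => rU (M0 w) a 0 * rU (M0 w) a' 0))).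
  - by move=> a; rewrite mxE; exact: h1.
  - by move=> a a'; rewrite mxE; exact: h2.
  - exact: h3.
  - exact: h4.
  - move: unitS; set A1 := (X in X \in _); set A2 := (X in _ -> X \in _).
    by suff -> : A1 = A2 by []; apply/matrixP => a a'; rewrite !mxE.
split => // tau tau0 p hp.
have mzx : measurable_fun setT (fun w => (zs 0%N w, xs 0%N w)) by apply: measurable_fun_pair.
(* The versions [p n] are constrained from [n = 1] on only; the shift is undone at the end. *)
have := @cond_probability_cvg0 _ T R P _ _ _ mzx
  (fun n => [set w | tau < `|ytilde0 n.+1 w - yhat0 w|]) (fun n => p n.+1) (fun n => hp n.+1 isT).
move=> H; have /H : P.-negligible (lim_sup_set (fun n => [set w | tau < `|ytilde0 n.+1 w - yhat0 w|])).
  (* A point lying in infinitely many of the events is a point where convergence fails, so the null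
     set of [cvg_y] contains the limsup. *)
  case: cvg_y => N [mN N0 cN]; exists N; split => // w Ew; apply: cN => /= cw.
  have /cvgrPdist_le/(_ _ tau0)[n _ hn] := cw.
  have [j /= nj] := Ew n I; rewrite ltNge distrC => /negP; apply.
  by apply: hn; rewrite /= ltnW.
apply: filterS => w; rewrite -(@cvg_shiftS _ (fun n => p n w)).
exact.
Qed.
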